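(* For every nonempty open set $\mathcal{U}\subset \mathrm{Diff}^\infty_{vol}(\mathbb{T}^2)$ there is a finitely supported probability measure $\mu$ on $\mathrm{Diff}^\infty_{vol}(\mathbb{T}^2)$ whose support is contained in $\mathcal{U}$ and such that $\mu$ is uniformly expanding.
   Context: $\mathbb{T}^2=\mathbb{R}^2/\mathbb{Z}^2$ carries the flat metric and the normalized Lebesgue measure $\mathrm{vol}$. $\mathrm{Diff}^\infty_{vol}(\mathbb{T}^2)$ is the space of $C^\infty$ diffeomorphisms of $\mathbb{T}^2$ preserving $\mathrm{vol}$, with the $C^\infty$ topology. For a probability measure $\mu$ on diffeomorphisms, $\mu^{(1)}=\mu$ and $\mu^{(n)}=\mu\ast\mu^{(n-1)}$; that is, $\mu^{(n)}$ is the pushforward of the product measure $\mu^n$ under composition of $n$ diffeomorphisms. The measure $\mu$ is uniformly expanding if there exists an integer $N>0$ such that for every $x\in\mathbb{T}^2$ and every unit vector $v\in T_x\mathbb{T}^2$, $\int \log\|D_xf\,v\|\,d\mu^{(N)}(f)>2$. *)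

(* Defs.v *)
From HB Require Import structures.
From mathcomp Require Import all_boot all_order all_algebra.
From mathcomp Require Import generic_quotient.
From mathcomp Require Import all_classical all_reals all_analysis.

Set Implicit Arguments.
Unset Strict Implicit.
Unset Printing Implicit Defensive.

Import Order.TTheory GRing.Theory Num.Theory.
Import numFieldNormedType.Exports.

Local Open Scope classical_set_scope.
Local Open Scope ring_scope.

(** * The flat torus *)

Notation plane R := (R * R)%type (only parsing).

(* The library norm on [R * R] is the max norm, hence a separate definition. *)
Definition enorm (R : realType) (v : plane R) : R :=
  Num.sqrt (v.1 ^+ 2 + v.2 ^+ 2).

Definition equivZ2 (R : realType) (p q : plane R) : bool :=
  (p.1 - q.1 \is a Num.int) && (p.2 - q.2 \is a Num.int).

Section torus.
Context (R : realType).

Lemma equivZ2_refl : reflexive (@equivZ2 R).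
Proof. by move=> p; rewrite /equivZ2 !subrr !rpred0. Qed.

Lemma equivZ2_sym : symmetric (@equivZ2 R).
Proof.
by move=> p q; rewrite /equivZ2 -(opprB q.1) -(opprB q.2) !rpredN.
Qed.

Lemma equivZ2_trans : transitive (@equivZ2 R).
Proof.
move=> q p r /andP[h1 h2] /andP[k1 k2]; apply/andP; split.
- by rewrite -(subrK q.1 p.1) -addrA rpredD.
- by rewrite -(subrK q.2 p.2) -addrA rpredD.
Qed.

Canonical equivZ2_equiv :=
  EquivRel (@equivZ2 R) equivZ2_refl equivZ2_sym equivZ2_trans.

Definition torus := {eq_quot (@equivZ2 R)}%qT.

HB.instance Definition _ := Choice.on torus.

Definition tpi (p : plane R) : torus := (\pi_torus p)%qT.

HB.instance Definition _ := isPointed.Build torus (tpi 0).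

(* Distance of the flat metric. *)
Definition tdist (x y : torus) : R :=
  inf [set enorm (p - q) | p in tpi @^-1` [set x] & q in tpi @^-1` [set y]].

(* A set is measurable in the torus when its preimage in the plane is Borel. *)
Definition torus_measurable : set (set torus) :=
  [set A | measurable
     (tpi @^-1` A : set (measurableTypeR R * measurableTypeR R)) ].

Lemma torus_measurable0 : torus_measurable set0.
Proof. by rewrite /torus_measurable/= preimage_set0. Qed.

Lemma torus_measurableC A : torus_measurable A -> torus_measurable (~` A).
Proof. by rewrite /torus_measurable/= preimage_setC; exact: measurableC. Qed.

Lemma torus_measurable_bigcup (F : (set torus)^nat) :
  (forall i, torus_measurable (F i)) -> torus_measurable (\bigcup_i F i).
Proof.
move=> mF; rewrite /torus_measurable/= preimage_bigcup.
by apply: bigcup_measurable => i _; exact: mF.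
Qed.

HB.instance Definition _ := isMeasurable.Build default_measure_display torus
  torus_measurable0 torus_measurableC torus_measurable_bigcup.

Definition vol (A : set torus) : \bar R :=
  (@lebesgue_measure R \x @lebesgue_measure R)%E
    (tpi @^-1` A `&` (`[0, 1[ `*` `[0, 1[)).

End torus.

(** * Smooth maps of the torus *)

Section smooth.
Context (R : realType).
Implicit Types (F G : plane R -> plane R) (f g : torus R -> torus R).

Definition basis2 (i : bool) : plane R := if i then (0, 1) else (1, 0).

Definition partials (s : seq bool) F : plane R -> plane R :=
  foldr (fun i G p => 'D_(basis2 i) G p) F s.

Definition smooth_near F (p : plane R) :=
  \forall q \near p, forall s, differentiable (partials s F) q.

(* The charts of R^2/Z^2 are the local inverses of [tpi]: [F] is the expression
   of [f] in charts around [tpi p] and [f (tpi p)]. *)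
Definition smooth_lift f (p : plane R) F :=
  (\forall q \near p, tpi (F q) = f (tpi q)) /\ smooth_near F p.

Definition tsmooth f := forall p, exists F, smooth_lift f p F.

(* [F] is only meaningful near [repr x]; two smooth lifts of [f] differ there by
   a constant of Z^2, so that derivatives do not depend on the choice. *)
Definition lift f (x : torus R) : plane R -> plane R :=
  get [set F | smooth_lift f (repr x) F].

(* Tangent spaces are identified with the plane through the differential of
   [tpi], which carries the flat metric to the Euclidean one. *)
Definition tdiff f (x : torus R) (v : plane R) : plane R :=
  'd (lift f x) (repr x) v.

Definition tpartials (s : seq bool) f (x : torus R) : plane R :=
  partials s (lift f x) (repr x).

Definition preserves_vol f :=
  measurable_fun setT f /\ forall A, measurable A -> vol (f @^-1` A) = vol A.

Definition voldiff f :=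
  [/\ tsmooth f,
      exists g, [/\ tsmooth g, cancel f g & cancel g f] &
      preserves_vol f].

End smooth.

Section smooth_comp.
Context (R : realType).
Implicit Types (F G : plane R -> plane R) (f g : torus R -> torus R).

Lemma near_differentiable (V W : normedModType R) (f g : V -> W) (a : V) :
  (\forall b \near a, f b = g b) -> differentiable f a -> differentiable g a.
Proof.
move=> fg df.
have -> : g = f + (g - f) by apply/funext => b; rewrite !fctE addrC subrK.
apply: differentiableD => //.
set k := g - f.
have k0 : \forall b \near a, k b = 0.
  near=> b; rewrite /k !fctE; apply/eqP; rewrite subr_eq0 eq_sym; apply/eqP.
  by near: b.
have kl : k \o shift a = cst (k a) + (\0 : {linear V -> W}) +o_ 0 id.
  apply/eqaddoP => e e0.
  have := k0; rewrite (near_shift 0) /= => k0'.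
  near=> h.
  have kh : k (h + a) = 0 by near: h; move: k0'; rewrite subr0.
  by rewrite !fctE /= kh (nbhs_singleton k0) addr0 subr0 normr0 mulr_ge0 // ltW.
have c0 : continuous (\0 : {linear V -> W}) by move=> x; exact: cvg_cst.
apply/diff_locallyP; rewrite (diff_unique c0 kl); split => //.
Unshelve. all: by end_near. Qed.

Lemma fst_cont (V W : normedModType R) : continuous (@fst V W).
Proof. by move=> x; exact: cvg_fst. Qed.
Lemma snd_cont (V W : normedModType R) : continuous (@snd V W).
Proof. by move=> x; exact: cvg_snd. Qed.


Lemma is_diff_fst (V W : normedModType R) (x : V * W) : is_diff x fst fst.
Proof.
have lin : linear (@fst V W) by [].
pose linM := GRing.isLinear.Build _ _ _ _ _ lin.
pose L : {linear (V * W)%type -> V} := HB.pack (@fst V W) linM.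
apply: DiffDef; first exact: (@linear_differentiable _ _ _ L x (@fst_cont V W)).
by rewrite (@diff_lin _ _ _ L x (@fst_cont V W)).
Qed.

Lemma is_diff_snd (V W : normedModType R) (x : V * W) : is_diff x snd snd.
Proof.
have lin : linear (@snd V W) by [].
pose linM := GRing.isLinear.Build _ _ _ _ _ lin.
pose L : {linear (V * W)%type -> W} := HB.pack (@snd V W) linM.
apply: DiffDef; first exact: (@linear_differentiable _ _ _ L x (@snd_cont V W)).
by rewrite (@diff_lin _ _ _ L x (@snd_cont V W)).
Qed.

Lemma differentiable_fst (F : plane R -> plane R) (q : plane R) :
  differentiable F q -> differentiable (fst \o F) q.
Proof.
move=> dF; apply: differentiable_comp => //.
by have [] := @is_diff_fst R R (F q).
Qed.

Lemma differentiable_snd (F : plane R -> plane R) (q : plane R) :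
  differentiable F q -> differentiable (snd \o F) q.
Proof.
move=> dF; apply: differentiable_comp => //.
by have [] := @is_diff_snd R R (F q).
Qed.

Lemma derive_fst (F : plane R -> plane R) (q v : plane R) :
  differentiable F q -> 'D_v (fst \o F) q = ('D_v F q).1.
Proof.
move=> dF; have [df e] := @is_diff_fst R R (F q).
by rewrite !deriveE //; [rewrite diff_comp //= e|exact: differentiable_fst].
Qed.

Lemma derive_snd (F : plane R -> plane R) (q v : plane R) :
  differentiable F q -> 'D_v (snd \o F) q = ('D_v F q).2.
Proof.
move=> dF; have [df e] := @is_diff_snd R R (F q).
by rewrite !deriveE //; [rewrite diff_comp //= e|exact: differentiable_snd].
Qed.

Lemma linear_basis2 (L : {linear (R * R)%type -> (R * R)%type}) (w : plane R) :
  L w = w.1 *: L (basis2 R false) + w.2 *: L (basis2 R true).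
Proof.
rewrite -!linearZ -linearD; congr (L _).
case: w => a b; rewrite /basis2; congr pair => /=.
- by rewrite /GRing.scale /= mulr1 mulr0 addr0.
- by rewrite /GRing.scale /= mulr1 mulr0 add0r.
Qed.

Lemma derive_compE (F K : plane R -> plane R) (q v : plane R) :
  differentiable F q -> differentiable K (F q) ->
  'D_v (K \o F) q = ('D_v F q).1 *: 'D_(basis2 R false) K (F q) +
                    ('D_v F q).2 *: 'D_(basis2 R true) K (F q).
Proof.
move=> dF dK.
rewrite !(deriveE _ dK).
rewrite !(deriveE _ dF).
have -> : 'D_v (K \o F) q = 'd K (F q) ('d F q v).
  rewrite deriveE; last exact: differentiable_comp.
  exact: (congr1 (fun h : plane R -> plane R => h v) (diff_comp dF dK)).
exact: linear_basis2.
Qed.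

(* All the iterated partial derivatives of [G \o F] have their coordinates in
   the algebra generated by those of [F], and those of [G] composed with [F]. *)
Inductive chain_alg F G : (plane R -> R) -> Prop :=
| chain_F1 s : chain_alg F G (fst \o partials s F)
| chain_F2 s : chain_alg F G (snd \o partials s F)
| chain_G1 s : chain_alg F G (fst \o (partials s G \o F))
| chain_G2 s : chain_alg F G (snd \o (partials s G \o F))
| chain_D h k : chain_alg F G h -> chain_alg F G k -> chain_alg F G (h + k)
| chain_M h k : chain_alg F G h -> chain_alg F G k -> chain_alg F G (h * k).

Section chain_alg.
Variables (F G : plane R -> plane R) (A : set (plane R)).
Hypothesis openA : open A.
Hypothesis dF : forall q, A q -> forall s, differentiable (partials s F) q.
Hypothesis dG : forall q, A q -> forall s, differentiable (partials s G) (F q).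

Lemma chain_alg_diff h q : chain_alg F G h -> A q -> differentiable h q.
Proof.
move=> Ph Aq; elim: Ph => [s|s|s|s|{}h k _ dh _ dk|{}h k _ dh _ dk].
- exact/differentiable_fst/dF.
- exact/differentiable_snd/dF.
- apply/differentiable_fst/differentiable_comp; last exact: dG.
  exact: (dF Aq [::]).
- apply/differentiable_snd/differentiable_comp; last exact: dG.
  exact: (dF Aq [::]).
- exact: differentiableD.
- exact: differentiableM.
Qed.

Lemma chain_alg_derive h i : chain_alg F G h ->
  exists2 h', chain_alg F G h' & forall q, A q -> 'D_(basis2 R i) h q = h' q.
Proof.
have dF0 q : A q -> differentiable F q by move=> Aq; exact: (dF Aq [::]).
elim=> [s|s|s|s|{}h k Ph [h' Ph' hE] Pk [k' Pk' kE]
       |{}h k Ph [h' Ph' hE] Pk [k' Pk' kE]].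
- exists (fst \o partials (i :: s) F); first exact: chain_F1.
  by move=> q Aq; rewrite derive_fst //; exact: dF.
- exists (snd \o partials (i :: s) F); first exact: chain_F2.
  by move=> q Aq; rewrite derive_snd //; exact: dF.
- exists ((fst \o partials [:: i] F) * (fst \o (partials (false :: s) G \o F))
    + (snd \o partials [:: i] F) * (fst \o (partials (true :: s) G \o F))).
    by apply: chain_D; apply: chain_M; constructor.
  move=> q Aq; rewrite derive_fst; last by apply: differentiable_comp;
    [exact: dF0|exact: dG].
  by rewrite derive_compE //; [exact: dF0|exact: dG].
- exists ((fst \o partials [:: i] F) * (snd \o (partials (false :: s) G \o F))
    + (snd \o partials [:: i] F) * (snd \o (partials (true :: s) G \o F))).
    by apply: chain_D; apply: chain_M; constructor.
  move=> q Aq; rewrite derive_snd; last by apply: differentiable_comp;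
    [exact: dF0|exact: dG].
  by rewrite derive_compE //; [exact: dF0|exact: dG].
- exists (h' + k'); first exact: chain_D.
  move=> q Aq; rewrite deriveD ?hE ?kE //;
    exact/diff_derivable/chain_alg_diff.
- exists (h * k' + k * h'); first by apply: chain_D; apply: chain_M.
  move=> q Aq; rewrite deriveM ?hE ?kE //;
    exact/diff_derivable/chain_alg_diff.
Qed.

Lemma chain_alg_partials s : exists h1 h2,
  [/\ chain_alg F G h1, chain_alg F G h2 &
      forall q, A q -> partials s (G \o F) q = (h1 q, h2 q)].
Proof.
elim: s => [|i s [h1 [h2 [P1 P2 E]]]].
  exists (fst \o (partials [::] G \o F)), (snd \o (partials [::] G \o F)).
  split; [exact: chain_G1|exact: chain_G2|].
  by move=> q _ /=; rewrite -surjective_pairing.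
have [h1' P1' E1] := chain_alg_derive i P1.
have [h2' P2' E2] := chain_alg_derive i P2.
exists h1', h2'; split => // q Aq.
pose h p := (h1 p, h2 p).
have dh : differentiable h q by apply: differentiable_pair; exact: chain_alg_diff.
transitivity ('D_(basis2 R i) h q).
  apply: near_eq_derive; near=> r; apply: E; near: r.
  exact: open_nbhs_nbhs.
rewrite [LHS]surjective_pairing -derive_fst // -derive_snd //.
by rewrite -E1 // -E2.
Unshelve. all: by end_near. Qed.

Lemma differentiable_partials_comp s q :
  A q -> differentiable (partials s (G \o F)) q.
Proof.
move=> Aq; have [h1 [h2 [P1 P2 E]]] := chain_alg_partials s.
apply: (@near_differentiable _ _ (fun p => (h1 p, h2 p))).
  near=> r; apply/esym/E; near: r; exact: open_nbhs_nbhs.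
by apply: differentiable_pair; exact: chain_alg_diff.
Unshelve. all: by end_near. Qed.

End chain_alg.

Lemma smooth_near_comp F G p :
  smooth_near F p -> smooth_near G (F p) -> smooth_near (G \o F) p.
Proof.
move=> sF sG.
have cF : {for p, continuous F}.
  by apply: differentiable_continuous; exact: (nbhs_singleton sF [::]).
have sGF := cF _ sG.
pose B := [set q | (forall s, differentiable (partials s F) q) /\
                   (forall s, differentiable (partials s G) (F q))].
have : nbhs p B by apply: filterI.
rewrite nbhsE => -[A [oA Ap] AB].
near=> q; move=> s; apply: (@differentiable_partials_comp F G A) => //.
- by move=> r /AB[].
- by move=> r /AB[].
- by near: q; exact: open_nbhs_nbhs.
Unshelve. all: by end_near. Qed.

Lemma smooth_lift_comp f g p F G : smooth_lift g p F -> smooth_lift f (F p) G ->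
  smooth_lift (f \o g) p (G \o F).
Proof.
move=> [gF sF] [fG sG]; split; last exact: smooth_near_comp.
have cF : {for p, continuous F}.
  by apply: differentiable_continuous; exact: (nbhs_singleton sF [::]).
have fGF := cF _ fG.
near=> q => /=.
have -> : tpi (G (F q)) = f (tpi (F q)) by near: q.
by congr f; near: q.
Unshelve. all: by end_near. Qed.

Lemma tsmooth_comp f g : tsmooth f -> tsmooth g -> tsmooth (f \o g).
Proof.
move=> sf sg p; have [F lF] := sg p; have [G lG] := sf (F p).
by exists (G \o F); exact: smooth_lift_comp.
Qed.

Lemma partials_id s : exists c : plane R,
  partials s (@idfun (plane R)) = cst c \/ partials s (@idfun (plane R)) = idfun.
Proof.
elim: s => [|i s [c [E|E]]]; first by exists 0; right.
- exists 0; left; apply/funext => p /=; rewrite E; exact: derive_cst.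
- exists (basis2 R i); left; apply/funext => p /=; rewrite E; exact: derive_id.
Qed.

Lemma tsmooth_id : tsmooth (@idfun (torus R)).
Proof.
move=> p; exists idfun; split; first by near=> q.
near=> q; move=> s; have [c [->|->]] := partials_id s.
- exact: differentiable_cst.
- by have [] := is_diff_id q.
Unshelve. all: by end_near. Qed.

Lemma preserves_vol_comp f g :
  preserves_vol f -> preserves_vol g -> preserves_vol (f \o g).
Proof.
move=> [mf vf] [mg vg]; split; first exact: measurableT_comp.
move=> A mA; rewrite comp_preimage vg ?vf //.
by rewrite -[_ @^-1` _]setTI; exact: mf.
Qed.

Lemma voldiff_comp f g : voldiff f -> voldiff g -> voldiff (f \o g).
Proof.
move=> [sf [f' [sf' f'K fK']] vf] [sg [g' [sg' g'K gK']] vg]; split.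
- exact: tsmooth_comp.
- exists (g' \o f'); split; first exact: tsmooth_comp.
  + by move=> x /=; rewrite f'K g'K.
  + by move=> x /=; rewrite gK' fK'.
- exact: preserves_vol_comp.
Qed.

Lemma voldiff_id : voldiff (@idfun (torus R)).
Proof.
split; first exact: tsmooth_id.
- by exists idfun; split=> //; exact: tsmooth_id.
- by split; first exact: measurable_id.
Qed.

End smooth_comp.

(** * Volume-preserving diffeomorphisms with the C^oo topology *)

Section DiffVol.
Context (R : realType).

Record DiffVol := {
  diffvol_fun :> torus R -> torus R;
  diffvolP : voldiff diffvol_fun }.

HB.instance Definition _ := gen_eqMixin DiffVol.
HB.instance Definition _ := gen_choiceMixin DiffVol.

Definition diffvol_id : DiffVol := Build_DiffVol (voldiff_id R).

Definition diffvol_comp (f g : DiffVol) : DiffVol :=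
  Build_DiffVol (voldiff_comp (diffvolP f) (diffvolP g)).

HB.instance Definition _ := isPointed.Build DiffVol diffvol_id.

(* The values are compared in the torus, the derivatives in the plane. *)
Definition Ck_ball (k : nat) (e : R) (f : DiffVol) : set DiffVol :=
  [set g : DiffVol | forall x : torus R,
     tdist (f x) (g x) < e /\
     (forall s, (0 < size s <= k)%N ->
        enorm (tpartials s f x - tpartials s g x : plane R) < e)].

(* The topology of uniform convergence of all derivatives. *)
Definition Coo_open : set (set DiffVol) :=
  [set U | forall f, U f -> exists k e, 0 < e /\ Ck_ball k e f `<=` U].

Lemma Coo_openT : Coo_open setT.
Proof. by move=> f _; exists 0%N, 1. Qed.

Lemma Ck_ball_le k l (d e : R) f :
  (k <= l)%N -> e <= d -> Ck_ball l e f `<=` Ck_ball k d f.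
Proof.
move=> kl ed g fg x; have [fg0 fgs] := fg x; split.
  exact: lt_le_trans ed.
move=> s /andP[s0 sk]; apply: lt_le_trans ed; apply: fgs.
by rewrite s0 (leq_trans sk).
Qed.

Lemma Coo_openI : setI_closed Coo_open.
Proof.
move=> U V oU oV f [/oU[k [d [d0 dU]]] /oV[l [e [e0 eV]]]].
exists (maxn k l), (Num.min d e); split; first by rewrite lt_min d0.
move=> g fg; split; [apply: dU|apply: eV]; apply: Ck_ball_le fg;
  by rewrite ?leq_maxl ?leq_maxr // ge_min lexx ?orbT.
Qed.

Lemma Coo_open_bigU (I : Type) (F : I -> set DiffVol) :
  (forall i, Coo_open (F i)) -> Coo_open (\bigcup_i F i).
Proof.
move=> oF f [i _ /oF[k [e [e0 eF]]]]; exists k, e; split => //.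
by move=> g /eF; exists i.
Qed.

HB.instance Definition _ :=
  isOpenTopological.Build DiffVol Coo_openT Coo_openI Coo_open_bigU.

End DiffVol.

(** * Uniform expansion *)

Notation DiffVolBorel R := (g_sigma_algebraType (@open (DiffVol R))).

Section expansion.
Context (R : realType).

Local Open Scope ereal_scope.

Definition convolution (mu nu : set (DiffVolBorel R) -> \bar R) :
    set (DiffVolBorel R) -> \bar R :=
  pushforward (mu \x nu)
    (fun fg : DiffVolBorel R * DiffVolBorel R =>
       diffvol_comp fg.1 fg.2 : DiffVolBorel R).

(* [convpow mu n] is mu^(n) for [0 < n]; the value at 0 is irrelevant. *)
Definition convpow (mu : set (DiffVolBorel R) -> \bar R) (n : nat) :
    set (DiffVolBorel R) -> \bar R :=
  iter n.-1 (convolution mu) mu.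

Definition uniformly_expanding (mu : set (DiffVolBorel R) -> \bar R) : Prop :=
  exists N : nat, (0 < N)%N /\
    forall (x : torus R) (v : plane R), enorm v = 1%R ->
      2%:E < \int[convpow mu N]_f (ln (enorm (tdiff (f : DiffVol R) x v)))%:E.

Definition finitely_supported (mu : set (DiffVolBorel R) -> \bar R) : Prop :=
  exists2 F : set (DiffVolBorel R), finite_set F & mu F = 1.

Definition msupport (mu : set (DiffVolBorel R) -> \bar R) : set (DiffVol R) :=
  [set f | forall V : set (DiffVol R), open V -> V f -> 0 < mu V].

End expansion.

(* Main.v *)
Require Import Defs.
From HB Require Import structures.
From mathcomp Require Import all_boot all_order all_algebra.
From mathcomp Require Import generic_quotient.
From mathcomp Require Import all_classical all_reals all_analysis.
From mathcomp Require Import measurable_realfun.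
From mathcomp Require Import zify ring lra.

Set Implicit Arguments.
Unset Strict Implicit.
Unset Printing Implicit Defensive.

Import Order.TTheory GRing.Theory Num.Theory.
Import numFieldNormedType.Exports.

Local Open Scope classical_set_scope.
Local Open Scope ring_scope.

(** Fix [f0] in the open set. The measure is uniform on the maps
    [transl a \o twist \o kick \o f0], where the kicks and the twists are small
    shears with trigonometric profile and [a] runs through a fine grid of small
    translations.

    Kicks. Some fourth-power norm [qnorm] on the plane is such that [1 / qnorm]
    decreases by a factor [r < 1] when averaged over the kicks and their inverses,
    whatever the base point. By Schur's test, averaging over the kicks has norm at
    most [r] on [L^2] of the tangent bundle; the other maps act on that space by
    isometries. Hence the probability that a word of length [N] sends a vector into
    a fixed box has [L^2] norm [O (r ^ N)].

    Grid. A word whose derivative at a point has norm at most [M] sends an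
    open set of tangent vectors of area of order [M ^- 2] into that box, and so does
    its derivative at nearby points. The [L^2] bound then shows that, for most
    points of a translate of the grid, most words have norm at least
    [M = r ^ (- N / 2)].

    Twists. For a linear map [A] of determinant 1 and a vector [w], only few of the
    twists send [w] close to the direction contracted by [A], so that [ln |A w|]
    averages to at least [ln |A| / 2 - C] over the twists. The twists move the base
    point by different amounts; since the grid of translations is much larger than
    those displacements and finer than the modulus of continuity of the derivatives
    of the words, the resulting grids can be matched up to a small proportion. *)

(** Expansion is required at every point and in every direction, while an L^2 bound only yields
    proportions. Hence a word has [N + 1] letters: the one applied first spreads the initial vector
    over a grid of points and over several directions, and the other [N] stretch it. A circularity
    threatens, since the grid enters the law of the words whose modulus of continuity dictates its
    mesh. Two uniformities remove it: the rate of decay is that of the kicks alone, whatever is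
    composed after them, and the modulus of continuity of words of length [N] holds for arbitrary
    translations between the letters. The extent of the grid, the kicks and the twists are therefore
    fixed before [N], and the mesh after it; [N] depends on the extent but not on the mesh, because
    refining the mesh multiplies the number of grid points and the bound on the bad ones alike. Near
    the border of the grid no matching is available and a word may contract by an amount exponential
    in [N]. The border has to be so thin that this loss, in logarithms linear in [N], stays below
    the gain. *)

Section average.
Context (R : realType).

Definition avg (T : Type) (s : seq T) (F : T -> R) : R :=
  (size s)%:R^-1 * \sum_(t <- s) F t.

Lemma avg_ge0 (T : Type) (s : seq T) (F : T -> R) :
  (forall t, 0 <= F t) -> 0 <= avg s F.
Proof. by move=> F0; rewrite mulr_ge0// sumr_ge0. Qed.

Lemma eq_avg (T : Type) (s : seq T) (F G : T -> R) : F =1 G -> avg s F = avg s G.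
Proof. by move=> FG; congr (_ * _); apply: eq_bigr => t _. Qed.

Lemma ler_avg (T : eqType) (s : seq T) (F G : T -> R) :
  {in s, forall t, F t <= G t} -> avg s F <= avg s G.
Proof.
move=> FG; rewrite ler_wpM2l// big_seq [leRHS]big_seq.
by apply: ler_sum => t /FG.
Qed.

Lemma avgD (T : Type) (s : seq T) (F G : T -> R) :
  avg s (fun t => F t + G t) = avg s F + avg s G.
Proof. by rewrite /avg big_split mulrDr. Qed.

Lemma avgZ (T : Type) (s : seq T) (k : R) (F : T -> R) :
  avg s (fun t => k * F t) = k * avg s F.
Proof. by rewrite /avg /= -mulr_sumr mulrCA. Qed.

Lemma avg_cst (T : Type) (s : seq T) (k : R) :
  (0 < size s)%N -> avg s (fun=> k) = k.
Proof.
move=> s0; rewrite /avg big_const_seq count_predT iter_addr addr0 -(mulr_natr k).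
by rewrite mulrC mulfK// pnatr_eq0 -lt0n.
Qed.

Lemma avg_exchange (S T : Type) (s : seq S) (t : seq T) (F : S -> T -> R) :
  avg s (fun x => avg t (F x)) = avg t (fun y => avg s (F^~ y)).
Proof.
rewrite /avg /= -!mulr_sumr mulrCA.
by congr (_ * (_ * _)); exact: exchange_big.
Qed.

Lemma avg_map (S T : Type) (s : seq S) (h : S -> T) (F : T -> R) :
  avg (map h s) F = avg s (F \o h).
Proof. by rewrite /avg size_map big_map. Qed.

Lemma avg_allpairs (S T U : Type) (s : seq S) (t : seq T) (h : S -> T -> U)
    (F : U -> R) :
  avg (allpairs h s t) F = avg s (fun x => avg t (fun y => F (h x y))).
Proof.
rewrite /avg size_allpairs natrM invfM big_allpairs_dep /= -mulr_sumr.
by rewrite -mulrA.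
Qed.

(* Cauchy-Schwarz with the weights [a]. *)
Lemma avg_sqr (T : eqType) (s : seq T) (a F G : T -> R) :
  {in s, forall t, [/\ 0 <= a t, 0 <= G t & F t ^+ 2 <= a t * G t]} ->
  avg s F ^+ 2 <= avg s a * avg s G.
Proof.
move=> h.
rewrite /avg exprMn [leRHS]mulrACA -[X in _ <= X * _]expr2 ler_wpM2l ?sqr_ge0//.
rewrite -(ler_pM2l (ltr0n R 2)) expr2 [X in _ <= X](_ : _ =
    \sum_(t <- s) \sum_(u <- s) (a t * G u + a u * G t)); last first.
  under [RHS]eq_bigr => t _ do rewrite big_split.
  by rewrite big_split /= -big_distrlr /= exchange_big -big_distrlr /=; ring.
rewrite big_distrlr /= mulr_sumr [leLHS]big_seq [leRHS]big_seq.
apply: ler_sum => t /h[]; move: (a t) (G t) (F t) => at_ gt ft at0 gt0 ht.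
rewrite mulr_sumr [leLHS]big_seq [leRHS]big_seq.
apply: ler_sum => u /h[]; move: (a u) (G u) (F u) => au gu fu au0 gu0 hu.
apply: le_trans (ler_norm _) _.
rewrite -(ler_pXn2r (n := 2)) ?nnegrE ?normr_ge0//; last first.
  by rewrite addr_ge0// mulr_ge0.
rewrite real_normK ?num_real//.
have : ft ^+ 2 * fu ^+ 2 <= (at_ * gt) * (au * gu).
  by apply: ler_pM => //; exact: sqr_ge0.
have := sqr_ge0 (at_ * gu - au * gt).
rewrite !expr2 => h1 h2; nra.
Qed.

End average.

(** * Integration against uniform measures on finite lists *)

Section uniform_measure.
Context d (T : measurableType d) (R : realType).
Local Open Scope ereal_scope.

Definition umeas (x0 : T) (s : seq T) : set T -> \bar R :=
  mscale (((size s).+1%:R : R)^-1%:nng)%R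
    (msum (fun i => \d_(nth x0 (x0 :: s) i)) (size s).+1).

Variables (x0 : T) (s : seq T).

HB.instance Definition _ := Measure.on (umeas x0 s).

Lemma umeasE (A : set T) :
  umeas x0 s A = (avg (x0 :: s) (fun t => \1_A t))%:E.
Proof.
rewrite /umeas /mscale /msum /avg EFinM -sumEFin /=; congr (_ * _).
rewrite [RHS](big_nth x0) big_mkord; apply: eq_bigr => i _.
by [].
Qed.

Lemma umeasT : umeas x0 s setT = 1.
Proof.
rewrite umeasE; congr EFin.
transitivity (avg (x0 :: s) (fun=> 1%R : R)); last by rewrite avg_cst.
by apply: eq_avg => t; rewrite indicE in_setT.
Qed.

HB.instance Definition _ := Measure_isProbability.Build _ _ _ (umeas x0 s) umeasT.

Import HBNNSimple.

Lemma ge0_integral_umeas_mfun (f : T -> R) : measurable_fun setT f ->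
  (forall t, (0 <= f t)%R) ->
  \int[umeas x0 s]_t (f t)%:E = (avg (x0 :: s) f)%:E.
Proof.
move=> mf f0; have /measurable_EFinP mEf := mf.
rewrite [LHS]ge0_integral_mscale//; last by move=> t _; rewrite lee_fin.
rewrite ge0_integral_measure_sum//; last by move=> t _; rewrite lee_fin.
rewrite /avg EFinM -sumEFin /=; congr (_ * _).
rewrite [RHS](big_nth x0) big_mkord; apply: eq_bigr => i _.
by rewrite integral_dirac// diracT mul1e.
Qed.

(** No measurability of [f] is assumed: the integral is a supremum over simple functions below [f],
    and since points are measurable, the measurable function [g] that agrees with [f] on the list
    and vanishes elsewhere already has the right integral. This spares a proof that the derivative
    depends measurably on the diffeomorphism. *)
Lemma ge0_integral_umeas (f : T -> R) : (forall t : T, measurable [set t]) ->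
  (forall t, (0 <= f t)%R) ->
  \int[umeas x0 s]_t (f t)%:E = (avg (x0 :: s) f)%:E.
Proof.
move=> m1 f0; pose s' := undup (x0 :: s).
pose g (t : T) := (\sum_(u <- s') f u * \1_[set u] t)%R.
have gE t : g t = if t \in s' then f t else 0%R.
  have [ts|ts] := ifPn.
    rewrite /g (bigD1_seq t)//= ?undup_uniq// big1 ?addr0 ?indicE.
      by rewrite mem_set// mulr1.
    by move=> u ut; rewrite indicE memNset ?mulr0//= => /esym/eqP; exact/negP.
  rewrite /g big_seq big1// => u us; rewrite indicE memNset ?mulr0//= => tu.
  by move: ts; rewrite tu us.
have mg : measurable_fun setT g.
  by apply: measurable_sum => u; exact: measurable_funM.
have g0 t : (0 <= g t)%R by rewrite gE; case: ifP.
have gf : avg (x0 :: s) g = avg (x0 :: s) f.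
  rewrite /avg; congr (_ * _)%R; rewrite !big_seq; apply: eq_bigr => t ts.
  by rewrite gE mem_undup ts.
apply/eqP; rewrite eq_le; apply/andP; split.
  rewrite ge0_integralTE; last by move=> t; rewrite lee_fin.
  apply: ge_ereal_sup => _ [h /= hf <-].
  rewrite -integralT_nnsfun ge0_integral_umeas_mfun// lee_fin.
  by apply: ler_avg => t _; have := hf t; rewrite lee_fin.
rewrite -gf -ge0_integral_umeas_mfun// !ge0_integralTE.
- apply: le_ereal_sup => _ [h /= hg <-]; exists h => // t.
  apply: le_trans (hg t) _; rewrite lee_fin gE; case: ifP => // _.
- by move=> t; rewrite lee_fin.
- by move=> t; rewrite lee_fin.
Qed.

Lemma integral_umeas (f : T -> R) : (forall t : T, measurable [set t]) ->
  \int[umeas x0 s]_t (f t)%:E = (avg (x0 :: s) f)%:E.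
Proof.
move=> m1; rewrite integralE.
rewrite (eq_integral (fun t => (Num.max (f t) 0)%:E))//; last first.
  by move=> t _; rewrite funeposE EFin_max.
rewrite [X in _ - X](eq_integral (fun t => (Num.max (- f t) 0)%:E))//; last first.
  by move=> t _; rewrite funenegE EFin_max.
rewrite !ge0_integral_umeas//; try by move=> t; rewrite le_max lexx orbT.
rewrite -EFinB; congr EFin.
rewrite -mulN1r -avgZ -avgD; apply: eq_avg => t.
rewrite mulN1r; case: (ltrP (f t) 0) => ft.
  by rewrite max_l ?oppr_ge0 ?ltW// sub0r opprK.
by rewrite max_r ?oppr_le0// subr0.
Qed.

End uniform_measure.

(** * The Euclidean norm and the flat distance *)

Section enorm.
Context (R : realType).
Implicit Types u v : plane R.

Lemma enorm_ge0 v : 0 <= enorm v. Proof. exact: sqrtr_ge0. Qed.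

Lemma sqr_enorm v : enorm v ^+ 2 = v.1 ^+ 2 + v.2 ^+ 2.
Proof. by rewrite sqr_sqrtr// addr_ge0// sqr_ge0. Qed.

Lemma ler_enorm v (x : R) : 0 <= x -> (enorm v <= x) = (v.1 ^+ 2 + v.2 ^+ 2 <= x ^+ 2).
Proof. by move=> x0; rewrite -sqr_enorm ler_pXn2r// nnegrE enorm_ge0. Qed.

Lemma enormZ (k : R) v : enorm (k *: v) = `|k| * enorm v.
Proof.
rewrite /enorm [(k *: v).1](_ : _ = k * v.1)// [(k *: v).2](_ : _ = k * v.2)//.
by rewrite !exprMn -mulrDr sqrtrM ?sqr_ge0// sqrtr_sqr.
Qed.

Lemma enormN v : enorm (- v) = enorm v.
Proof. by rewrite -scaleN1r enormZ normrN1 mul1r. Qed.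

Lemma enormB u v : enorm (u - v) = enorm (v - u).
Proof. by rewrite -enormN opprB. Qed.

Lemma enormD u v : enorm (u + v) <= enorm u + enorm v.
Proof.
rewrite ler_enorm ?addr_ge0 ?enorm_ge0// [leRHS]sqrrD !sqr_enorm.
rewrite [(u + v).1](_ : _ = u.1 + v.1)// [(u + v).2](_ : _ = u.2 + v.2)//.
have h : u.1 * v.1 + u.2 * v.2 <= enorm u * enorm v.
  apply: le_trans (ler_norm _) _.
  rewrite -(ler_pXn2r (n := 2)) ?nnegrE ?mulr_ge0 ?enorm_ge0// real_normK ?num_real//.
  rewrite exprMn !sqr_enorm; have := sqr_ge0 (u.1 * v.2 - u.2 * v.1); lra.
by move: h; move: (enorm u * enorm v) => k; lra.
Qed.

Lemma enorm_fst v : `|v.1| <= enorm v.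
Proof.
rewrite -(ler_pXn2r (n := 2)) ?nnegrE ?enorm_ge0// real_normK ?num_real// sqr_enorm.
by have := sqr_ge0 v.2; lra.
Qed.

Lemma enorm_snd v : `|v.2| <= enorm v.
Proof.
rewrite -(ler_pXn2r (n := 2)) ?nnegrE ?enorm_ge0// real_normK ?num_real// sqr_enorm.
by have := sqr_ge0 v.1; lra.
Qed.

Lemma enorm_le v : enorm v <= `|v.1| + `|v.2|.
Proof.
rewrite ler_enorm ?addr_ge0// [leRHS]sqrrD !real_normK ?num_real//.
have : 0 <= `|v.1| * `|v.2| by rewrite mulr_ge0.
by lra.
Qed.

Lemma enorm0 : enorm (0 : plane R) = 0.
Proof. by rewrite /enorm /= expr0n addr0 sqrtr0. Qed.

Lemma enorm_eq0 v : enorm v = 0 -> v = 0.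
Proof.
move=> v0; have := enorm_fst v; have := enorm_snd v; rewrite v0 !normr_le0.
by case: v {v0} => a b /= /eqP -> /eqP ->.
Qed.

Lemma enorm_gt0 v : v != 0 -> 0 < enorm v.
Proof.
move=> v0; rewrite lt_neqAle enorm_ge0 andbT eq_sym.
by apply: contra v0 => /eqP/enorm_eq0 ->.
Qed.

End enorm.

Section flat_distance.
Context (R : realType).
Implicit Types (p q r : plane R) (x y z : torus R).

Lemma tpiP p q : tpi p = tpi q <-> equivZ2 p q.
Proof. by split => [/eqmodP|h]; [|apply/eqmodP]. Qed.

Lemma tpi_repr x : tpi (repr x) = x. Proof. exact: reprK. Qed.

Lemma tpiD p q r : tpi p = tpi q -> tpi (p + r) = tpi (q + r).
Proof.
move=> /tpiP/andP[h1 h2]; apply/tpiP; rewrite /equivZ2.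
rewrite [(p + r).1 - _](_ : _ = p.1 + r.1 - (q.1 + r.1))//.
rewrite [(p + r).2 - _](_ : _ = p.2 + r.2 - (q.2 + r.2))//.
rewrite (_ : _ - _ = p.1 - q.1); last by ring.
by rewrite (_ : p.2 + _ - _ = p.2 - q.2) ?h1//; ring.
Qed.

Let dists x y := [set enorm (p - q) | p in @tpi R @^-1` [set x] & q in @tpi R @^-1` [set y]].

Let dists_lb x y : has_lbound (dists x y).
Proof. by exists 0 => _ [p _ [q _ <-]]; exact: enorm_ge0. Qed.

Let dists_n0 x y : dists x y !=set0.
Proof.
by exists (enorm (repr x - repr y)), (repr x); [exact: tpi_repr|];
  exists (repr y); [exact: tpi_repr|].
Qed.

Lemma tdist_le p q : tdist (tpi p) (tpi q) <= enorm (p - q).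
Proof. apply: ge_inf; first exact: dists_lb.
by exists p => //; exists q. Qed.

Lemma tdist_ge x y e :
  (forall p q, tpi p = x -> tpi q = y -> e <= enorm (p - q)) -> e <= tdist x y.
Proof. move=> h; apply: lb_le_inf; first exact: dists_n0.
by move=> _ [p px [q qy <-]]; exact: h. Qed.

Lemma tdist_sym x y : tdist x y = tdist y x.
Proof.
apply/eqP; rewrite eq_le; apply/andP; split;
  by apply: tdist_ge => p q <- <-; rewrite enormB; exact: tdist_le.
Qed.

(** The two pairs of lifts may lift [y] at different points [q] and [q']; moving the lift [r] of [z]
    by the lattice vector [q - q'] makes them share a lift of [y]. *)
Lemma tdist_triangle x y z : tdist x z <= tdist x y + tdist y z.
Proof.
rewrite -lerBlDr; apply: tdist_ge => p q px qy.
rewrite lerBlDr addrC -lerBlDr; apply: tdist_ge => q' r q'y rz.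
rewrite lerBlDr addrC.
have <- : tpi (r + (q - q')) = z.
  rewrite -rz; have := @tpiD q q' (r - q').
  by rewrite qy q'y => /(_ erefl); rewrite (addrC q') subrK addrCA.
rewrite -px; apply: le_trans (tdist_le _ _) _.
have -> : p - (r + (q - q')) = (p - q) + (q' - r).
  by rewrite !opprD opprK (addrCA (- r)) (addrC (- r)) (addrA p).
exact: enormD.
Qed.

Lemma nint_dist_gt0 (d : R) : d \isn't a Num.int ->
  exists2 e, 0 < e & forall n : R, n \is a Num.int -> e <= `|d + n|.
Proof.
move=> dn; pose f := d - (Num.floor d)%:~R.
have /andP[f0 f1] := floor_itv d.
have f0' : 0 < f.
  rewrite subr_gt0 lt_neqAle f0 andbT; apply: contra dn => /eqP <-.
  exact: intr_int.
have f1' : f < 1 by rewrite ltrBlDl; rewrite intrD1 in f1.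
exists (Num.min f (1 - f)); first by rewrite lt_min f0' subr_gt0.
move=> n /intrP[m ->].
have -> : d + m%:~R = f + (Num.floor d + m)%:~R by rewrite /f intrD; ring.
move: (Num.floor d + m) => {}m.
have [m0|m0] := leP 0 m.
  have mm : 0 <= (m%:~R : R) by rewrite ler0z.
  by rewrite ge_min ger0_norm; [apply/orP; left|]; lra.
have mm : (m%:~R : R) <= -1.
  rewrite (_ : -1 = (-1)%:~R)// ler_int.
  by move: m0; lia.
by rewrite ge_min ler0_norm; [apply/orP; right|]; lra.
Qed.

Lemma tdist_gt0 x y : x <> y -> 0 < tdist x y.
Proof.
move=> xy; set p := repr x; set q := repr y.
have npq : ~~ equivZ2 p q.
  by apply/negP => /tpiP; rewrite !tpi_repr.
suff [e e0 he] : exists2 e, 0 < e & forall p' q', tpi p' = x -> tpi q' = y ->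
    e <= enorm (p' - q').
  by apply: lt_le_trans e0 _; exact: tdist_ge.
have eqv p' x' : tpi p' = x' -> p'.1 - (repr x').1 \is a Num.int /\
    p'.2 - (repr x').2 \is a Num.int.
  by rewrite -{1}(tpi_repr x') => /tpiP/andP[].
move: npq; rewrite negb_and => /orP[] /nint_dist_gt0[e e0 he]; exists e => //;
  move=> p' q' /eqv[h1 h2] /eqv[k1 k2].
- apply: le_trans (enorm_fst _).
  have -> : (p' - q').1 = p.1 - q.1 + ((p'.1 - p.1) - (q'.1 - q.1)).
    by rewrite [LHS](_ : _ = p'.1 - q'.1)//; ring.
  by apply: he; rewrite rpredB.
- apply: le_trans (enorm_snd _).
  have -> : (p' - q').2 = p.2 - q.2 + ((p'.2 - p.2) - (q'.2 - q.2)).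
    by rewrite [LHS](_ : _ = p'.2 - q'.2)//; ring.
  by apply: he; rewrite rpredB.
Qed.

End flat_distance.

Section diffvol_space.
Context (R : realType).
Implicit Types f g : DiffVol R.

Lemma eq_diffvol f g : diffvol_fun f =1 diffvol_fun g -> f = g.
Proof.
case: f g => [f vf] [g vg] /= /funext fg.
by subst g; congr Build_DiffVol; exact: Prop_irrelevance.
Qed.

Lemma openE_diffvol (U : set (DiffVol R)) : open U = Coo_open U.
Proof. by []. Qed.

(** A ball of order 0 suffices, its radius being the distance between two distinct values. The aim
    is that points are Borel, so that [integral_umeas] applies. *)
Lemma open_diffvolC1 f : open (~` [set f]).
Proof.
rewrite openE_diffvol => g /= gf.
have [x fgx] : exists x, f x <> g x.
  by apply/existsNP => fg; apply: gf; apply: eq_diffvol => x; rewrite fg.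
exists 0%N, (tdist (f x) (g x)); split; first exact: tdist_gt0.
by move=> h fh /= hf; have [] := fh x; rewrite hf tdist_sym ltxx.
Qed.

Lemma measurable_diffvol1 (f : DiffVolBorel R) : measurable [set f].
Proof.
rewrite -[X in measurable X]setCK; apply: measurableC.
by apply: sub_gen_smallest; exact: open_diffvolC1.
Qed.

End diffvol_space.

(** * Random words *)

Section random_words.
Context (R : realType).
Implicit Types (L : seq (DiffVol R)) (Phi : DiffVol R -> R).

(* Expectation of [Phi (f_1 \o ... \o f_n)] for independent [f_i] uniform in [L]. *)
Fixpoint Ex L n Phi : R :=
  if n is m.+1 then avg L (fun f => Ex L m (fun g => Phi (diffvol_comp g f)))
  else Phi (diffvol_id R).

Lemma eq_Ex L n Phi Psi : Phi =1 Psi -> Ex L n Phi = Ex L n Psi.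
Proof.
elim: n Phi Psi => [|n IH] Phi Psi e /=; first exact: e.
by apply: eq_avg => f; apply: IH => g; exact: e.
Qed.

Lemma diffvol_compA (f g h : DiffVol R) :
  diffvol_comp f (diffvol_comp g h) = diffvol_comp (diffvol_comp f g) h.
Proof. exact: eq_diffvol. Qed.

Lemma diffvol_comp1 (f : DiffVol R) : diffvol_comp f (diffvol_id R) = f.
Proof. exact: eq_diffvol. Qed.

Lemma diffvol_1comp (f : DiffVol R) : diffvol_comp (diffvol_id R) f = f.
Proof. exact: eq_diffvol. Qed.

Lemma Ex_avg L (T : Type) (s : seq T) n (Phi : T -> DiffVol R -> R) :
  Ex L n (fun g => avg s (fun t => Phi t g)) = avg s (fun t => Ex L n (Phi t)).
Proof.
elim: n Phi => [//|n IH] Phi /=.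
rewrite -avg_exchange; apply: eq_avg => f.
by rewrite (IH (fun t g => Phi t (diffvol_comp g f))).
Qed.

(** [Ex] adds letters on the right, where they are applied first, whereas [convolution] adds them on
    the left. The two recursions agree because the letters are independent with the same law. *)
Lemma ExSr L n Phi :
  Ex L n.+1 Phi = avg L (fun f => Ex L n (fun g => Phi (diffvol_comp f g))).
Proof.
elim: n Phi => [|n IH] Phi.
  by apply: eq_avg => f /=; rewrite diffvol_1comp diffvol_comp1.
rewrite [LHS](_ : _ =
  avg L (fun f => Ex L n.+1 (fun g => Phi (diffvol_comp g f))))//.
rewrite [RHS](_ : _ = avg L (fun f => avg L (fun g => Ex L n (fun h =>
    Phi (diffvol_comp f (diffvol_comp h g))))))//.
rewrite avg_exchange; apply: eq_avg => f.
rewrite (IH (fun g => Phi (diffvol_comp g f))).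
by apply: eq_avg => g; apply: eq_Ex => h; rewrite diffvol_compA.
Qed.

Fixpoint words L n : seq (DiffVolBorel R) :=
  if n is m.+1 then allpairs (@diffvol_comp R) L (words L m) else L.

Lemma avg_words L n Phi : avg (words L n) Phi = Ex L n.+1 Phi.
Proof.
elim: n Phi => [|n IH] Phi.
  by apply: eq_avg => f /=; rewrite diffvol_1comp.
by rewrite ExSr avg_allpairs; apply: eq_avg => f; rewrite IH.
Qed.

Lemma size_words L n : (0 < size L)%N -> (0 < size (words L n))%N.
Proof. by move=> L0; elim: n => //= n IH; rewrite size_allpairs muln_gt0 L0. Qed.

Definition udist (s : seq (DiffVolBorel R)) : set (DiffVolBorel R) -> \bar R :=
  @umeas _ (DiffVolBorel R) R (head (diffvol_id R) s) (behead s).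

Lemma udistE s : (0 < size s)%N -> forall A, udist s A = (avg s (fun t => \1_A t))%:E.
Proof. by case: s => // f s _ A; rewrite /udist umeasE. Qed.

Lemma integral_udist s (Phi : DiffVol R -> R) : (0 < size s)%N ->
  (\int[udist s]_f (Phi f)%:E = (avg s Phi)%:E)%E.
Proof.
case: s => // f s _; rewrite /udist.
exact: (@integral_umeas _ _ _ f s Phi (@measurable_diffvol1 R)).
Qed.

Lemma convolution_udist s t : (0 < size s)%N -> (0 < size t)%N ->
  convolution (udist s) (udist t) = udist (allpairs (@diffvol_comp R) s t).
Proof.
move=> s0 t0; apply/funext => A.
rewrite udistE ?size_allpairs ?muln_gt0 ?s0// avg_allpairs.
rewrite /convolution /pushforward /product_measure1 /=.
rewrite -integral_udist//; apply: eq_integral => f _ /=.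
rewrite udistE//; congr EFin; apply: eq_avg => g.
rewrite !indicE mem_xsection (_ : _ \in _ = (diffvol_comp f g \in A))//.
Qed.

Lemma convpow_udist L n : (0 < size L)%N ->
  convpow (udist L) n.+1 = udist (words L n).
Proof.
move=> L0; elim: n => [//|n IH].
have -> : convpow (udist L) n.+2 = convolution (udist L) (convpow (udist L) n.+1) by [].
by rewrite IH convolution_udist// size_words.
Qed.

Lemma open_diffvolC_seq L : open (~` [set` L]).
Proof.
elim: L => [|f L IH]; first by rewrite set_nil setC0; exact: openT.
have -> : ~` [set` f :: L] = ~` [set f] `&` ~` [set` L].
  apply/seteqP; split => [g /= gL|g /= [gf gL]].
    by split => [gf|h]; apply: gL; rewrite inE; [rewrite gf eqxx|rewrite h orbT].
  by rewrite inE => /orP[/eqP//|].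
by apply: openI => //; exact: open_diffvolC1.
Qed.

Lemma udist_expanding_probability L (U : set (DiffVol R)) n : (0 < size L)%N ->
  (forall f, f \in L -> U f) ->
  (forall x v, enorm v = 1 -> 2 < Ex L n.+1 (fun f => ln (enorm (tdiff f x v)))) ->
  exists mu : probability (DiffVolBorel R) R,
    [/\ finitely_supported mu, msupport mu `<=` U & uniformly_expanding mu].
Proof.
move=> L0 LU ex.
pose mu : probability (DiffVolBorel R) R :=
  @umeas _ (DiffVolBorel R) R (head (diffvol_id R) L) (behead L).
have muE : mu = udist L :> (set (DiffVolBorel R) -> \bar R) by [].
exists mu; split.
- exists [set` L]; first exact: finite_seq.
  rewrite muE udistE//; congr EFin; rewrite -[RHS](avg_cst 1 L0).
  rewrite /avg; congr (_ * _); rewrite !big_seq; apply: eq_bigr => f fL.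
  by rewrite indicE mem_set.
(* The complement of the list is open and has measure 0, so a point of the support lies in the
   list. *)
- move=> f /= supf; apply: LU; apply: contrapT => /negP fL.
  have oV := @open_diffvolC_seq L.
  have := supf _ oV (negP fL).
  rewrite muE udistE// lte_fin /avg big_seq big1 ?mulr0 ?ltxx// => g gL.
  by rewrite indicE memNset//= => /(_ gL).
- exists n.+1; split => // x v v1.
  rewrite muE convpow_udist// integral_udist ?size_words// lte_fin avg_words.
  exact: ex.
Qed.

End random_words.

(** * Independence of the choice of lifts *)

Section lifts.
Context (R : realType).
Local Notation lift := Defs.lift.
Implicit Types (F G : plane R -> plane R) (f g : torus R -> torus R).
Implicit Types (p q c v : plane R) (x : torus R) (s : seq bool).

Lemma derive_shiftc F v c q : 'D_v (fun r => F (r + c)) q = 'D_v F (q + c).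
Proof.
rewrite /derive [X in lim (X @ _)](_ : _ =
  (fun h => h^-1 *: ((F \o shift (q + c)) (h *: v) - F (q + c))))//.
by apply/funext => h /=; rewrite addrA.
Qed.

Lemma derive_addc F v c q : 'D_v (fun r => F r + c) q = 'D_v F q.
Proof.
rewrite /derive [X in lim (X @ _)](_ : _ =
  (fun h => h^-1 *: ((F \o shift q) (h *: v) - F q)))//.
by apply/funext => h /=; rewrite opprD addrACA subrr addr0.
Qed.

Lemma partials_shiftc s F c : partials s (fun r => F (r + c)) = fun q => partials s F (q + c).
Proof.
elim: s => [//|i s IH] /=; rewrite IH; apply/funext => q.
exact: derive_shiftc.
Qed.

Lemma partials_addc s F G c p : s != [::] ->
  (\forall q \near p, F q = G q + c) ->
  \forall q \near p, partials s F q = partials s G q.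
Proof.
elim: s => [//|i [|j s] IH] _ FG.
  have := near_join FG; apply: filterS => q FGq /=.
  by rewrite (near_eq_derive _ FGq) derive_addc.
have := near_join (IH erefl FG); apply: filterS => q FGq.
exact: near_eq_derive.
Qed.

Lemma nint_small (d : R) : d \is a Num.int -> `|d| < 1 -> d = 0.
Proof.
move=> /intrP[m ->]; rewrite -intr_norm (_ : 1 = 1%:~R)// ltr_int.
by move=> m1; have -> : m = 0 by lia.
Qed.

(** The difference of the two maps is continuous with integer coordinates near [p], hence locally
    constant. *)
Lemma lift_unique F G p : {for p, continuous F} -> {for p, continuous G} ->
  (\forall q \near p, tpi (F q) = tpi (G q)) ->
  \forall q \near p, F q = G q + (F p - G p).
Proof.
move=> cF cG FG.
have cH : {for p, continuous (fun q => F q - G q)} by exact: continuousB.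
have /cvgrPdist_lt /(_ 1 ltr01) h := cH.
have FGp := nbhs_singleton FG.
near=> q.
have hq : `|F p - G p - (F q - G q)| < 1 by near: q.
have /tpiP/andP[i1 i2] : tpi (F q) = tpi (G q) by near: q.
have /tpiP/andP[j1 j2] := FGp.
suff -> : F p - G p = F q - G q by rewrite addrC subrK.
move: hq; set d := F p - G p - _ => hd; apply/eqP; rewrite -subr_eq0 -/d.
have d1 : d.1 = 0.
  apply: nint_small; first by rewrite rpredB.
  by apply: le_lt_trans hd; rewrite prod_normE le_max lexx.
have d2 : d.2 = 0.
  apply: nint_small; first by rewrite rpredB.
  by apply: le_lt_trans hd; rewrite prod_normE le_max lexx orbT.
by apply/eqP; rewrite [LHS]surjective_pairing d1 d2.
Unshelve. all: by end_near. Qed.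

Lemma smooth_near_continuous F p : smooth_near F p -> {for p, continuous F}.
Proof.
by move=> sF; apply: differentiable_continuous; exact: (nbhs_singleton sF [::]).
Qed.

Lemma smooth_lift_near f F p : smooth_lift f p F ->
  \forall q \near p, smooth_lift f q F.
Proof.
move=> [/near_join h1 /near_join h2]; near=> q; split.
- by near: q.
- by near: q.
Unshelve. all: by end_near. Qed.

Lemma smooth_lift_unique f F G p : smooth_lift f p F -> smooth_lift f p G ->
  \forall q \near p, F q = G q + (F p - G p).
Proof.
move=> [fF sF] [fG sG]; apply: lift_unique; try exact: smooth_near_continuous.
near=> q.
have -> : tpi (F q) = f (tpi q) by near: q.
by have -> : tpi (G q) = f (tpi q) by near: q.
Unshelve. all: by end_near. Qed.

Lemma liftP f x : tsmooth f -> smooth_lift f (repr x) (lift f x).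
Proof. by move=> sf; have [F FP] := sf (repr x); apply: (getPex (ex_intro _ F FP)). Qed.

Lemma smooth_lift_shift f F p c : tpi (p + c) = tpi p -> smooth_lift f (p + c) F ->
  smooth_lift f p (fun q => F (q + c)).
Proof.
move=> pc [fF sF].
have cs : (q + c) @[q --> p] --> p + c.
  by apply: cvgD; [exact: cvg_id|exact: cvg_cst].
split.
  have : \forall q \near p, tpi (F (q + c)) = f (tpi (q + c)) := cs _ fF.
  apply: filterS => q ->; congr f.
  have e1 (r : plane R) : (r + c).1 - r.1 = c.1 by rewrite /= addrAC subrr add0r.
  have e2 (r : plane R) : (r + c).2 - r.2 = c.2 by rewrite /= addrAC subrr add0r.
  by apply/tpiP; move/tpiP: pc; rewrite /equivZ2 !e1 !e2.
have : \forall q \near p, forall s, differentiable (partials s F) (q + c) := cs _ sF.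
apply: filterS => q h s; rewrite partials_shiftc.
apply: (@differentiable_comp _ _ _ _ (fun r => r + c) (partials s F)); last exact: h.
by apply: differentiableD => //; exact: differentiable_cst.
Qed.

(** [tpartials] is computed at one representative with a lift picked by choice; from here on any
    lift, at any point above, can be used instead. *)
Lemma smooth_lift_tpartials f F p s : s != [::] -> tsmooth f -> smooth_lift f p F ->
  tpartials s f (tpi p) = partials s F p.
Proof.
move=> s0 sf lF; rewrite /tpartials; set x := tpi p.
pose c := repr x - p.
have pc : p + c = repr x by rewrite /c addrC subrK.
have lG : smooth_lift f p (fun q => lift f x (q + c)).
  by apply: smooth_lift_shift; rewrite pc; [exact: tpi_repr|exact: liftP].
have := nbhs_singleton (partials_addc s0 (smooth_lift_unique lG lF)).
by rewrite partials_shiftc pc.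
Qed.

Lemma tdiffE f F p v : tsmooth f -> smooth_lift f p F ->
  tdiff f (tpi p) v = 'd F p v.
Proof.
move=> sf lF.
have dL : differentiable (lift f (tpi p)) (repr (tpi p)).
  exact: (nbhs_singleton (liftP (tpi p) sf).2 [::]).
have dF : differentiable F p by exact: (nbhs_singleton lF.2 [::]).
have e i : 'd (lift f (tpi p)) (repr (tpi p)) (basis2 R i) = 'd F p (basis2 R i).
  transitivity ('D_(basis2 R i) (lift f (tpi p)) (repr (tpi p))).
    by apply/esym; exact: deriveE.
  transitivity ('D_(basis2 R i) F p); last exact: deriveE.
  exact: (smooth_lift_tpartials (s := [:: i]) erefl sf lF).
rewrite /tdiff [LHS](linear_basis2 ('d (lift f (tpi p)) (repr (tpi p))) v).
rewrite [RHS](linear_basis2 ('d F p) v).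
exact: (f_equal2 (fun a b => v.1 *: a + v.2 *: b) (e false) (e true)).
Qed.

Lemma tdiff_basis f x (i : bool) : tsmooth f -> tdiff f x (basis2 R i) = tpartials [:: i] f x.
Proof.
move=> sf; rewrite /tdiff /tpartials /=; apply/esym; apply: deriveE.
exact: (nbhs_singleton (liftP _ sf).2 [::]).
Qed.

Lemma tdiffl f x v :
  tdiff f x v = v.1 *: tdiff f x (basis2 R false) + v.2 *: tdiff f x (basis2 R true).
Proof. exact: (linear_basis2 ('d (lift f x) (repr x)) v). Qed.

Lemma tdiff_comp f g x v : tsmooth f -> tsmooth g ->
  tdiff (f \o g) x v = tdiff f (g x) (tdiff g x v).
Proof.
move=> sf sg; have lF := liftP x sg.
have [G lG] := sf (lift g x (repr x)).
have lGF := smooth_lift_comp lF lG.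
have gx : tpi (lift g x (repr x)) = g x.
  by rewrite (nbhs_singleton lF.1) tpi_repr.
rewrite -{1}(tpi_repr x) (tdiffE _ (tsmooth_comp sf sg) lGF).
rewrite -gx (tdiffE _ sf lG) /tdiff.
have dF := nbhs_singleton lF.2 [::].
have dG := nbhs_singleton lG.2 [::].
exact: (congr1 (fun h : plane R -> plane R => h v) (diff_comp dF dG)).
Qed.

Lemma continuous_tpartials f s : s != [::] -> tsmooth f ->
  continuous (fun p => tpartials s f (tpi p) : plane R).
Proof.
move=> s0 sf p; have [F lF] := sf p.
have dF : differentiable (partials s F) p by exact: (nbhs_singleton lF.2).
rewrite /continuous_at (smooth_lift_tpartials s0 sf lF).
have := differentiable_continuous dF; rewrite /continuous_at.
apply: cvg_trans; apply: near_eq_cvg.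
have := smooth_lift_near lF; apply: filterS => q lq.
by rewrite (smooth_lift_tpartials s0 sf lq).
Qed.

End lifts.

Section compactness.
Context (R : realType).

Lemma compact_unit_square : compact (`[0 : R, 1] `*` `[0 : R, 1]).
Proof. by apply: compact_setX; exact: segment_compact. Qed.

Lemma torus_unit_square (x : torus R) :
  exists2 p, (`[0 : R, 1] `*` `[0 : R, 1]) p & tpi p = x.
Proof.
pose q := repr x.
exists (q.1 - (Num.floor q.1)%:~R, q.2 - (Num.floor q.2)%:~R).
  have /andP[a1 a2] := floor_itv q.1; have /andP[b1 b2] := floor_itv q.2.
  rewrite intrD1 in a2; rewrite intrD1 in b2.
  by split; rewrite /= in_itv /= subr_ge0 lerBlDl (a1, b1) (ltW a2, ltW b2).
rewrite -[RHS]tpi_repr; apply/tpiP; rewrite /equivZ2 /=.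
by rewrite !(addrAC _ (- (_%:~R))) !subrr !add0r !rpredN !intr_int.
Qed.

(** As [K] need not be periodic, the bound is claimed at one lift of each point only, taken in the
    unit square. *)
Lemma torus_bounded (K : plane R -> plane R) : continuous K ->
  exists2 C, 0 < C & forall x : torus R, exists2 p, tpi p = x & enorm (K p) <= C.
Proof.
move=> cK.
have /compact_bounded[M [_ /(_ (M + 1))]] :
    compact (K @` (`[0, 1] `*` `[0, 1])).
  by apply: continuous_compact; [exact: continuous_subspaceT|exact: compact_unit_square].
rewrite ltrDl ltr01 => /(_ erefl) h.
exists (2 * `|M + 1| + 1); first by rewrite ltr_wpDl// mulr_ge0.
move=> x; have [p sp px] := torus_unit_square x; exists p => //.
apply: le_trans (enorm_le _) _.
have := h (K p) (ex_intro2 _ _ p sp erefl); rewrite /= prod_normE ge_max => /andP[h1 h2].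
by have := ler_norm (M + 1); lra.
Qed.

End compactness.

(** * Linear changes of variables and the volume of the torus *)

Section affine_line.
Context (R : realType).
Local Notation lam := (@lebesgue_measure R).
Local Open Scope ereal_scope.

Lemma measurable_affine (a b : R) :
  measurable_fun setT (fun x : measurableTypeR R => (a * x + b)%R : measurableTypeR R).
Proof. by apply: measurable_funD => //; apply: measurable_funM. Qed.

Lemma lebesgue_measure_affine (a b : R) (A : set (measurableTypeR R)) : a != 0%R ->
  measurable A ->
  lam A = `|a|%:E * lam ((fun x => a * x + b)%R @^-1` A).
Proof.
move=> a0 mA.
have a0' : (0 < `|a|)%R by rewrite normr_gt0.
pose f (x : measurableTypeR R) : measurableTypeR R := (a * x + b)%R.
pose m : {measure set (measurableTypeR R) -> \bar R} := pushforward lam f.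
pose m' := mscale (NngNum (ltW a0')) (m (measurable_affine a b)).
rewrite [RHS](_ : _ = m' A)//.
apply: (@lebesgue_measure_unique R m') => // _ [[c d] _ <-].
rewrite [RHS](_ : _ = `|a|%:E * lam (f @^-1` `]c, d]%classic))//.
rewrite lebesgue_measure_itv /= lte_fin.
have [a1|a1|/eqP] := ltgtP a 0%R; last by rewrite (negbTE a0).
- rewrite (_ : f @^-1` _ = `[((d - b) / a)%R, ((c - b) / a)%R[%classic); last first.
    apply/seteqP; split => x; rewrite /f /= !in_itv /= ler_ndivrMr// ltr_ndivlMr//.
      by rewrite mulrC => /andP[h1 h2]; apply/andP; split; lra.
    by rewrite mulrC => /andP[h1 h2]; apply/andP; split; lra.
  rewrite lebesgue_measure_itv /= lte_fin ltr_nM2r ?invr_lt0// ltrBlDr subrK.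
  case: ifP => _; last by rewrite mule0.
  rewrite -!EFinB -EFinM ltr0_norm//; congr EFin.
  by field.
- rewrite (_ : f @^-1` _ = `]((c - b) / a)%R, ((d - b) / a)%R]%classic); last first.
    apply/seteqP; split => x; rewrite /f /= !in_itv /= ler_pdivlMr// ltr_pdivrMr//.
      by rewrite mulrC => /andP[h1 h2]; apply/andP; split; lra.
    by rewrite mulrC => /andP[h1 h2]; apply/andP; split; lra.
  rewrite lebesgue_measure_itv /= lte_fin ltr_pM2r ?invr_gt0// ltrBlDr subrK.
  case: ifP => _; last by rewrite mule0.
  rewrite -!EFinB -EFinM gtr0_norm//; congr EFin.
  by field.
Qed.

Lemma integral_affine (a b : R) (g : measurableTypeR R -> \bar R) : a != 0%R ->
  measurable_fun setT g -> (forall x, 0 <= g x) ->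
  \int[lam]_x g (a * x + b)%R = (`|a|^-1)%:E * \int[lam]_x g x.
Proof.
move=> a0 mg g0.
have a0' : (0 < `|a|)%R by rewrite normr_gt0.
pose f (x : measurableTypeR R) : measurableTypeR R := (a * x + b)%R.
pose m : {measure set (measurableTypeR R) -> \bar R} := pushforward lam f.
pose mf := measurable_affine a b.
have -> : \int[lam]_x g x = \int[mscale (NngNum (ltW a0')) (m mf)]_x g x.
  apply: eq_measure_integral => A mA _.
  exact: lebesgue_measure_affine.
rewrite ge0_integral_mscale// muleA -EFinM mulVf ?gt_eqF// mul1e.
by rewrite ge0_integral_pushforward.
Qed.

End affine_line.

Section linear_plane.
Context (R : realType).
Local Notation lam := (@lebesgue_measure R).
Local Notation lam2 := (lam \x lam)%E.
Local Notation mplane := (measurableTypeR R * measurableTypeR R)%type.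
Local Open Scope ereal_scope.

Definition lin2 (a b c d : R) (v : mplane) : mplane :=
  (a * v.1 + b * v.2, c * v.1 + d * v.2)%R.

Lemma measurable_lin2 (a b c d : R) : measurable_fun setT (lin2 a b c d).
Proof.
by apply: measurable_fun_pair; apply: measurable_funD; apply: measurable_funM.
Qed.

Lemma integral_swap (g : mplane -> \bar R) : measurable_fun setT g ->
  (forall v, 0 <= g v) -> \int[lam2]_v g (v.2, v.1) = \int[lam2]_v g v.
Proof.
move=> mg g0.
have ms : measurable_fun setT (fun v : mplane => g (v.2, v.1)).
  by apply: (measurableT_comp mg); exact: measurable_fun_pair.
rewrite (fubini_tonelli1 (fun v : mplane => g (v.2, v.1)))//.
by rewrite (fubini_tonelli2 g).
Qed.

(** Gaussian elimination inside Tonelli's theorem: substituting [u = a x + b y] at fixed [y] turns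
    the second coordinate into [(c / a) u + (D / a) y]; after the exchange of the integrals, a
    second substitution at fixed [u] completes the factor [|a|^-1 |D / a|^-1 = |D|^-1]. *)
Lemma integral_lin2 (a b c d : R) (g : mplane -> \bar R) :
  (a * d - b * c != 0)%R -> measurable_fun setT g -> (forall v, 0 <= g v) ->
  \int[lam2]_v g (lin2 a b c d v) = (`|a * d - b * c|^-1)%:E * \int[lam2]_v g v.
Proof.
(* If [a = 0] then [c] is nonzero, and exchanging the target coordinates swaps the two rows. *)
wlog a0 : a b c d g / a != 0%R.
  move=> wl D0 mg g0; have [a0|a0] := eqVneq a 0%R; last exact: wl.
  have c0 : c != 0%R by apply: contra D0 => /eqP ->; rewrite a0 mulr0 mul0r subrr.
  rewrite -(integral_swap mg g0).
  have -> : (`|a * d - b * c| = `|c * b - d * a|)%R.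
    by rewrite -normrN; congr (`| _ |)%R; ring.
  rewrite -(wl c d a b (fun v => g (v.2, v.1)))//.
  - by rewrite (_ : c * b - d * a = - (a * d - b * c))%R ?oppr_eq0//; ring.
  - by apply: (measurableT_comp mg); exact: measurable_fun_pair.
move=> D0 mg g0; set D := (a * d - b * c)%R in D0 *.
have mgl (a' b' c' d' : R) : measurable_fun setT (fun v => g (lin2 a' b' c' d' v)).
  by apply: (measurableT_comp mg); exact: measurable_lin2.
rewrite (fubini_tonelli2 (fun v => g (lin2 a b c d v)))//.
rewrite /fubini_G.
transitivity (\int[lam]_y ((`|a|^-1)%:E * \int[lam]_x g (lin2 1 0 (c / a) (D / a) (x, y)))).
  apply: eq_integral => y _.
  rewrite -(@integral_affine _ a (b * y) (fun x => g (lin2 1 0 (c / a) (D / a) (x, y))))//.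
    apply: eq_integral => x _; congr g; rewrite /lin2 /=; congr pair; first by ring.
    by rewrite /D; field.
  by apply: (measurableT_comp (mgl 1 0 (c / a) (D / a))%R); exact: measurable_pair2.
rewrite ge0_integralZl//; last 2 first.
- exact: (measurable_fun_fubini_tonelli_G (fun v => g (lin2 1 0 (c / a) (D / a) v))).
- by move=> y _; exact: integral_ge0.
have -> : \int[lam]_y \int[lam]_x g (lin2 1 0 (c / a) (D / a) (x, y)) =
    \int[lam]_x \int[lam]_y g (lin2 1 0 (c / a) (D / a) (x, y)).
  by rewrite (fubini_tonelli (fun v => g (lin2 1 0 (c / a) (D / a) v))).
transitivity ((`|a|^-1)%:E *
    \int[lam]_x ((`|D / a|^-1)%:E * \int[lam]_y g (x, y))).
  congr (_ * _); apply: eq_integral => x _.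
  rewrite -(@integral_affine _ (D / a) (c / a * x) (fun y => g (x, y)))//.
  - apply: eq_integral => y _; congr g; rewrite /lin2 /=; congr pair; first by ring.
    by rewrite addrC.
  - by rewrite mulf_neq0// invr_eq0.
  - by apply: (measurableT_comp mg); exact: measurable_pair1.
rewrite ge0_integralZl//; last 2 first.
- exact: (measurable_fun_fubini_tonelli_F g).
- by move=> y _; exact: integral_ge0.
rewrite muleA -EFinM fubini_tonelli1//; congr (_%:E * _).
by rewrite normrM normfV invfM invrK mulrC -mulrA mulfV ?mulr1// normr_eq0.
Qed.

End linear_plane.

Section continuous_measurable.
Context (R : realType).
Local Notation mplane := (measurableTypeR R * measurableTypeR R)%type.

Lemma measurable_itvoo_prod (a b c d : R) :
  measurable ((`]a, b[ : set (measurableTypeR R)) `*` (`]c, d[ : set (measurableTypeR R)) : set mplane).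
Proof. by apply: measurableX; exact: measurable_itv. Qed.

(** Rational squares form a countable base of the topology. In [B'] those not contained in [U] are
    replaced by the empty set, which keeps the union indexed by all rationals. *)
Lemma open_measurable2 (U : set (R * R)) : open U -> measurable (U : set mplane).
Proof.
move=> oU.
pose B (q1 q2 e : rat) : set mplane :=
  `]ratr q1 - ratr e, ratr q1 + ratr e[ `*` `]ratr q2 - ratr e, ratr q2 + ratr e[.
pose B' q1 q2 e := if `[< B q1 q2 e `<=` U >] then B q1 q2 e else set0.
rewrite (_ : U = \bigcup_q1 \bigcup_q2 \bigcup_e B' q1 q2 e).
  do 3 (apply: bigcupT_measurable_rat => ?).
  by rewrite /B'; case: ifP => // _; exact: measurable_itvoo_prod.
apply/seteqP; split => [p Up|p [q1 _ [q2 _ [e _]]]]; last first.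
  by rewrite /B'; case: asboolP => // BU /BU.
have : nbhs p U by exact: open_nbhs_nbhs.
move=> /nbhs_ballP[r /= r0 rU].
have [e] : exists e : rat, ratr e \in `]0, (r / 2)[.
  by apply: rat_in_itvoo; rewrite divr_gt0.
rewrite in_itv /= => /andP[e0 er].
have approx (a : R) : exists q : rat, ratr q \in `](a - ratr e), (a + ratr e)[.
  by apply: rat_in_itvoo; rewrite ltrBlDr -addrA ltrDl addr_gt0.
have [q1] := approx p.1; rewrite in_itv /= => /andP[q11 q12].
have [q2] := approx p.2; rewrite in_itv /= => /andP[q21 q22].
exists q1 => //; exists q2 => //; exists e => //.
rewrite /B' ifT.
  by split; rewrite /= in_itv /=; apply/andP; split; lra.
apply/asboolP => -[x y] [/=]; rewrite !in_itv /= => /andP[x1 x2] /andP[y1 y2].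
by apply: rU; split; rewrite /ball /= ltr_norml; apply/andP; split; lra.
Qed.

Lemma continuous_measurable_fun2 (g : R * R -> R) : continuous g ->
  measurable_fun setT (g : mplane -> measurableTypeR R).
Proof.
move=> /continuousP cg; apply: (measurability _ (RGenOpens.measurableE R)).
move=> _ [_ [a [b ->] <-]]; rewrite setTI; apply: open_measurable2.
exact/cg/interval_open.
Qed.

End continuous_measurable.

Lemma integral_measure_preserving d (T : measurableType d) (R : realType)
    (mu : {measure set T -> \bar R}) (phi : T -> T) (g : T -> \bar R) :
  measurable_fun setT phi ->
  (forall A, measurable A -> mu (phi @^-1` A) = mu A) ->
  measurable_fun setT g -> (forall x, 0 <= g x)%E ->
  (\int[mu]_x g (phi x) = \int[mu]_x g x)%E.
Proof.
move=> mphi pres mg g0.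
have h := ge0_integral_pushforward mphi mu measurableT mg (fun y _ => g0 y).
rewrite preimage_setT in h; rewrite -[LHS]h.
by apply: eq_measure_integral => A mA _; exact: pres.
Qed.

Section torus_measure.
Context (R : realType).
Local Notation lam := (@lebesgue_measure R).
Local Notation lam2 := (lam \x lam)%E.
Local Notation mplane := (measurableTypeR R * measurableTypeR R)%type.
Local Notation tpim := (@tpi R : mplane -> torus R).
Local Open Scope ereal_scope.

Definition cell : set mplane := `[0%R, 1%R[ `*` `[0%R, 1%R[.

Lemma measurable_cell : measurable cell.
Proof. by apply: measurableX; exact: measurable_itv. Qed.

Lemma measurable_tpi : measurable_fun setT tpim.
Proof. by move=> _ A mA; rewrite setTI. Qed.

Definition tvol : {measure set (torus R) -> \bar R} :=
  measure_function_pushforward__canonical__measure_function_Measure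
    (mrestr lam2 measurable_cell) measurable_tpi.

Lemma tvolE (A : set (torus R)) : tvol A = vol A. Proof. by []. Qed.

Lemma tvolT : tvol setT = 1.
Proof.
rewrite /tvol /= /pushforward /mrestr preimage_setT setTI.
have l1 : lam `[0%R, 1%R[%classic = 1.
  by rewrite lebesgue_measure_itv /= lte_fin ltr01 oppr0 adde0.
rewrite /cell product_measure1E//.
by rewrite [LHS](_ : _ = lam `[0%R, 1%R[%classic * lam `[0%R, 1%R[%classic)// l1 mule1.
Qed.

HB.instance Definition _ := Measure.on tvol.
HB.instance Definition _ := Measure_isProbability.Build _ _ _ tvol tvolT.

Lemma integral_preserves_vol (f : torus R -> torus R) (g : torus R -> \bar R) :
  preserves_vol f -> measurable_fun setT g -> (forall x, 0 <= g x) ->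
  \int[tvol]_x g (f x) = \int[tvol]_x g x.
Proof.
by move=> [mf vf] mg g0; exact: (@integral_measure_preserving _ _ _ tvol f g mf vf mg g0).
Qed.

Lemma tpi_cell_inj (p q : plane R) : cell p -> cell q -> tpi p = tpi q -> p = q.
Proof.
move=> [/=]; rewrite !in_itv /= => /andP[a1 a2] /andP[b1 b2].
move=> [/=]; rewrite !in_itv /= => /andP[c1 c2] /andP[d1 d2] /tpiP/andP[i1 i2].
have e1 : (p.1 - q.1 = 0)%R by apply: nint_small => //; rewrite ltr_norml; apply/andP; split; lra.
have e2 : (p.2 - q.2 = 0)%R by apply: nint_small => //; rewrite ltr_norml; apply/andP; split; lra.
by rewrite [p]surjective_pairing [q]surjective_pairing; congr pair; lra.
Qed.

(** Measurability in the torus is that of the saturation, a countable union of integer translates of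
    [S]. The union is indexed by rationals, the non-integers contributing the empty set. *)
Lemma measurable_tpi_image (S : set mplane) : measurable S ->
  measurable (tpim @` S).
Proof.
move=> mS; pose T (q1 q2 : rat) : set mplane :=
  if ((ratr q1 : R) \is a Num.int) && ((ratr q2 : R) \is a Num.int) then
    (fun p : mplane => (p.1 + ratr q1, p.2 + ratr q2)%R : mplane) @^-1` S else set0.
have tE : tpim @^-1` (tpim @` S) = \bigcup_q1 \bigcup_q2 T q1 q2.
  apply/seteqP; split => [p [q Sq qp]|p [q1 _ [q2 _]]]; last first.
    rewrite /T; case: ifP => // /andP[i1 i2] Sp.
    exists (p.1 + ratr q1, p.2 + ratr q2)%R => //; apply/tpiP/andP; split => /=.
      by rewrite addrAC subrr add0r.
    by rewrite addrAC subrr add0r.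
  have /tpiP/andP[/intrP[m1 h1] /intrP[m2 h2]] := qp.
  exists m1%:~R => //; exists m2%:~R => //; rewrite /T !ratr_int !intr_int /=.
  by rewrite -h1 -h2 !(addrC p.1) !(addrC p.2) !subrK -surjective_pairing.
rewrite /measurable /= /torus_measurable /= tE.
do 2 (apply: bigcupT_measurable_rat => ?).
rewrite /T; case: ifP => // _; rewrite -[X in measurable X]setTI.
by apply: measurable_fun_pair => //; apply: measurable_funD.
Qed.

Lemma vol_tpi_image (S : set mplane) : S `<=` cell -> vol (tpim @` S) = lam2 S.
Proof.
move=> Sc; rewrite /vol; congr (lam2 _); apply/seteqP; split => [p [[q Sq qp] cp]|p Sp].
  by rewrite -(tpi_cell_inj (Sc _ Sq) cp qp).
by split; [exists p|exact: Sc].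
Qed.

End torus_measure.

(** * Shears *)

Section waves.
Context (R : realType).
Implicit Types (c : R * R * R) (y : R) (b i : bool) (p q v : plane R).

(** These profiles are stable under differentiation, negation and scaling, and contain the
    constants. Inverses of shears, derivatives, amplitudes tending to 0 and translations are thus
    all treated within one family. *)
Definition wave c y : R :=
  c.1.1 + c.1.2 * sin (pi *+ 2 * y) + c.2 * cos (pi *+ 2 * y).

Definition dwave c : R * R * R := (0, - (pi *+ 2 * c.2), pi *+ 2 * c.1.2).

Lemma is_derive_wave c y : is_derive y 1 (wave c) (wave (dwave c) y).
Proof.
pose m : R -> R := (pi *+ 2) \*: (@idfun R).
have hm : is_derive y 1 m ((pi *+ 2) *: 1) := is_deriveZ (pi *+ 2) (is_derive_id y 1).
have hs := is_derive1_comp (is_derive_sin (m y)) hm.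
have hc := is_derive1_comp (is_derive_cos (m y)) hm.
rewrite (_ : wave c = cst c.1.1 + c.1.2 \*: (sin \o m) + c.2 \*: (cos \o m)); last first.
  by apply/funext => z.
apply: (is_derive_eq (is_deriveD (is_deriveD (is_derive_cst c.1.1 y 1)
  (is_deriveZ c.1.2 hs)) (is_deriveZ c.2 hc))).
by rewrite /dwave /wave /m /GRing.scale /=; ring.
Qed.

Lemma waveDz c y (m : R) : m \is a Num.int -> wave c (y + m) = wave c y.
Proof.
have nat_case (k : nat) z : wave c (z + k%:R) = wave c z.
  have e : pi *+ 2 * (z + k%:R) = pi *+ 2 * z + (pi *+ 2) *+ k :> R.
    by rewrite mulrDr [X in _ + X]mulr_natr.
  rewrite /wave e.
  by rewrite (periodicn (@sinD2pi R)) (periodicn (@cosD2pi R)).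
move=> /intrP[[k|k] ->]; first exact: nat_case.
by rewrite NegzE mulrNz -[in RHS](subrK k.+1%:R y) nat_case.
Qed.

Lemma waveN c y : wave (- c.1.1, - c.1.2, - c.2) y = - wave c y.
Proof. by rewrite /wave /=; ring. Qed.

Definition push b c p : plane R := if b then (0, wave c p.1) else (wave c p.2, 0).

Lemma differentiable_wave c y : differentiable (wave c) y.
Proof. by apply/derivable1_diffP; have [] := is_derive_wave c y. Qed.

Lemma diff_wave c y (h : R) : 'd (wave c) y h = h * wave (dwave c) y.
Proof.
rewrite diff1E; last exact: differentiable_wave.
by rewrite derive1E (derive_val (is_derive := is_derive_wave c y)).
Qed.

Lemma differentiable_push b c p : differentiable (push b c) p.
Proof.
have [d1 _] := @is_diff_fst R R R p; have [d2 _] := @is_diff_snd R R R p.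
case: b; rewrite /push; apply: differentiable_pair => //.
- exact: (differentiable_comp d1 (differentiable_wave c p.1)).
- exact: (differentiable_comp d2 (differentiable_wave c p.2)).
Qed.

Lemma derive_push b c p v : 'D_v (push b c) p =
  if b then (0, v.1 * wave (dwave c) p.1) else (v.2 * wave (dwave c) p.2, 0).
Proof.
have [d1 e1] := @is_diff_fst R R R p; have [d2 e2] := @is_diff_snd R R R p.
have dp := differentiable_push b c p.
rewrite [LHS]surjective_pairing -derive_fst// -derive_snd//.
have w1 : 'D_v (wave c \o fst) p = v.1 * wave (dwave c) p.1.
  rewrite deriveE; last exact: (differentiable_comp d1 (differentiable_wave c p.1)).
  by rewrite diff_comp//= ?e1 ?diff_wave//; exact: differentiable_wave.
have w2 : 'D_v (wave c \o snd) p = v.2 * wave (dwave c) p.2.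
  rewrite deriveE; last exact: (differentiable_comp d2 (differentiable_wave c p.2)).
  by rewrite diff_comp//= ?e2 ?diff_wave//; exact: differentiable_wave.
case: b dp => dp; congr pair.
- rewrite (_ : fst \o _ = cst 0)//; exact: derive_cst.
- by rewrite (_ : snd \o _ = wave c \o fst).
- by rewrite (_ : fst \o _ = wave c \o snd).
- rewrite (_ : snd \o _ = cst 0)//; exact: derive_cst.
Qed.

(** A family that contains the lifts of the shears, for [k = 1] and [v = 0], and is stable under
    partial derivatives: smoothness reduces to differentiability of its members. *)
Definition affpush (k : R) v b c p : plane R := k *: p + v + push b c p.

Lemma differentiable_affpush k v b c p : differentiable (affpush k v b c) p.
Proof.
apply: differentiableD; last exact: differentiable_push.
apply: differentiableD; last exact: differentiable_cst.
exact: differentiableZ.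
Qed.

Lemma derive_affpush k v b c i : (fun p => 'D_(basis2 R i) (affpush k v b c) p) =
  affpush 0 (k *: basis2 R i) b (if i == b then (0, 0, 0) else dwave c).
Proof.
apply/funext => p; rewrite /affpush.
have h1 : derivable (fun p => k *: p + v) p (basis2 R i).
  apply: diff_derivable; apply: differentiableD; last exact: differentiable_cst.
  exact: differentiableZ.
have h2 : derivable (push b c) p (basis2 R i).
  exact/diff_derivable/differentiable_push.
rewrite (deriveD h1 h2) derive_addc deriveZ ?derive_id; last exact: derivable_id.
rewrite derive_push scale0r add0r; congr (_ + _).
rewrite /push; case: b {h1 h2}; case: i => /=;
  by rewrite /wave /= ?mul0r ?mul1r ?addr0.
Qed.

Lemma partials_affpush s k v b c : exists k' v' c',
  partials s (affpush k v b c) = affpush k' v' b c'.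
Proof.
elim: s k v c => [|i s IH] k v c; first by exists k, v, c.
have [k' [v' [c' E]]] := IH k v c; rewrite /= E derive_affpush.
by do 3 eexists.
Qed.

Lemma smooth_affpush k v b c p : smooth_near (affpush k v b c) p.
Proof.
near=> q; move=> s; have [k' [v' [c' ->]]] := partials_affpush s k v b c.
exact: differentiable_affpush.
Unshelve. all: by end_near. Qed.

Definition pshear b c p : plane R := p + push b c p.

Lemma pshearE b c p : pshear b c p =
  if b then (p.1, p.2 + wave c p.1) else (p.1 + wave c p.2, p.2).
Proof. by rewrite /pshear /push; case: b; case: p => x y; congr pair; rewrite /= addr0. Qed.

Lemma smooth_pshear b c p : smooth_near (pshear b c) p.
Proof.
rewrite (_ : pshear b c = affpush 1 0 b c); first exact: smooth_affpush.
by apply/funext => q; rewrite /affpush scale1r addr0.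
Qed.

Definition tshear b c (x : torus R) : torus R := tpi (pshear b c (repr x)).

Lemma tpi_pshear b c p q : tpi p = tpi q -> tpi (pshear b c p) = tpi (pshear b c q).
Proof.
move=> /tpiP/andP[h1 h2]; apply/tpiP; rewrite !pshearE /equivZ2.
have w1 : wave c p.1 = wave c q.1 by rewrite -(subrK q.1 p.1) addrC waveDz.
have w2 : wave c p.2 = wave c q.2 by rewrite -(subrK q.2 p.2) addrC waveDz.
by case: b => /=; rewrite ?h1 ?h2 ?w1 ?w2 opprD addrACA subrr addr0 ?h1 ?h2.
Qed.

Lemma tshear_tpi b c p : tshear b c (tpi p) = tpi (pshear b c p).
Proof. by apply: tpi_pshear; rewrite tpi_repr. Qed.

Lemma smooth_lift_tshear b c p : smooth_lift (tshear b c) p (pshear b c).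
Proof.
split; last exact: smooth_pshear.
by near=> q; rewrite tshear_tpi.
Unshelve. all: by end_near. Qed.

Lemma tsmooth_tshear b c : tsmooth (tshear b c).
Proof. by move=> p; exists (pshear b c); exact: smooth_lift_tshear. Qed.

Lemma tshearK b c : cancel (tshear b c) (tshear b (- c.1.1, - c.1.2, - c.2)).
Proof.
move=> x; rewrite -(tpi_repr x) !tshear_tpi; congr tpi.
by rewrite !pshearE; case: b => /=; rewrite waveN addrK -surjective_pairing.
Qed.

End waves.

Section shear_volume.
Context (R : realType).
Local Notation lam := (@lebesgue_measure R).
Local Notation lam2 := (lam \x lam)%E.
Local Notation mline := (measurableTypeR R).
Local Notation mplane := (measurableTypeR R * measurableTypeR R)%type.
Implicit Types (b : bool) (c : R * R * R).

Lemma lebesgue_measureD (s : R) (A : set mline) : measurable A ->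
  lam ((fun x : R => x + s) @^-1` A) = lam A.
Proof.
move=> mA; rewrite (lebesgue_measure_affine s (oner_neq0 R) mA) normr1 mul1e.
by congr (lam _); apply/seteqP; split => x /=; rewrite mul1r.
Qed.

(** Translation invariance on the circle: once [s] is reduced modulo 1, the translated domain [[s, 1
    + s[] is cut at 1 and its second piece is moved back by 1. *)
Lemma lebesgue_measure_periodic (s : R) (E : set mline) : measurable E ->
  (forall x m : R, m \is a Num.int -> E x -> E (x + m)) ->
  lam ((fun x : R => x + s) @^-1` E `&` `[0, 1[) = lam (E `&` `[0, 1[).
Proof.
move=> mE pE.
have pE' (x m : R) : m \is a Num.int -> E (x + m) <-> E x.
  move=> mi; split; last exact: pE.
  by move=> h; rewrite -(addrK m x); apply: pE; rewrite ?rpredN.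
wlog /andP[s0 s1] : s / 0 <= s < 1.
  move=> wl; have /andP[f0 f1] := floor_itv s; rewrite intrD1 in f1.
  rewrite -(wl (s - (Num.floor s)%:~R)); last by rewrite subr_ge0 f0 ltrBlDl.
  congr (lam (_ `&` _)); apply/seteqP; split => x /= h.
    by rewrite addrA; apply/pE' => //; rewrite rpredN intr_int.
  by move: h; rewrite addrA => /pE'; apply; rewrite rpredN intr_int.
have mI (i : interval R) : measurable (E `&` [set` i]).
  by apply: measurableI => //; exact: measurable_itv.
have -> : (fun x : R => x + s) @^-1` E `&` `[0, 1[ =
    (fun x : R => x + s) @^-1` (E `&` `[s, 1 + s[).
  apply/seteqP; split => x /=; rewrite !in_itv /= => -[Ex /andP[x0 x1]];
    by split => //; apply/andP; split; lra.
rewrite lebesgue_measureD//.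
have -> : E `&` `[s, 1 + s[ = (E `&` `[s, 1[) `|` (E `&` `[1, 1 + s[).
  rewrite -setIUr; congr (_ `&` _); apply/seteqP; split => x /=; rewrite !in_itv /=.
    move=> /andP[x0 x1]; have [xl|xl] := ltP x 1; [left|right]; apply/andP; split; lra.
  by move=> [/andP[x0 x1]|/andP[x0 x1]]; apply/andP; split; lra.
have -> : E `&` `[0, 1[ = (E `&` `[s, 1[) `|` (E `&` `[0, s[).
  rewrite -setIUr; congr (_ `&` _); apply/seteqP; split => x /=; rewrite !in_itv /=.
    move=> /andP[x0 x1]; have [xl|xl] := ltP x s; [right|left]; apply/andP; split; lra.
  by move=> [/andP[x0 x1]|/andP[x0 x1]]; apply/andP; split; lra.
rewrite !measureU//; last 2 first.
- apply/seteqP; split => x //= [[_]] /=; rewrite !in_itv /= => /andP[? ?] [_ /andP[? ?]].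
  by exfalso; lra.
- apply/seteqP; split => x //= [[_]] /=; rewrite !in_itv /= => /andP[? ?] [_ /andP[? ?]].
  by exfalso; lra.
congr (_ + _)%E.
transitivity (lam ((fun x : R => x + 1) @^-1` (E `&` `[1, 1 + s[))).
  by apply/esym; exact: lebesgue_measureD.
congr (lam _).
apply/seteqP; split => x /=; rewrite !in_itv /= => -[Ex /andP[x0 x1]].
  by split; [exact/(pE' x 1)|apply/andP; split; lra].
by split; [exact/(pE' x 1)|apply/andP; split; lra].
Qed.

Lemma measurable_pshear b c : measurable_fun setT (pshear b c : mplane -> mplane).
Proof.
have mw : measurable_fun setT (wave c : mline -> mline).
  apply: continuous_measurable_fun => x.
  by apply: differentiable_continuous; exact: differentiable_wave.
have -> : pshear b c = (fun p => if b then (p.1, p.2 + wave c p.1) else (p.1 + wave c p.2, p.2)).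
  by apply/funext => p; rewrite pshearE.
case: b; apply: measurable_fun_pair => //; apply: measurable_funD => //.
- exact: (measurableT_comp mw).
- exact: (measurableT_comp mw).
Qed.

(** Tonelli along the lines that the shear preserves: on the line of coordinate [x] it acts as the
    translation by [wave c x], and the slices of a lifted set are periodic. *)
Lemma preserves_vol_tshear b c : preserves_vol (tshear b c).
Proof.
have pre A : @tpi R @^-1` (tshear b c @^-1` A) = pshear b c @^-1` (@tpi R @^-1` A).
  by apply/seteqP; split => p /=; rewrite tshear_tpi.
have mpre A : measurable A ->
    measurable (pshear b c @^-1` (@tpi R @^-1` A) : set mplane).
  move=> mA; rewrite -[X in measurable X]setTI; apply: measurable_pshear => //.
split => [_ A mA|A mA].
  rewrite setTI /measurable /= /torus_measurable /= pre; exact: mpre.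
have mcell := @measurable_cell R.
rewrite /vol pre; set B := @tpi R @^-1` A.
have mB : measurable (B : set mplane) by exact: mA.
have perB (p q : plane R) : B p -> q.1 - p.1 \is a Num.int -> q.2 - p.2 \is a Num.int -> B q.
  move=> Bp h1 h2; rewrite /B /= (_ : tpi q = tpi p)//.
  by apply/tpiP/andP.
have key (x : R) : lam [set y | (pshear b c @^-1` B `&` `[0, 1[ `*` `[0, 1[)
      (if b then (x, y) else (y, x))] =
    lam [set y | (B `&` `[0, 1[ `*` `[0, 1[) (if b then (x, y) else (y, x))].
  have [x01|x01] := boolP (x \in `[0, 1[); last first.
    by congr (lam _); apply/seteqP; split => y; case: (b) => -[_ [] /=];
      rewrite ?(negbTE x01).
  pose E : set mline := [set y | B (if b then (x, y) else (y, x))].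
  have mE : measurable E.
    rewrite (_ : E = if b then xsection B x else ysection B x).
      case: (b).
      exact: (@measurable_xsection _ _ mline mline B x mB).
    exact: (@measurable_ysection _ _ mline mline B x mB).
    by rewrite /E; case: (b); rewrite ?xsectionE ?ysectionE.
  have := @lebesgue_measure_periodic (wave c x) E mE.
  have pE y m : m \is a Num.int -> E y -> E (y + m).
    move=> mi; rewrite /E /=; case: (b) => h; apply: perB h _ _ => /=;
      by rewrite ?subrr ?rpred0// addrAC subrr add0r.
  move=> /(_ pE) e.
  transitivity (lam ((fun y : R => y + wave c x) @^-1` E `&` `[0, 1[)).
    congr (lam _); apply/seteqP; split => y /=; rewrite /E pshearE; case: (b) => /=.
    - by move=> [h [_ k]].
    - by move=> [h [k _]].
    - by move=> [h k].
    - by move=> [h k].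
  rewrite e; congr (lam _); apply/seteqP; split => y /=; rewrite /E /=; case: (b) => /=.
  - by move=> [h k].
  - by move=> [h k].
  - by move=> [h [_ k]].
  - by move=> [h [k _]].
have mS1 : measurable (pshear b c @^-1` B `&` @cell R) by apply: measurableI => //; exact: mpre.
have mS2 : measurable (B `&` @cell R) by exact: measurableI.
clear pre mpre; case: b key mS1 => key mS1.
  rewrite /product_measure1; apply: eq_integral => x _ /=.
  by rewrite !xsectionE; exact: key.
(* The product measure is by definition an integral over vertical slices; horizontal shears require
   the horizontal ones. *)
have lam2E (S : set mplane) : measurable S ->
    (lam2 S = \int[lam]_y lam [set x | S (x, y)])%E.
  move=> mS; rewrite -[S in LHS]setIT -integral_indic//.
  have m1 : measurable_fun setT (fun v : mplane => (\1_S v)%:E : \bar R).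
    exact/measurable_EFinP.
  rewrite (fubini_tonelli2 (fun v => (\1_S v)%:E))//.
  apply: eq_integral => y _; rewrite /fubini_G.
  have mSy : measurable [set x : mline | S (x, y)].
    have := measurable_ysection y mS; rewrite ysectionE; apply.
  rewrite -[X in lam X]setIT -integral_indic//; apply: eq_integral => x _.
rewrite !lam2E//; apply: eq_integral => y _; exact: key.
Qed.

Lemma voldiff_tshear b c : voldiff (tshear b c).
Proof.
split; [exact: tsmooth_tshear| |exact: preserves_vol_tshear].
exists (tshear b (- c.1.1, - c.1.2, - c.2)); split.
- exact: tsmooth_tshear.
- exact: tshearK.
- move=> x; have := tshearK b (- c.1.1, - c.1.2, - c.2) x.
  by rewrite /= !opprK -!surjective_pairing.
Qed.

Definition shear b c : DiffVol R := Build_DiffVol (voldiff_tshear b c).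

Lemma tdiff_tshear b c (p v : plane R) : tdiff (tshear b c) (tpi p) v =
  if b then (v.1, v.2 + v.1 * wave (dwave c) p.1) else (v.1 + v.2 * wave (dwave c) p.2, v.2).
Proof.
rewrite (tdiffE _ (tsmooth_tshear b c) (smooth_lift_tshear b c p)).
have dp := differentiable_push b c p.
have did : differentiable (@idfun (plane R)) p by have [] := is_diff_id p.
rewrite -deriveE; last exact: (differentiableD did dp).
rewrite (deriveD (diff_derivable did) (diff_derivable dp)).
rewrite derive_id derive_push; case: b {dp}; case: v => v1 v2;
  by congr pair => /=; rewrite addr0.
Qed.

End shear_volume.

Section interval_bounds.
Context (R : realType).
Implicit Types u l z e q : R.

Lemma itv01 u l z : 0 <= u -> u + l <= 1 -> u <= z -> z < u + l -> 0 <= z < 1.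
Proof. by move=> *; apply/andP; split; lra. Qed.

Lemma itv_widen u l e : 0 <= l -> 0 <= e -> u - e <= u + l + e.
Proof. by move=> *; lra. Qed.

Lemma itv2l u z l e : 0 <= l -> e <= l -> u - e <= z -> z <= u + l + e ->
  `|z - u| <= 2 * l.
Proof. by move=> *; rewrite ler_norml; apply/andP; split; lra. Qed.

Lemma half01 z : `|z - 1 / 2| < 1 / 2 -> 0 <= z < 1.
Proof. by rewrite ltr_norml => /andP[? ?]; apply/andP; split; lra. Qed.

Lemma itv_perturb u z q q' l e : q <= q' -> q' < q + l ->
  `|z - u - (q' - q)| <= e -> u - e <= z <= u + l + e.
Proof. by rewrite ler_norml => ? ? /andP[? ?]; apply/andP; split; lra. Qed.

Lemma itv_norm u z l : u <= z -> z < u + l -> `|z - u| <= l.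
Proof. by move=> *; rewrite ler_norml; apply/andP; split; lra. Qed.

Lemma contraction_sqr z : 0 <= z -> z < 1 -> z * (1 + 2 * ((1 - z) / 16)) ^+ 2 < 1.
Proof.
move=> z0 z1; pose t := (1 - z) / 16; have t0 : 0 < t by rewrite /t; lra.
have -> : z * (1 + 2 * ((1 - z) / 16)) ^+ 2 = 1 - 12 * t - 60 * t ^+ 2 - 64 * t ^+ 3.
  by rewrite /t; field.
have := exprn_gt0 2 t0; have := exprn_gt0 3 t0; lra.
Qed.

End interval_bounds.

Section translations.
Context (R : realType).

(** Built from two shears of constant profile, it is a volume-preserving diffeomorphism by
    construction. *)
Definition transl (a : plane R) : DiffVol R :=
  diffvol_comp (shear true (a.2, 0, 0)) (shear false (a.1, 0, 0)).

Lemma wave_cst (k y : R) : wave (k, 0, 0) y = k.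
Proof. by rewrite /wave /= !mul0r !addr0. Qed.

Lemma transl_tpi (a p : plane R) : transl a (tpi p) = tpi (p + a).
Proof. by rewrite /= !tshear_tpi !pshearE /= !wave_cst. Qed.

Lemma diffvol_tsmooth (f : DiffVol R) : tsmooth f.
Proof. by case: f => f []. Qed.

Lemma diffvol_preserves (f : DiffVol R) : preserves_vol f.
Proof. by case: f => f []. Qed.

Lemma tdiff_transl (a : plane R) (x : torus R) (v : plane R) : tdiff (transl a) x v = v.
Proof.
rewrite tdiff_comp; [|exact: tsmooth_tshear..].
rewrite -(tpi_repr x) /= tshear_tpi !tdiff_tshear /dwave /= !mulr0 oppr0.
by rewrite !wave_cst !mulr0 !addr0 -surjective_pairing.
Qed.

End translations.

(** * Area and the derivative of a volume-preserving map *)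

Section jacobian.
Context (R : realType).
Local Notation lam := (@lebesgue_measure R).
Local Notation lam2 := (lam \x lam)%E.
Local Notation mplane := (measurableTypeR R * measurableTypeR R)%type.
Implicit Types (f g : torus R -> torus R) (x : torus R) (p q v : plane R).

Definition tdet f x : R :=
  (tdiff f x (1, 0)).1 * (tdiff f x (0, 1)).2 -
  (tdiff f x (0, 1)).1 * (tdiff f x (1, 0)).2.

Lemma tdiff_lin2 f x v : tdiff f x v =
  lin2 (tdiff f x (1, 0)).1 (tdiff f x (0, 1)).1
       (tdiff f x (1, 0)).2 (tdiff f x (0, 1)).2 v.
Proof.
rewrite tdiffl /basis2 [LHS]surjective_pairing; congr pair; rewrite /= /GRing.scale /=;
  by congr (_ + _); rewrite mulrC.
Qed.

Lemma torus_cell x : exists2 p, cell p & tpi p = x.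
Proof.
pose q := repr x.
exists (q.1 - (Num.floor q.1)%:~R, q.2 - (Num.floor q.2)%:~R).
  have /andP[a1 a2] := floor_itv q.1; have /andP[b1 b2] := floor_itv q.2.
  rewrite intrD1 in a2; rewrite intrD1 in b2.
  by split; rewrite /= in_itv /= subr_ge0 ltrBlDl (a1, b1) (a2, b2).
rewrite -[RHS]tpi_repr; apply/tpiP; rewrite /equivZ2 /=.
by rewrite !(addrAC _ (- (_%:~R))) !subrr !add0r !rpredN !intr_int.
Qed.

Lemma lam2_box (a b c d : R) : a <= b -> c <= d ->
  lam2 (`[a, b] `*` `[c, d] : set mplane) = ((b - a) * (d - c))%:E.
Proof.
move=> ab cd.
have l (u v : R) : u <= v -> lam (`[u, v]%classic : set (measurableTypeR R)) = (v - u)%:E.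
  rewrite lebesgue_measure_itv /= lte_fin le_eqVlt => /predU1P[->|->]//.
  by rewrite ltxx subrr.
rewrite product_measure1E//.
by rewrite [LHS](_ : _ = lam `[a, b]%classic * lam `[c, d]%classic)%E// !l// EFinM.
Qed.

Lemma lam2_boxo (a b l : R) : 0 <= l ->
  lam2 (`[a, a + l[ `*` `[b, b + l[ : set mplane) = (l ^+ 2)%:E.
Proof.
move=> l0.
have lE (u : R) : lam (`[u, u + l[%classic : set (measurableTypeR R)) = l%:E.
  rewrite lebesgue_measure_itv /= lte_fin ltrDl; move: l0; rewrite le_eqVlt.
  by move=> /predU1P[<-|l0]; rewrite ?ltxx// l0 -EFinD addrAC subrr add0r.
rewrite product_measure1E//.
by rewrite [LHS](_ : _ = lam `[a, (a + l)%R[%classic * lam `[b, (b + l)%R[%classic)%E// !lE.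
Qed.

Lemma lam2_lin2_preimage (a b c d : R) (S : set mplane) :
  a * d - b * c != 0 -> measurable S ->
  lam2 (lin2 a b c d @^-1` S) = (`|a * d - b * c|^-1%:E * lam2 S)%E.
Proof.
move=> D0 mS.
have mS' : measurable (lin2 a b c d @^-1` S).
  by rewrite -[X in measurable X]setTI; exact: (@measurable_lin2 R).
rewrite -[X in lam2 X]setIT -integral_indic// -[X in (_ * lam2 X)%E]setIT -integral_indic//.
by rewrite -integral_lin2//; exact/measurable_EFinP.
Qed.

Lemma differentiable_approx (F : plane R -> plane R) p (e : R) : 0 < e ->
  differentiable F p -> exists2 r, 0 < r & forall h : plane R, `|h| < r ->
    `|F (p + h) - F p - 'd F p h| <= e * `|h|.
Proof.
move=> e0 /diff_locallyP[cF /eqaddoP /(_ e e0) /= /nbhs_ballP[r /= r0 h]].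
exists r => // k kr; have := h k; rewrite -ball_normE /= sub0r normrN => /(_ kr).
by rewrite !fctE /= opprD addrA (addrC k).
Qed.

(* Linearize on a small square [Q] with its lower left corner in the unit cell:
   [f] maps [tpi @` Q] into the projection of a parallelogram of area about
   [`|tdet f x|] times that of [Q]. *)
Lemma tdet_ge1 f x : tsmooth f -> tdet f x != 0 ->
  (forall C D : set (torus R), measurable C -> measurable D ->
     (forall y, C y -> D (f y)) -> (vol C <= vol D)%E) ->
  1 <= `|tdet f x|.
Proof.
move=> sf; have [p cp <-] := torus_cell x; have [F lF] := sf p.
have dF : differentiable F p by exact: (nbhs_singleton lF.2 [::]).
rewrite /tdet !(tdiffE _ sf lF).
have tE v : tdiff f (tpi p) v = 'd F p v by exact: tdiffE.
have := tdiff_lin2 f (tpi p); rewrite !tE.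
set a := ('d F p (1, 0)).1; set b := ('d F p (0, 1)).1.
set c := ('d F p (1, 0)).2; set d := ('d F p (0, 1)).2.
set D := a * d - b * c => linE D0 vle.
have {}linE v : 'd F p v = lin2 a b c d v by rewrite -linE tE.
rewrite leNgt; apply/negP => D1.
pose iA : mplane -> mplane := lin2 (d / D) (- b / D) (- c / D) (a / D).
have iAK v : iA (lin2 a b c d v) = v.
  rewrite /iA /lin2 /= [RHS]surjective_pairing; congr pair;
    by rewrite /D; field; exact: D0.
have AiK v : lin2 a b c d (iA v) = v.
  rewrite /iA /lin2 /= [RHS]surjective_pairing; congr pair;
    by rewrite /D; field; exact: D0.
have iAB u v : iA (u - v) = iA u - iA v.
  by rewrite /iA /lin2 /= [RHS]surjective_pairing; congr pair => /=; ring.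
have bnd (a' b' c' d' : R) : exists2 K, 0 < K & forall v : plane R,
    `|lin2 a' b' c' d' v| <= K * `|v|.
  exists (1 + (`|a'| + `|b'| + `|c'| + `|d'|)).
    by rewrite ltr_wpDr ?addr_ge0.
  move=> v; rewrite prod_normE ge_max /=.
  have h1 : `|v.1| <= `|v| by rewrite prod_normE le_max lexx.
  have h2 : `|v.2| <= `|v| by rewrite prod_normE le_max lexx orbT.
  have m (s t : R) : `|s * v.1 + t * v.2| <= (`|s| + `|t|) * `|v|.
    apply: le_trans (ler_normD _ _) _; rewrite !normrM mulrDl lerD// ler_wpM2l//.
  apply/andP; split; (apply: le_trans (m _ _) _; rewrite ler_wpM2r//);
    have := normr_ge0 a'; have := normr_ge0 b'; have := normr_ge0 c';
    have := normr_ge0 d'; clear; lra.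
have [K K0 hK] := bnd (d / D) (- b / D) (- c / D) (a / D).
have [K' K'0 hK'] := bnd a b c d.
pose eta := (1 - `|D|) / 16.
have eta0 : 0 < eta by rewrite /eta; lra.
have [r1 r10 hr1] := differentiable_approx (divr_gt0 eta0 K0) dF.
have [r r0 [rr1 hr]] : exists2 r, 0 < r & r <= r1 /\
    forall q, `|q - p| < r -> tpi (F q) = f (tpi q).
  have /nbhs_ballP[r2 /= r20 h2] := lF.1.
  exists (Num.min r1 r2); first by rewrite lt_min r10.
  split => [|q]; first by rewrite ge_min lexx.
  rewrite lt_min => /andP[_ q2]; apply: h2; rewrite -ball_normE /=.
  by rewrite distrC.
have [l [l0 lr l1 l2 lK]] : exists l, [/\ 0 < l, l < r, p.1 + l <= 1, p.2 + l <= 1 &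
    K' * (2 * l) < 1 / 2].
  have [/= + +] := cp; rewrite !in_itv /= => /andP[_ p1] /andP[_ p2].
  exists (Num.min (Num.min (r / 2) (1 / (8 * K'))) (Num.min (1 - p.1) (1 - p.2))).
  set m := Num.min _ _.
  have k0 : 0 < 1 / (8 * K') by rewrite divr_gt0// mulr_gt0.
  have m0 : 0 < m by rewrite !lt_min !subr_gt0 p1 p2 k0 divr_gt0.
  have /andP[/andP[m1 m2] /andP[m3 m4]] : (m <= r / 2) && (m <= 1 / (8 * K')) &&
      ((m <= 1 - p.1) && (m <= 1 - p.2)) by rewrite -!le_min lexx.
  split => //.
  - by move: r0 m1; clear; lra.
  - by move: m3; clear; lra.
  - by move: m4; clear; lra.
  - by move: m2; rewrite ler_pdivlMr ?mulr_gt0//; clear; lra.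
(* The image is recentred at the middle of the unit cell, because the volume of a projection is
   computed only for sets inside that cell. *)
pose h : plane R := (1 / 2, 1 / 2).
pose Q : set mplane := `[p.1, p.1 + l[ `*` `[p.2, p.2 + l[.
pose box : set mplane := `[(iA h).1 - eta * l, (iA h).1 + l + eta * l] `*`
  `[(iA h).2 - eta * l, (iA h).2 + l + eta * l].
pose P := iA @^-1` box.
have mQ : measurable Q by apply: measurableX; exact: measurable_itv.
have mbox : measurable box by apply: measurableX; exact: measurable_itv.
have mP : measurable P.
  by rewrite -[X in measurable X]setTI; exact: (@measurable_lin2 R).
have Qc : Q `<=` @cell R.
  move=> q [/=]; rewrite !in_itv /= => /andP[q1 q2] /andP[q3 q4].
  have [/= + +] := cp; rewrite !in_itv /= => /andP[p1 _] /andP[p2 _].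
  by split; rewrite /= in_itv /=; [apply: itv01 q1 q2|apply: itv01 q3 q4].
have el : eta * l <= l.
  by rewrite ler_piMl ?(ltW l0)// /eta; move: (normr_ge0 D); clear; lra.
have Pc : P `<=` @cell R.
  move=> z [/=]; rewrite !in_itv /= => /andP[z1 z2] /andP[z3 z4].
  have : `|z - h| < 1 / 2.
    rewrite -(AiK (z - h)) iAB; apply: le_lt_trans lK.
    apply: le_trans (hK' _) _; rewrite ler_wpM2l ?(ltW K'0)//.
    rewrite prod_normE ge_max; apply/andP; split.
      exact: (itv2l (ltW l0) el z1 z2).
    exact: (itv2l (ltW l0) el z3 z4).
  rewrite prod_normE gt_max /= => /andP[? ?].
  by split; rewrite /= in_itv /= half01.
pose t := h - F p.
have := vle (@tpi R @` Q) (transl t @^-1` (@tpi R @` P)).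
have mPi := measurable_tpi_image mP.
have [mt vt] := diffvol_preserves (transl t).
have el0 := mulr_gt0 eta0 l0.
have iD : d / D * (a / D) - - b / D * (- c / D) = D^-1.
  by rewrite /D; field; exact: D0.
have lP : lam2 P = (`|D| * (1 + 2 * eta) ^+ 2 * l ^+ 2)%:E.
  have := @lam2_lin2_preimage (d / D) (- b / D) (- c / D) (a / D) box.
  rewrite iD invr_eq0 => /(_ D0 mbox) ->; rewrite normfV invrK.
  by rewrite lam2_box ?itv_widen ?(ltW el0) ?(ltW l0)// -EFinM; congr EFin; ring.
rewrite vt// !vol_tpi_image// lP (lam2_boxo _ _ (ltW l0)).
rewrite lee_fin => /(_ (measurable_tpi_image mQ)).
have vE : measurable (transl t @^-1` (@tpi R @` P)).
  by rewrite -[X in measurable X]setTI; exact: mt.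
move=> /(_ vE); suff tt : forall y, (@tpi R @` Q) y -> (transl t @^-1` (@tpi R @` P)) (f y).
  move=> /(_ tt); have l20 : 0 < l ^+ 2 by rewrite exprn_gt0.
  rewrite -{1}[l ^+ 2]mul1r ler_pM2r// /eta.
  by rewrite leNgt contraction_sqr.
move=> _ [q Qq <-].
move: Qq => [/=]; rewrite !in_itv /= => /andP[q1 q2] /andP[q3 q4].
have qp : `|q - p| <= l.
  by rewrite prod_normE ge_max /= !itv_norm.
have qr : `|q - p| < r by exact: le_lt_trans lr.
rewrite -(hr q qr); suff : [set tpi z | z in P] (transl t (tpi (F q))) by [].
rewrite transl_tpi; exists (F q + t) => //.
have : `|iA (F (p + (q - p)) - F p - 'd F p (q - p))| <= eta * l.
  apply: le_trans (hK _) _.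
  have := hr1 (q - p) (lt_le_trans qr rr1).
  rewrite -(ler_pM2l K0) => h1; apply: le_trans h1 _.
  by rewrite mulrA mulrCA mulfV ?gt_eqF// mulr1 ler_wpM2l// ltW.
rewrite [p + _]addrC subrK linE iAB iAK.
have -> : iA (F q - F p) = iA (F q + t) - iA h.
  by rewrite -iAB /t; congr iA; apply/esym; rewrite addrA addrAC addrK.
rewrite prod_normE ge_max => /andP[u1 u2].
split; rewrite /= in_itv /=; first exact: itv_perturb q1 q2 u1.
exact: itv_perturb q3 q4 u2.
Qed.

End jacobian.

Section volume_preserving_derivative.
Context (R : realType).
Implicit Types (f g : DiffVol R) (x : torus R) (v w : plane R).

Lemma tdet_comp (f g : torus R -> torus R) x : tsmooth f -> tsmooth g ->
  tdet (f \o g) x = tdet f (g x) * tdet g x.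
Proof.
move=> sf sg; rewrite /tdet !(tdiff_comp _ _ sf sg).
rewrite (tdiff_lin2 f (g x) (tdiff g x (1, 0))) (tdiff_lin2 f (g x) (tdiff g x (0, 1))).
rewrite /lin2.
move: (tdiff f (g x) (1, 0)) (tdiff f (g x) (0, 1)) (tdiff g x (1, 0)) (tdiff g x (0, 1)).
by move=> [a c] [b d] [a' c'] [b' d'] /=; ring.
Qed.

Lemma tdiff_id x v : tdiff idfun x v = v.
Proof.
rewrite -(tpi_repr x) (tdiffE (F := idfun) v (@tsmooth_id R)).
  by have [_ ->] := is_diff_id (repr x : plane R).
split; first by near=> q.
near=> q; move=> s; have [c [->|->]] := partials_id R s.
- exact: differentiable_cst.
- by have [] := is_diff_id q.
Unshelve. all: by end_near. Qed.

Lemma le_vol (C D : set (torus R)) : measurable C -> measurable D -> C `<=` D ->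
  (vol C <= vol D)%E.
Proof. by move=> mC mD CD; rewrite -!tvolE; apply: le_measure; rewrite ?inE. Qed.

Lemma norm_mul1 (a b : R) : b * a = 1 -> 1 <= `|a| -> 1 <= `|b| -> `|a| = 1.
Proof.
move=> ba1 a1 b1; have := congr1 (fun z => `|z|) ba1; rewrite normrM normr1 => h.
by apply/eqP; rewrite eq_le a1 andbT -h ler_peMl.
Qed.

(** Comparing areas only bounds the determinant from below; applied to the inverse map it gives the
    upper bound, as the two determinants have product 1. *)
Lemma tdet_norm f x : `|tdet f x| = 1.
Proof.
case: f => f [/= sf [g [sg fK gK]] [mf vf]].
have mfD D : measurable D -> measurable (f @^-1` D).
  by move=> mD; rewrite -[X in measurable X]setTI; exact: mf.
have det1 : tdet g (f x) * tdet f x = 1.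
  rewrite -tdet_comp// (_ : g \o f = idfun); last by apply/funext => y /=; rewrite fK.
  by rewrite /tdet !tdiff_id /= mulr1 mulr0 subr0.
have [g0 f0] : tdet g (f x) != 0 /\ tdet f x != 0.
  by apply/andP; rewrite -negb_or -mulf_eq0 det1 oner_eq0.
have hf : 1 <= `|tdet f x|.
  apply: (tdet_ge1 sf f0) => C D mC mD CD; rewrite -(vf D mD).
  by apply: le_vol => //; exact: mfD.
have hg : 1 <= `|tdet g (f x)|.
  apply: (tdet_ge1 sg g0) => C D mC mD CD; rewrite -(vf C mC).
  apply: le_vol => //; first exact: mfD.
  by move=> y /CD; rewrite fK.
exact: (norm_mul1 det1 hf hg).
Qed.

(** The Frobenius norm. It dominates the operator norm, and its square is polynomial in the entries,
    so that the inequalities below reduce to sums of squares. *)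
Definition tnorm (f : torus R -> torus R) x : R :=
  Num.sqrt (enorm (tdiff f x (1, 0)) ^+ 2 + enorm (tdiff f x (0, 1)) ^+ 2).

Lemma tnorm_ge0 (f : torus R -> torus R) x : 0 <= tnorm f x.
Proof. exact: sqrtr_ge0. Qed.

Lemma sqr_tnorm (f : torus R -> torus R) x : tnorm f x ^+ 2 =
  enorm (tdiff f x (1, 0)) ^+ 2 + enorm (tdiff f x (0, 1)) ^+ 2.
Proof. by rewrite sqr_sqrtr// addr_ge0// sqr_ge0. Qed.

Lemma enorm_tdiff_le (f : torus R -> torus R) x v :
  enorm (tdiff f x v) <= tnorm f x * enorm v.
Proof.
rewrite ler_enorm ?mulr_ge0 ?tnorm_ge0 ?enorm_ge0// exprMn sqr_tnorm !sqr_enorm.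
rewrite (tdiff_lin2 f x v) /lin2 /=.
move: (tdiff f x (1, 0)) (tdiff f x (0, 1)) v => [a c] [b d] [v1 v2] /=.
have := sqr_ge0 (a * v2 - b * v1); have := sqr_ge0 (c * v2 - d * v1); lra.
Qed.

(** For determinant 1 or -1 the inverse is up to sign the adjugate, which has the same Frobenius
    norm. *)
Lemma enorm_tdiff_ge f x v : enorm v <= tnorm f x * enorm (tdiff f x v).
Proof.
rewrite ler_enorm ?mulr_ge0 ?tnorm_ge0 ?enorm_ge0// exprMn sqr_tnorm !sqr_enorm.
have : tdet f x ^+ 2 = 1 by rewrite -(real_normK (num_real _)) tdet_norm expr1n.
rewrite (tdiff_lin2 f x v) /lin2 /tdet /=.
move: (tdiff f x (1, 0)) (tdiff f x (0, 1)) v => [a c] [b d] [v1 v2] /= D1.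
set y1 := a * v1 + b * v2; set y2 := c * v1 + d * v2.
have e1 : (a * d - b * c) * v1 = d * y1 - b * y2 by rewrite /y1 /y2; ring.
have e2 : (a * d - b * c) * v2 = a * y2 - c * y1 by rewrite /y1 /y2; ring.
have -> : v1 ^+ 2 + v2 ^+ 2 = (d * y1 - b * y2) ^+ 2 + (a * y2 - c * y1) ^+ 2.
  by rewrite -e1 -e2 !exprMn D1 !mul1r.
move: y1 y2 {e1 e2 D1} => y1 y2.
have := sqr_ge0 (d * y2 + b * y1); have := sqr_ge0 (a * y1 + c * y2); lra.
Qed.

Lemma tnorm_ge1 f x : 1 <= tnorm f x.
Proof.
rewrite -(ler_pXn2r (n := 2)) ?nnegrE ?tnorm_ge0// expr1n sqr_tnorm !sqr_enorm.
have := tdet_norm f x; rewrite /tdet.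
move: (tdiff f x (1, 0)) (tdiff f x (0, 1)) => [a c] [b d] /= D1.
have h1 := sqr_ge0 (a - d); have h2 := sqr_ge0 (b + c).
have h3 := sqr_ge0 (a + d); have h4 := sqr_ge0 (b - c).
by case: (lerP 0 (a * d - b * c)) D1 => h; [rewrite ger0_norm|rewrite ltr0_norm] => //; lra.
Qed.

Lemma enorm_tdiff_gt0 f x v : v != 0 -> 0 < enorm (tdiff f x v).
Proof.
move=> /enorm_gt0 v0; have := lt_le_trans v0 (enorm_tdiff_ge f x v).
by rewrite pmulr_rgt0// (lt_le_trans ltr01 (tnorm_ge1 f x)).
Qed.

Lemma tdiff0 (f : torus R -> torus R) x : tdiff f x 0 = 0.
Proof. by rewrite (tdiff_lin2 f x 0) /lin2 /= !mulr0 addr0. Qed.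

Lemma tdiffZ (f : torus R -> torus R) x (k : R) v : tdiff f x (k *: v) = k *: tdiff f x v.
Proof.
rewrite (tdiff_lin2 f x (k *: v)) (tdiff_lin2 f x v) /lin2.
move: (tdiff f x (1, 0)) (tdiff f x (0, 1)) => [a c] [b d].
by rewrite [RHS]surjective_pairing; congr pair; rewrite /= /GRing.scale /=; ring.
Qed.

Lemma tdiff_eq0 f x v : (tdiff f x v == 0) = (v == 0).
Proof.
apply/eqP/eqP => [h|->]; last exact: tdiff0.
apply/eqP; apply: contraT => /(enorm_tdiff_gt0 f x).
by rewrite h enorm0 ltxx.
Qed.

End volume_preserving_derivative.

(** * The invariant measure on the tangent bundle and Schur's test *)

Section tangent_bundle.
Context (R : realType).
Local Notation lam := (@lebesgue_measure R).
Local Notation lam2 := (lam \x lam)%E.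
Local Notation mplane := (measurableTypeR R * measurableTypeR R)%type.
Local Open Scope ereal_scope.

Lemma measurable_fun_torus d (T : measurableType d) (g : torus R -> T) :
  measurable_fun setT ((fun p => g (tpi p)) : mplane -> T) -> measurable_fun setT g.
Proof.
move=> mg _ A mA; rewrite setTI.
by have := mg measurableT A mA; rewrite setTI.
Qed.

Lemma continuous_measurable_pair (K : plane R -> plane R) : continuous K ->
  measurable_fun setT (K : mplane -> mplane).
Proof.
move=> cK; rewrite (_ : K = (fun p => ((K p).1, (K p).2))%R).
  apply: measurable_fun_pair; apply: continuous_measurable_fun2 => p;
    apply: continuous_comp; try exact: cK.
    exact: fst_cont.
  exact: snd_cont.
by apply/funext => p; rewrite -surjective_pairing.
Qed.

Lemma measurable_tdiff (f : DiffVol R) (i : bool) :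
  measurable_fun setT (fun x => tdiff f x (basis2 R i) : mplane).
Proof.
rewrite (_ : (fun x => _) = tpartials [:: i] f); last first.
  by apply/funext => x; exact/tdiff_basis/diffvol_tsmooth.
apply: measurable_fun_torus.
have c := @continuous_tpartials R f [:: i] erefl (@diffvol_tsmooth R f).
exact: (continuous_measurable_pair c).
Qed.

Definition tmap (f : DiffVol R) (z : torus R * mplane) : torus R * mplane :=
  (f z.1, tdiff f z.1 z.2).

Lemma measurable_tmap (f : DiffVol R) : measurable_fun setT (tmap f).
Proof.
have [mf _] := diffvol_preserves f.
apply: measurable_fun_pair.
  exact: (measurableT_comp mf).
have m1 := measurable_tdiff f false; have m2 := measurable_tdiff f true.
rewrite (_ : (fun z => _) = (fun z : torus R * mplane =>
  lin2 (tdiff f z.1 (1, 0)).1 (tdiff f z.1 (0, 1)).1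
       (tdiff f z.1 (1, 0)).2 (tdiff f z.1 (0, 1)).2 z.2))%R; last first.
  by apply/funext => z; rewrite tdiff_lin2.
have c1 (i : bool) : measurable_fun setT
    (fun z : torus R * mplane => (tdiff f z.1 (basis2 R i)).1 : measurableTypeR R).
  apply: (measurableT_comp (f := fst)) => //.
  by apply: (measurableT_comp (f := fun x => tdiff f x (basis2 R i) : mplane)) => //;
    exact: measurable_tdiff.
have c2 (i : bool) : measurable_fun setT
    (fun z : torus R * mplane => (tdiff f z.1 (basis2 R i)).2 : measurableTypeR R).
  apply: (measurableT_comp (f := snd)) => //.
  by apply: (measurableT_comp (f := fun x => tdiff f x (basis2 R i) : mplane)) => //;
    exact: measurable_tdiff.
have v1 : measurable_fun setT (fun z : torus R * mplane => z.2.1 : measurableTypeR R).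
  exact: (measurableT_comp (f := fst)).
have v2 : measurable_fun setT (fun z : torus R * mplane => z.2.2 : measurableTypeR R).
  exact: (measurableT_comp (f := snd)).
by apply: measurable_fun_pair; apply: measurable_funD; apply: measurable_funM => //;
  [exact: (c1 false)|exact: (c1 true)|exact: (c2 false)|exact: (c2 true)].
Qed.

(** A name for the product measure that carries its sigma-finiteness, on which integration over the
    fibres relies. *)
Definition plam : set mplane -> \bar R := lam2.

HB.instance Definition _ := Measure.on plam.

Lemma sigma_finite_plam : sigma_finite setT plam.
Proof.
exists (fun n => `[(- n%:R)%R, n%:R]%classic `*` `[(- n%:R)%R, n%:R]%classic).
  apply/esym; rewrite -subTset => v _.
  have [n vn] : exists n : nat, (`|v.1| + `|v.2| <= n%:R)%R.
    by exists (Num.bound (`|v.1| + `|v.2|)); rewrite ltW// archi_boundP// addr_ge0.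
  exists n => //; have := normr_ge0 v.1; have := normr_ge0 v.2 => h1 h2.
  by split; rewrite /= in_itv /= -ler_norml; lra.
move=> n; split; first by apply: measurableX; exact: measurable_itv.
have n0 : (- n%:R <= n%:R :> R)%R by rewrite ge0_cp.
by rewrite /plam lam2_box// ltry.
Qed.

HB.instance Definition _ := Measure_isSigmaFinite.Build _ _ _ plam sigma_finite_plam.

Definition tint (psi : torus R * mplane -> \bar R) : \bar R :=
  \int[@tvol R]_x \int[plam]_v psi (x, v).

Lemma measurable_tint (psi : torus R * mplane -> \bar R) :
  measurable_fun setT psi -> (forall z, 0 <= psi z) ->
  measurable_fun setT (fun x => \int[plam]_v psi (x, v)).
Proof. by move=> mpsi psi0; exact: (@measurable_fun_fubini_tonelli_F _ _ _ _ R plam psi mpsi psi0). Qed.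

(** On each fibre the derivative has determinant of absolute value 1, and on the base the volume is
    preserved. Composition with [tmap f] is therefore an isometry of L^2 of the tangent bundle. *)
Lemma tint_tmap (f : DiffVol R) (psi : torus R * mplane -> \bar R) :
  measurable_fun setT psi -> (forall z, 0 <= psi z) ->
  tint (psi \o tmap f) = tint psi.
Proof.
move=> mpsi psi0; rewrite /tint.
rewrite -(integral_preserves_vol (diffvol_preserves f) (measurable_tint mpsi psi0)); last first.
  by move=> x; exact: integral_ge0.
apply: eq_integral => x _ /=.
have mpx : measurable_fun setT (fun v => psi (f x, v)).
  by apply: (measurableT_comp mpsi); exact: measurable_pair1.
under eq_integral do rewrite /tmap /= tdiff_lin2.
have D1 := tdet_norm f x; rewrite /tdet in D1.
have D0 : ((tdiff f x (1, 0)).1 * (tdiff f x (0, 1)).2 -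
  (tdiff f x (0, 1)).1 * (tdiff f x (1, 0)).2 != 0)%R by rewrite -normr_eq0 D1 oner_eq0.
by rewrite (integral_lin2 D0 mpx)// D1 invr1 mul1e.
Qed.

End tangent_bundle.

Lemma measurable_inv (R : realType) :
  measurable_fun setT (fun x : measurableTypeR R => x^-1 : measurableTypeR R).
Proof.
rewrite -(setUv [set 0]); apply/measurable_funU => //.
- exact: measurableC.
- split; first exact: measurable_fun_set1.
  apply: open_continuous_measurable_fun.
    by apply: closed_openC; apply: accessible_closed_set1; apply: hausdorff_accessible; exact: Rhausdorff.
  by move=> x /set_mem/eqP x0; exact: inv_continuous.
Qed.

Section koopman.
Context (R : realType).
Local Notation mplane := (measurableTypeR R * measurableTypeR R)%type.
Local Notation bundle := (torus R * mplane)%type.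
Implicit Types (phi : bundle -> R) (f : DiffVol R).

Lemma le_tint (psi psi' : bundle -> \bar R) :
  measurable_fun setT psi -> measurable_fun setT psi' ->
  (forall z, 0 <= psi z)%E -> (forall z, psi z <= psi' z)%E ->
  (tint psi <= tint psi')%E.
Proof.
move=> m1 m2 p0 le; have p0' z : (0 <= psi' z)%E by exact: le_trans (le z).
apply: ge0_le_integral.
- exact: measurableT.
- by move=> x _; exact: integral_ge0.
- exact: measurable_tint.
- exact: measurable_tint.
- move=> x _; apply: ge0_le_integral => //.
  + by apply: (measurableT_comp m1); exact: measurable_pair1.
  + by apply: (measurableT_comp m2); exact: measurable_pair1.
Qed.

Lemma tintZ (k : R) (psi : bundle -> \bar R) : 0 <= k ->
  measurable_fun setT psi -> (forall z, 0 <= psi z)%E ->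
  tint (fun z => k%:E * psi z)%E = (k%:E * tint psi)%E.
Proof.
move=> k0 m1 p0; rewrite /tint.
under eq_integral => x _.
  rewrite ge0_integralZl//; last by apply: (measurableT_comp m1); exact: measurable_pair1.
  over.
rewrite ge0_integralZl//; first exact: measurable_tint.
by move=> x _; exact: integral_ge0.
Qed.

Lemma tint_sum (T : Type) (s : seq T) (psi : T -> bundle -> \bar R) :
  (forall t, measurable_fun setT (psi t)) -> (forall t z, 0 <= psi t z)%E ->
  tint (fun z => \sum_(t <- s) psi t z)%E = (\sum_(t <- s) tint (psi t))%E.
Proof.
move=> m1 p0; rewrite /tint.
under eq_integral => x _.
  rewrite ge0_integral_sum//; last first.
    by move=> t; apply: (measurableT_comp (m1 t)); exact: measurable_pair1.
  over.
rewrite ge0_integral_sum//; first by move=> t; exact: measurable_tint.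
by move=> t x _; exact: integral_ge0.
Qed.

Lemma tint_avg (T : Type) (s : seq T) (phi : T -> bundle -> R) :
  (forall t, measurable_fun setT (phi t)) -> (forall t z, 0 <= phi t z) ->
  tint (fun z => (avg s (phi^~ z))%:E) =
  (((size s)%:R^-1)%:E * \sum_(t <- s) tint (fun z => (phi t z)%:E))%E.
Proof.
move=> m1 p0; rewrite -tint_sum; last 2 first.
- by move=> t; exact/measurable_EFinP.
- by move=> t z; rewrite lee_fin.
rewrite -tintZ//; last 2 first.
- by apply: emeasurable_sum => t; exact/measurable_EFinP.
- by move=> z; apply: sume_ge0 => t _; rewrite lee_fin.
by congr tint; apply/funext => z; rewrite /avg EFinM -sumEFin.
Qed.

Lemma measurable_avg (T : Type) (s : seq T) (phi : T -> bundle -> R) :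
  (forall t, measurable_fun setT (phi t)) ->
  measurable_fun setT (fun z => avg s (phi^~ z)).
Proof. by move=> m1; apply: measurable_funM => //; exact: measurable_sum. Qed.

Definition energy phi : \bar R := tint (fun z => (phi z ^+ 2)%:E).

Lemma measurable_sqr phi : measurable_fun setT phi ->
  measurable_fun setT (fun z => (phi z ^+ 2)%:E).
Proof. by move=> mphi; apply/measurable_EFinP; exact: measurable_funX. Qed.

Lemma energy_tmap phi f : measurable_fun setT phi ->
  energy (phi \o tmap f) = energy phi.
Proof.
move=> mphi.
apply: (@tint_tmap R f (fun z => (phi z ^+ 2)%:E)); first exact: measurable_sqr.
by move=> z; rewrite lee_fin sqr_ge0.
Qed.

(* Schur's test for the average of the unitary operators [phi |-> phi \o tmap f]. *)
Lemma schur_test (T : eqType) (s : seq T) (F F' : T -> DiffVol R)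
    (N : mplane -> R) (r : R) phi :
  (0 < size s)%N -> 0 <= r -> measurable_fun setT N -> (forall v, 0 <= N v) ->
  (forall v, N v = 0 -> v = 0) ->
  (forall t, cancel (F t) (F' t)) ->
  (forall x v, v != 0 -> avg s (fun t => N v / N (tdiff (F t) x v)) <= r) ->
  (forall x v, v != 0 -> avg s (fun t => N v / N (tdiff (F' t) x v)) <= r) ->
  measurable_fun setT phi -> (forall x, phi (x, 0) = 0) ->
  (energy (fun z => avg s (fun t => phi (tmap (F t) z))) <= (r ^+ 2)%:E * energy phi)%E.
Proof.
move=> s0 r0 mN N0 Neq0 invK a_le a'_le mphi phi0.
pose a (f : DiffVol R) (z : bundle) := N z.2 / N (tdiff f z.1 z.2).
have a0 f z : 0 <= a f z by rewrite divr_ge0.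
have ma f : measurable_fun setT (a f).
  apply: measurable_funM; first exact: (measurableT_comp mN).
  have mv := measurableT_comp mN (measurableT_comp measurable_snd (measurable_tmap f)).
  exact: (measurableT_comp (@measurable_inv R) mv).
pose psi t (z : bundle) := phi z ^+ 2 * a (F' t) z.
have mpsi t : measurable_fun setT (psi t).
  by apply: measurable_funM => //; exact: measurable_funX.
have psi0 t z : 0 <= psi t z by rewrite mulr_ge0// sqr_ge0.
have mU (f : DiffVol R) (u : bundle -> R) : measurable_fun setT u ->
    measurable_fun setT (fun z => u (tmap f z)).
  by move=> mu; apply: (measurableT_comp mu); exact: measurable_tmap.
have phi0' (f : DiffVol R) (x : torus R) : phi (tmap f (x, 0)) = 0.
  by rewrite /tmap /= tdiff0 phi0.
have step1 z : avg s (fun t => phi (tmap (F t) z)) ^+ 2 <=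
    r * avg s (fun t => psi t (tmap (F t) z)).
  case: z => x v; have [->|v0] := eqVneq v 0.
    rewrite (_ : avg s _ = 0) ?expr0n/=; last first.
      by rewrite /avg big1 ?mulr0// => f _; exact: phi0'.
    by rewrite mulr_ge0// avg_ge0.
  apply: le_trans (_ : avg s (fun t => a (F t) (x, v)) * avg s (fun t => psi t (tmap (F t) (x, v))) <= _).
    apply: avg_sqr => t ts; split => //.
    (* By the chain rule, the weight of [F' t] at the image point is the inverse of the weight of
       [F t]. *)
    rewrite /psi /a /tmap /= -tdiff_comp; [|exact: diffvol_tsmooth..].
    rewrite (_ : F' t \o F t = idfun); last by apply/funext => y /=; rewrite invK.
    rewrite tdiff_id mulrCA -[leLHS]mulr1 ler_wpM2l ?sqr_ge0//.
    have Nv : N v != 0 by apply: contra v0 => /eqP/Neq0 ->.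
    have Nw : N (tdiff (F t) x v) != 0.
      by apply: contra v0 => /eqP/Neq0/eqP; rewrite tdiff_eq0.
    by rewrite mulrA divfK// divff.
  by rewrite ler_wpM2r ?avg_ge0// a_le.
apply: (@le_trans _ _ (tint (fun z => r%:E * (avg s (fun t => psi t (tmap (F t) z)))%:E)))%E.
  apply: le_tint.
  - by apply: measurable_sqr; apply: measurable_avg => f; exact: mU.
  - apply: measurable_funeM; apply/measurable_EFinP.
    by apply: measurable_avg => f; exact: mU.
  - by move=> z; rewrite lee_fin sqr_ge0.
  - by move=> z; rewrite -EFinM lee_fin.
rewrite tintZ//; last 2 first.
- by apply/measurable_EFinP; apply: measurable_avg => f; exact: mU.
- by move=> z; rewrite lee_fin avg_ge0.
rewrite tint_avg//; last by move=> f; exact: mU.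
(* Invariance of [tint] removes [tmap (F t)]; what remains is an average of the weights of the
   inverses, which yields the second factor [r]. *)
under eq_bigr => f _.
  rewrite (@tint_tmap R (F f) (fun z => (psi f z)%:E)); last 2 first.
  - exact/measurable_EFinP.
  - by move=> z; rewrite lee_fin.
  over.
rewrite -tint_avg// expr2 EFinM -muleA lee_wpmul2l ?lee_fin//.
rewrite -tintZ ?r0//; last 2 first.
- exact: measurable_sqr.
- by move=> z; rewrite lee_fin sqr_ge0.
apply: le_tint.
- by apply/measurable_EFinP; exact: measurable_avg.
- by apply: measurable_funeM; exact: measurable_sqr.
- by move=> z; rewrite lee_fin avg_ge0.
move=> [x v]; rewrite -EFinM lee_fin /psi avgZ mulrC.
have [->|v0] := eqVneq v 0; first by rewrite phi0 expr0n !mulr0.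
by rewrite ler_wpM2r ?sqr_ge0// a'_le.
Qed.

End koopman.

(** * A weight contracted by averaged shears *)

Section quartic_weight.
Context (R : realType).
Implicit Types (a b k t x : R) (v : plane R).

(** The Euclidean norm corresponds to the coefficient 2 on the mixed term. For it, averaged shears
    in both directions increase the weight to second order on the diagonals [|a| = |b|]; lowering
    the coefficient to [1 / 2] repairs this. *)
Definition quart a b : R := a ^+ 4 + a ^+ 2 * b ^+ 2 / 2 + b ^+ 4.

Lemma quart_ge a b : (a ^+ 2 + b ^+ 2) ^+ 2 <= 2 * quart a b.
Proof. by rewrite /quart; have := sqr_ge0 (a ^+ 2 - b ^+ 2); have := sqr_ge0 (a * b); lra. Qed.

Lemma quart_ge0 a b : 0 <= quart a b.
Proof. by have := quart_ge a b; have := sqr_ge0 (a ^+ 2 + b ^+ 2); lra. Qed.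

Lemma quart_eq0 a b : quart a b = 0 -> a = 0 /\ b = 0.
Proof.
move=> q0; have := quart_ge a b; rewrite q0 mulr0 => h.
have : a ^+ 2 + b ^+ 2 = 0.
  by apply/eqP; rewrite -sqrf_eq0 eq_le h sqr_ge0.
move=> /eqP; rewrite paddr_eq0 ?sqr_ge0// !sqrf_eq0 => /andP[/eqP-> /eqP->].
by [].
Qed.

Lemma quartC a b : quart a b = quart b a.
Proof. by rewrite /quart; ring. Qed.

(* [quart] is the fourth power of a norm for which the shears in both
   directions are, to second order, contracting the weight [1 / qnorm]. *)
Definition qnorm v : R := Num.sqrt (Num.sqrt (quart v.1 v.2)).

Lemma qnorm_ge0 v : 0 <= qnorm v. Proof. exact: sqrtr_ge0. Qed.

Lemma qnorm4 v : qnorm v ^+ 4 = quart v.1 v.2.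
Proof. by rewrite (exprM _ 2 2) sqr_sqrtr ?sqrtr_ge0// sqr_sqrtr ?quart_ge0. Qed.

Lemma qnorm_eq0 v : qnorm v = 0 -> v = 0.
Proof.
move=> q0; have := qnorm4 v; rewrite q0 expr0n /= => /esym/quart_eq0[].
by case: v {q0} => a b /= -> ->.
Qed.

(** Taylor's formula of order 2 for [(1 + x)^(-1/4)]. Expressed in [t], the remainder is polynomial,
    with a triple zero at [t = 1] and cofactor [h]; the factor 3 leaves room for [t] down to
    [3 / 4]. *)
Lemma inv_fourth_root t x : 0 < t -> t ^+ 4 = 1 + x -> `|x| <= 1 / 2 ->
  t^-1 <= 1 - x / 4 + 5 / 32 * x ^+ 2 + 3 * `|x| ^+ 3.
Proof.
move=> t0 tx xh; have /andP[x1 x2] : - (1 / 2) <= x <= 1 / 2 by rewrite -ler_norml.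
have t1 : 3 / 4 <= t.
  rewrite leNgt; apply/negP => tl.
  have : t ^+ 4 < (3 / 4) ^+ 4 by rewrite ltr_pXn2r// nnegrE ?ltW// divr_ge0.
  by rewrite tx (_ : (3 / 4) ^+ 4 = 81 / 256); [lra|field].
have t2 : t <= 5 / 4.
  rewrite leNgt; apply/negP => tl.
  have : (5 / 4) ^+ 4 < t ^+ 4 by rewrite ltr_pXn2r// nnegrE ?ltW// divr_ge0.
  by rewrite tx (_ : (5 / 4) ^+ 4 = 625 / 256); [lra|field].
rewrite -[leLHS]mulr1 -ler_pdivlMl ?invr_gt0// invrK.
have xE0 : x = t ^+ 4 - 1 by rewrite tx; ring.
have xE : x = (t - 1) * (t ^+ 3 + t ^+ 2 + t + 1) by rewrite xE0; ring.
set h := 5 * t ^+ 6 + 15 * t ^+ 5 + 30 * t ^+ 4 + 50 * t ^+ 3 + 57 * t ^+ 2 + 51 * t + 32.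
have key : t * (1 - x / 4 + 5 / 32 * x ^+ 2) - 1 = (t - 1) ^+ 3 * h / 32.
  by rewrite xE /h; field.
have pw n : t ^+ n <= (5 / 4) ^+ n by rewrite lerXn2r// nnegrE ?ltW// divr_ge0.
have pl n : (3 / 4) ^+ n <= t ^+ n by rewrite lerXn2r// nnegrE ?ltW// divr_ge0.
have h0 : 0 <= h by rewrite /h !addr_ge0// ?mulr_ge0// ?exprn_ge0// ltW.
have h1 : h <= 450.
  by have := pw 6%N; have := pw 5%N; have := pw 4%N; have := pw 3%N; have := pw 2%N;
     rewrite /h; lra.
have s2 : 2 <= t ^+ 3 + t ^+ 2 + t + 1 by have := pl 3%N; have := pl 2%N; lra.
have tx1 : 2 * `|t - 1| <= `|x|.
  rewrite xE normrM mulrC ler_wpM2l// ger0_norm//.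
  by rewrite (le_trans _ s2).
have tx3 : 8 * `|t - 1| ^+ 3 <= `|x| ^+ 3.
  have -> : 8 * `|t - 1| ^+ 3 = (2 * `|t - 1|) ^+ 3 by ring.
  by rewrite lerXn2r// nnegrE ?mulr_ge0.
have low : - (`|t - 1| ^+ 3 * 450 / 32) <= (t - 1) ^+ 3 * h / 32.
  rewrite -mulNr ler_wpM2r ?invr_ge0// lerNl.
  apply: le_trans (ler_norm _) _; rewrite normrN normrM normrX (ger0_norm h0).
  by rewrite ler_wpM2l// exprn_ge0.
have x3 : 0 <= `|x| ^+ 3 by rewrite exprn_ge0.
rewrite mulrDr; have : 3 / 4 * (3 * `|x| ^+ 3) <= t * (3 * `|x| ^+ 3).
  by rewrite ler_wpM2r// mulr_ge0.
lra.
Qed.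

(** The coefficient of [k^2] in the expansion of [qnorm (a, b) / qnorm (a + k b, b)]. *)
Definition qgain a b : R :=
  - (b ^+ 2 * (12 * a ^+ 2 + b ^+ 2) / (2 * quart a b)) / 4 +
  5 / 32 * (b * (4 * a ^+ 3 + a * b ^+ 2) / quart a b) ^+ 2.

(** Once denominators are cleared, the claim concerns a quadratic form in [S = a^4 + b^4] and
    [P = a^2 b^2] on the cone [0 <= 2 P <= S]. The value [- 1 / 20] is attained on the diagonals,
    where [S = 2 P]. *)
Lemma qgain_sum a b : 0 < quart a b -> qgain a b + qgain b a <= - (1 / 20).
Proof.
move=> q0; rewrite /qgain (quartC b a).
set Q := quart a b in q0 *; have Qn : Q != 0 by rewrite gt_eqF.
rewrite -subr_le0.
have -> : - (b ^+ 2 * (12 * a ^+ 2 + b ^+ 2) / (2 * Q)) / 4 +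
    5 / 32 * (b * (4 * a ^+ 3 + a * b ^+ 2) / Q) ^+ 2 +
    (- (a ^+ 2 * (12 * b ^+ 2 + a ^+ 2) / (2 * Q)) / 4 +
    5 / 32 * (a * (4 * b ^+ 3 + b * a ^+ 2) / Q) ^+ 2) - - (1 / 20) =
    (- 4 * Q * (24 * (a ^+ 2 * b ^+ 2) + (a ^+ 4 + b ^+ 4)) +
     5 * (a ^+ 2 * b ^+ 2 * (17 * (a ^+ 4 + b ^+ 4) + 16 * (a ^+ 2 * b ^+ 2))) + 8 / 5 * Q ^+ 2)
    / (32 * Q ^+ 2) by field.
rewrite pmulr_lle0 ?invr_gt0 ?mulr_gt0 ?exprn_gt0//.
have QE : Q = (a ^+ 4 + b ^+ 4) + (a ^+ 2 * b ^+ 2) / 2 by rewrite /Q /quart; ring.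
have P0 : 0 <= a ^+ 2 * b ^+ 2 by rewrite mulr_ge0 ?sqr_ge0.
have SP : 2 * (a ^+ 2 * b ^+ 2) <= a ^+ 4 + b ^+ 4.
  by have := sqr_ge0 (a ^+ 2 - b ^+ 2); lra.
rewrite QE; move: (a ^+ 4 + b ^+ 4) (a ^+ 2 * b ^+ 2) P0 SP => S P P0 SP.
have := mulr_ge0 P0 P0; have : 0 <= P * (S - 2 * P) by rewrite mulr_ge0// subr_ge0.
have := sqr_ge0 (S - 2 * P); lra.
Qed.

Lemma quart_shear_bounds a b : 0 < quart a b ->
  [/\ `|b * (4 * a ^+ 3 + a * b ^+ 2) / quart a b| <= 4,
      0 <= b ^+ 2 * (12 * a ^+ 2 + b ^+ 2) / (2 * quart a b) <= 12,
      `|4 * a * b ^+ 3 / quart a b| <= 4 &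
      0 <= b ^+ 4 / quart a b <= 1].
Proof.
move=> q0; have Qge := quart_ge a b; set Q := quart a b in q0 Qge *.
have X0 := sqr_ge0 a; have Y0 := sqr_ge0 b.
have m0 : `|a * b| <= (a ^+ 2 + b ^+ 2) / 2.
  have := sqr_ge0 (a - b); have := sqr_ge0 (a + b).
  by rewrite ler_norml => h1 h2; apply/andP; split; lra.
have YQ : b ^+ 2 * b ^+ 2 <= Q.
  have := mulr_ge0 X0 Y0; have := sqr_ge0 (a ^+ 2); rewrite /Q /quart; lra.
have -> : b * (4 * a ^+ 3 + a * b ^+ 2) = (a * b) * (4 * a ^+ 2 + b ^+ 2) by ring.
have -> : 4 * a * b ^+ 3 = (a * b) * (4 * b ^+ 2) by ring.
have -> : b ^+ 4 = b ^+ 2 * b ^+ 2 by ring.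
move: {Q} (a ^+ 2) (b ^+ 2) (a * b) (Q) q0 Qge X0 Y0 m0 YQ => X Y m Q q0 Qge X0 Y0 m0 YQ.
have XY0 := mulr_ge0 X0 Y0; have XX0 := mulr_ge0 X0 X0; have YY0 := mulr_ge0 Y0 Y0.
split.
- rewrite 2!normrM normfV (gtr0_norm q0) ler_pdivrMr// [X in _ * X](ger0_norm _); last lra.
  apply: le_trans (_ : (X + Y) / 2 * (4 * X + Y) <= _); last lra.
  by rewrite ler_wpM2r//; lra.
- apply/andP; split; first by rewrite divr_ge0// ?mulr_ge0//; lra.
  by rewrite ler_pdivrMr; lra.
- rewrite 2!normrM normfV (gtr0_norm q0) ler_pdivrMr// [X in _ * X](ger0_norm _); last lra.
  apply: le_trans (_ : (X + Y) / 2 * (4 * Y) <= _); last lra.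
  by rewrite ler_wpM2r//; lra.
- by rewrite divr_ge0 ?(ltW q0)// ler_pdivrMr// mul1r.
Qed.

(** The four bounds add up to 21, so [|x| <= 21 |k|]; then [1 / 42] ensures [|x| <= 1 / 2], and
    [28 * 1000] exceeds [3 * 21^3]. *)
Lemma inv_qnorm_shear (k a b p1 p2 p3 p4 x : R) : 0 < quart a b -> `|k| <= 1 / 42 ->
  x = k * p1 + k ^+ 2 * p2 + k ^+ 3 * p3 + k ^+ 4 * p4 ->
  quart (a + k * b) b = quart a b * (1 + x) ->
  `|p1| <= 4 -> 0 <= p2 <= 12 -> `|p3| <= 4 -> 0 <= p4 <= 1 ->
  qnorm (a, b) / qnorm (a + k * b, b) <=
    1 - x / 4 + 5 / 32 * x ^+ 2 + 28 * 1000 * `|k| ^+ 3.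
Proof.
move=> q0 k1 xE qE h1 /andP[h2 h2'] h3 /andP[h4 h4'].
have n0 : 0 < qnorm (a, b) by rewrite !sqrtr_gt0.
have k0 := normr_ge0 k.
have x21 : `|x| <= 21 * `|k|.
  have kn n : `|k ^+ n.+1| <= `|k|.
    by rewrite normrX exprS ler_piMr// exprn_ile1//; lra.
  have step n (p c : R) : `|p| <= c -> `|k ^+ n.+1 * p| <= `|k| * c.
    by move=> pc; rewrite normrM ler_pM.
  have e1 := step 0%N _ _ h1; rewrite expr1 in e1.
  have e2 : `|k ^+ 2 * p2| <= `|k| * 12 by apply: step; rewrite ger0_norm.
  have e3 := step 2%N _ _ h3.
  have e4 : `|k ^+ 4 * p4| <= `|k| * 1 by apply: step; rewrite ger0_norm.
  rewrite xE; apply: le_trans (ler_normD _ _) _; apply: le_trans (lerD (ler_normD _ _) (lexx _)) _.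
  apply: le_trans (lerD (lerD (ler_normD _ _) (lexx _)) (lexx _)) _; lra.
have xh : `|x| <= 1 / 2 by lra.
have x3 : `|x| ^+ 3 <= (9 * 1000 + 261) * `|k| ^+ 3.
  have -> : (9 * 1000 + 261) * `|k| ^+ 3 = (21 * `|k|) ^+ 3 by ring.
  by rewrite lerXn2r// nnegrE mulr_ge0.
have x10 : 0 < 1 + x by move: xh; rewrite ler_norml => /andP[? _]; lra.
have n1 : 0 < qnorm (a + k * b, b) by rewrite !sqrtr_gt0 /= qE mulr_gt0.
pose t := qnorm (a + k * b, b) / qnorm (a, b).
have t0 : 0 < t by rewrite divr_gt0.
have t4 : t ^+ 4 = 1 + x.
  rewrite expr_div_n !qnorm4 /= qE mulrAC divff ?mul1r//; exact: lt0r_neq0.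
have k3 : 0 <= `|k| ^+ 3 by rewrite exprn_ge0.
have := inv_fourth_root t0 t4 xh; rewrite /t invf_div; lra.
Qed.

(** Opposite shears cancel the first order. The terms of order at least four are absorbed by the
    difference between [57 * 1000] and [2 * 28 * 1000]. *)
Lemma qnorm_shear_avg (k a b : R) : 0 < quart a b -> `|k| <= 1 / 42 ->
  qnorm (a, b) / qnorm (a + k * b, b) + qnorm (a, b) / qnorm (a - k * b, b) <=
  2 + 2 * k ^+ 2 * qgain a b + 57 * 1000 * `|k| ^+ 3.
Proof.
move=> q0 k1; have [b1 b2 b3 b4] := quart_shear_bounds q0; rewrite /qgain.
set Q := quart a b in q0 b1 b2 b3 b4 *.
set p1 := b * (4 * a ^+ 3 + a * b ^+ 2) / Q in b1 *.
set p2 := b ^+ 2 * (12 * a ^+ 2 + b ^+ 2) / (2 * Q) in b2 *.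
set p3 := 4 * a * b ^+ 3 / Q in b3; set p4 := b ^+ 4 / Q in b4.
have qE (h : R) : quart (a + h * b) b =
    Q * (1 + (h * p1 + h ^+ 2 * p2 + h ^+ 3 * p3 + h ^+ 4 * p4)).
  have -> : quart (a + h * b) b = Q + h * (b * (4 * a ^+ 3 + a * b ^+ 2)) +
      h ^+ 2 * (b ^+ 2 * (12 * a ^+ 2 + b ^+ 2)) / 2 + h ^+ 3 * (4 * a * b ^+ 3) +
      h ^+ 4 * b ^+ 4.
    by rewrite /Q /quart; field.
  by rewrite /p1 /p2 /p3 /p4; field; exact: lt0r_neq0.
have i1 := inv_qnorm_shear q0 k1 erefl (qE k) b1 b2 b3 b4.
have kN : `|- k| <= 1 / 42 by rewrite normrN.
have i2 := inv_qnorm_shear q0 kN erefl (qE (- k)) b1 b2 b3 b4.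
move: i1 i2; rewrite /= mulNr normrN => i1 i2.
apply: le_trans (lerD i1 i2) _.
have K0 := normr_ge0 k.
have k2 : k ^+ 2 <= 1.
  by rewrite -(real_normK (num_real k)) exprn_ile1//; lra.
have k20 := sqr_ge0 k.
have k4 : k ^+ 4 <= `|k| ^+ 3 * 1.
  have -> : k ^+ 4 = `|k| ^+ 4 by rewrite -normrX ger0_norm// exprn_even_ge0.
  by rewrite exprSr ler_wpM2l ?exprn_ge0//; lra.
have k40 : 0 <= k ^+ 4 by rewrite exprn_even_ge0.
move: b2 b4 => /andP[b2 b2'] /andP[b4 b4'].
have p13 : p1 * p3 <= 16.
  apply: le_trans (ler_norm _) _; rewrite normrM.
  by apply: le_trans (ler_pM _ _ b1 b3) _ => //; lra.
have p33 : k ^+ 2 * p3 ^+ 2 <= 16.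
  have : p3 ^+ 2 <= 4 ^+ 2 by rewrite -(real_normK (num_real p3)) lerXn2r// nnegrE.
  have := sqr_ge0 p3 => h h'; apply: le_trans (ler_pM _ _ k2 h') _ => //; lra.
have p24 : (p2 + k ^+ 2 * p4) ^+ 2 <= 169.
  have -> : (169 : R) = 13 ^+ 2 by ring.
  have k2p4 : k ^+ 2 * p4 <= 1 * 1 by exact: ler_pM.
  have := mulr_ge0 k20 b4 => h.
  by rewrite lerXn2r// ?nnegrE; lra.
have E : k ^+ 4 * (- p4 / 2 + 5 / 16 * (2 * (p1 * p3) + k ^+ 2 * p3 ^+ 2 +
    (p2 + k ^+ 2 * p4) ^+ 2)) <= k ^+ 4 * 100.
  by rewrite ler_wpM2l//; lra.
have K3 : 0 <= `|k| ^+ 3 by rewrite exprn_ge0.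
lra.
Qed.

End quartic_weight.

(** * Contraction by the kicks *)

Section energy_decay.
Context (R : realType).
Local Notation mplane := (measurableTypeR R * measurableTypeR R)%type.
Local Notation bundle := (torus R * mplane)%type.
Implicit Types (e k : R) (x : torus R) (v : plane R).

Definition neg3 (c : R * R * R) : R * R * R := (- c.1.1, - c.1.2, - c.2).

(** In each direction, opposite signs cancel the first order, and the pair of a sine and a cosine
    makes the second order independent of the base point, by [cos^2 + sin^2 = 1]. Division by [2 pi]
    gives slopes of amplitude [e]. *)
Definition kicks e : seq (bool * (R * R * R)) :=
  let s := e / (pi *+ 2) in
  [:: (false, (0, s, 0)); (false, (0, - s, 0)); (false, (0, 0, s)); (false, (0, 0, - s));
      (true, (0, s, 0)); (true, (0, - s, 0)); (true, (0, 0, s)); (true, (0, 0, - s))].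

Definition kick (t : bool * (R * R * R)) : DiffVol R := shear t.1 t.2.
Definition kick_inv (t : bool * (R * R * R)) : DiffVol R := shear t.1 (neg3 t.2).

Lemma kickK t : cancel (kick t) (kick_inv t).
Proof. exact: tshearK. Qed.

Lemma tdiff_kick b c x v : tdiff (kick (b, c)) x v =
  if b then (v.1, v.2 + v.1 * wave (dwave c) (repr x).1)
  else (v.1 + v.2 * wave (dwave c) (repr x).2, v.2).
Proof. by rewrite -{1}(tpi_repr x) tdiff_tshear. Qed.

Lemma pi2_neq0 : pi *+ 2 != 0 :> R.
Proof. by rewrite mulrn_eq0 /= gt_eqF// pi_gt0. Qed.

Lemma wave_dwave_kick e y (c1 c2 : R) :
  wave (dwave (0, c1 * (e / (pi *+ 2)), c2 * (e / (pi *+ 2)))) y =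
  e * (c1 * cos (pi *+ 2 * y) - c2 * sin (pi *+ 2 * y)).
Proof.
have eE : e / (pi *+ 2) * (pi *+ 2) = e by rewrite divfK// pi2_neq0.
by rewrite -[in RHS]eE /wave /dwave /=; ring.
Qed.

Lemma qnormC (a b : R) : qnorm (a, b) = qnorm (b, a).
Proof. by rewrite /qnorm /= quartC. Qed.

Lemma qnorm_sum4 e y (a b : R) : 0 < quart a b -> 0 <= e <= 1 / 42 ->
  qnorm (a, b) / qnorm (a + b * (e * cos (pi *+ 2 * y)), b) +
  qnorm (a, b) / qnorm (a + b * - (e * cos (pi *+ 2 * y)), b) +
  qnorm (a, b) / qnorm (a + b * - (e * sin (pi *+ 2 * y)), b) +
  qnorm (a, b) / qnorm (a + b * (e * sin (pi *+ 2 * y)), b) <=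
  4 + 2 * e ^+ 2 * qgain a b + 2 * (57 * 1000) * e ^+ 3.
Proof.
move=> q0 /andP[e0 e1]; set c := e * cos _; set s := e * sin _.
have hc : `|c| <= e by rewrite normrM ger0_norm// ler_piMr// cos_max.
have hs : `|s| <= e by rewrite normrM ger0_norm// ler_piMr// sin_max.
have h1 := qnorm_shear_avg q0 (le_trans hc e1).
have h2 := qnorm_shear_avg q0 (le_trans hs e1).
have cs : c ^+ 2 + s ^+ 2 = e ^+ 2.
  by rewrite /c /s !exprMn -mulrDr cos2Dsin2 mulr1.
have c3 : `|c| ^+ 3 <= e ^+ 3 by rewrite lerXn2r// nnegrE.
have s3 : `|s| ^+ 3 <= e ^+ 3 by rewrite lerXn2r// nnegrE.
rewrite !mulrN !(mulrC b).
have : 2 * c ^+ 2 * qgain a b + 2 * s ^+ 2 * qgain a b = 2 * e ^+ 2 * qgain a b.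
  by rewrite -cs; ring.
lra.
Qed.

Lemma kicks_avg e (e2 e3 g1 g2 : R) (G : bool -> R * R * R -> R) :
  let s := e / (pi *+ 2) in
  G false (0, s, 0) + G false (0, - s, 0) + G false (0, 0, s) + G false (0, 0, - s) <=
    4 + 2 * e2 * g1 + 2 * (57 * 1000) * e3 ->
  G true (0, s, 0) + G true (0, - s, 0) + G true (0, 0, s) + G true (0, 0, - s) <=
    4 + 2 * e2 * g2 + 2 * (57 * 1000) * e3 ->
  228 * 1000 * e3 <= e2 / 20 -> 2 * e2 * (g1 + g2) <= 2 * e2 * - (1 / 20) ->
  avg (kicks e) (fun t => G t.1 t.2) <= 1 - e2 / 160 /\
  avg (kicks e) (fun t => G t.1 (neg3 t.2)) <= 1 - e2 / 160.
Proof.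
move=> s; rewrite /avg /kicks -/s !big_cons !big_nil /neg3 /= !oppr0 !opprK.
by move=> gk1 gk2 h3 h4; split; lra.
Qed.

(** The eight terms sum to at most [8 - e^2 / 10 + 228 * 1000 * e^3]. The bound on [e] lets the
    cubic error consume at most half of the gain, which leaves [e^2 / 20] to be divided by 8. The
    inverses give the same terms in another order. *)
Lemma kicks_weight e x v : 0 < e <= 1 / (5 * 1000 * 1000) -> v != 0 ->
  avg (kicks e) (fun t => qnorm v / qnorm (tdiff (kick t) x v)) <= 1 - e ^+ 2 / 160 /\
  avg (kicks e) (fun t => qnorm v / qnorm (tdiff (kick_inv t) x v)) <= 1 - e ^+ 2 / 160.
Proof.
move=> /andP[e0 e1] v0; case: v v0 => a b v0.
have q0 : 0 < quart a b.
  rewrite lt_neqAle quart_ge0 andbT eq_sym; apply: contra v0 => /eqP/quart_eq0[-> ->].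
  by [].
have q0' : 0 < quart b a by rewrite quartC.
have e01 : 0 <= e <= 1 / 42 by apply/andP; split; lra.
have h1 := qnorm_sum4 (repr x).2 q0 e01.
have h2 := qnorm_sum4 (repr x).1 q0' e01.
have g := qgain_sum q0.
have e2 := exprn_gt0 2 e0.
have e3 : 228 * 1000 * e ^+ 3 <= e ^+ 2 / 20.
  have -> : 228 * 1000 * e ^+ 3 = e ^+ 2 * (228 * 1000 * e) by ring.
  by rewrite ler_wpM2l ?(ltW e2)//; lra.
have eg : 2 * e ^+ 2 * (qgain a b + qgain b a) <= 2 * e ^+ 2 * - (1 / 20).
  by rewrite ler_wpM2l// mulr_ge0// ltW.
rewrite !(qnormC b a) !(qnormC _ a) in h2.
set t2 := pi *+ 2 * (repr x).2 in h1; set t1 := pi *+ 2 * (repr x).1 in h2.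
set s := e / (pi *+ 2).
have k1 (y : R) : wave (dwave (0, s, 0)) y = e * cos (pi *+ 2 * y).
  have := wave_dwave_kick e y 1 0; rewrite !mul1r !mul0r subr0; exact.
have k2 (y : R) : wave (dwave (0, - s, 0)) y = - (e * cos (pi *+ 2 * y)).
  have := wave_dwave_kick e y (- 1) 0; rewrite !mulN1r !mul0r subr0 mulrN; exact.
have k3 (y : R) : wave (dwave (0, 0, s)) y = - (e * sin (pi *+ 2 * y)).
  have := wave_dwave_kick e y 0 1; rewrite !mul1r !mul0r sub0r mulrN; exact.
have k4 (y : R) : wave (dwave (0, 0, - s)) y = e * sin (pi *+ 2 * y).
  have := wave_dwave_kick e y 0 (- 1); rewrite !mulN1r !mul0r sub0r opprK; exact.
pose G (i : bool) (c : R * R * R) : R :=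
  if i then qnorm (a, b) / qnorm (a, b + a * wave (dwave c) (repr x).1)
  else qnorm (a, b) / qnorm (a + b * wave (dwave c) (repr x).2, b).
have e1' : avg (kicks e) (fun t => qnorm (a, b) / qnorm (tdiff (kick t) x (a, b))) =
    avg (kicks e) (fun t => G t.1 t.2).
  by apply: eq_avg => -[i c]; rewrite tdiff_kick /G; case: i.
have e2' : avg (kicks e) (fun t => qnorm (a, b) / qnorm (tdiff (kick_inv t) x (a, b))) =
    avg (kicks e) (fun t => G t.1 (neg3 t.2)).
  apply: eq_avg => -[i c]; rewrite (_ : kick_inv _ = kick (i, neg3 c))// tdiff_kick /G.
  by case: i.
have gk i : G i (0, s, 0) + G i (0, - s, 0) + G i (0, 0, s) + G i (0, 0, - s) <=
    4 + 2 * e ^+ 2 * qgain (if i then b else a) (if i then a else b) + 2 * (57 * 1000) * e ^+ 3.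
  by case: i; rewrite /G !(k1, k2, k3, k4).
have [s1 s2] := kicks_avg (gk false) (gk true) e3 eg.
by split; [rewrite e1'|rewrite e2'].
Qed.

End energy_decay.

(** * Decay of the energy along random words *)

Section random_products.
Context (R : realType).
Local Notation mplane := (measurableTypeR R * measurableTypeR R)%type.
Local Notation bundle := (torus R * mplane)%type.
Local Notation lam := (@lebesgue_measure R).
Local Notation lam2 := (lam \x lam)%E.
Implicit Types (K : seq (DiffVol R)) (f g : DiffVol R) (phi : bundle -> R) (z : bundle).

Lemma tmap_comp f g z : tmap (diffvol_comp f g) z = tmap f (tmap g z).
Proof. by rewrite /tmap tdiff_comp//; exact: diffvol_tsmooth. Qed.

(** [K] stands for the translated twists and is kept arbitrary, since the rate of decay must be
    known before the grid is chosen. *)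
Definition steps K (e : R) (f0 : DiffVol R) : seq (DiffVol R) :=
  allpairs (fun g t => diffvol_comp g (diffvol_comp (kick t) f0)) K (kicks e).

(* The origin is removed so that its indicator vanishes on the zero section. *)
Definition bump_set : set mplane := (`[-1, 1] `*` `[-1, 1]) `\` (`[0, 0] `*` `[0, 0]).

Lemma measurable_bump_set : measurable bump_set.
Proof. by apply: measurableD; apply: measurableX; exact: measurable_itv. Qed.

Definition contracted L n z : R := Ex L n (fun g => \1_bump_set (tmap g z).2).

Lemma Ex_ge0 L n (Phi : DiffVol R -> R) : (forall g, 0 <= Phi g) -> 0 <= Ex L n Phi.
Proof.
elim: n Phi => [|n IH] Phi Phi0 //=.
by apply: avg_ge0 => f; apply: IH => g; exact: Phi0.
Qed.

Lemma contracted_ge0 L n z : 0 <= contracted L n z.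
Proof. by apply: Ex_ge0 => g; rewrite indicE. Qed.

Lemma contracted_avg L n z :
  contracted L n.+1 z = avg L (fun g => contracted L n (tmap g z)).
Proof. by apply: eq_avg => g; apply: eq_Ex => h; rewrite tmap_comp. Qed.

Lemma contractedS K e f0 n z : contracted (steps K e f0) n.+1 z =
  avg (kicks e) (fun t => avg K (fun g =>
    contracted (steps K e f0) n (tmap g (tmap (kick t) (tmap f0 z))))).
Proof.
rewrite contracted_avg avg_allpairs avg_exchange; apply: eq_avg => t.
by apply: eq_avg => g; rewrite !tmap_comp.
Qed.

Lemma measurable_contracted L n : measurable_fun setT (contracted L n).
Proof.
elim: n => [|n IH].
  rewrite (_ : contracted L 0 = \1_bump_set \o snd \o tmap (diffvol_id R))//.
  have m1 : measurable_fun setT (\1_bump_set : mplane -> R).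
    by apply: measurable_indic; exact: measurable_bump_set.
  exact: (measurableT_comp m1 (measurableT_comp measurable_snd (measurable_tmap _))).
rewrite (_ : contracted L n.+1 = fun z => avg L (fun g => contracted L n (tmap g z))).
  by apply: measurable_avg => g; exact: (measurableT_comp IH (measurable_tmap g)).
by apply/funext => z; rewrite contracted_avg.
Qed.

Lemma contracted0 L n x : contracted L n (x, 0) = 0.
Proof.
rewrite /contracted (@eq_Ex R L n _ (fun=> 0)); last first.
  move=> g; rewrite /tmap /= tdiff0 indicE memNset// => -[_]; apply.
  by split; rewrite /= in_itv /= lexx.
by elim: n => [//|n IH] /=; rewrite /avg big1 ?mulr0.
Qed.

Lemma energy_avg K phi : (0 < size K)%N -> measurable_fun setT phi ->
  (energy (fun z => avg K (fun g => phi (tmap g z))) <= energy phi)%E.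
Proof.
move=> K0 mphi.
have mU g : measurable_fun setT (fun z => phi (tmap g z) ^+ 2).
  by apply: measurable_funX; exact: (measurableT_comp mphi (measurable_tmap g)).
have mU' g : measurable_fun setT (fun z => phi (tmap g z)).
  exact: (measurableT_comp mphi (measurable_tmap g)).
apply: (@le_trans _ _ (tint (fun z => (avg K (fun g => phi (tmap g z) ^+ 2))%:E))).
  apply: le_tint.
  - by apply: measurable_sqr; exact: measurable_avg.
  - by apply/measurable_EFinP; exact: (measurable_avg K mU).
  - by move=> z; rewrite lee_fin sqr_ge0.
  - move=> z; rewrite lee_fin -[leRHS]mul1r -(avg_cst 1 K0).
    by apply: avg_sqr => g _; rewrite sqr_ge0 mul1r.
rewrite (tint_avg K mU); last by move=> g z; rewrite sqr_ge0.
under eq_bigr => g _ do rewrite [tint _](energy_tmap g mphi).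
rewrite [leRHS](_ : _ = tint (fun z => (avg K (fun=> phi z ^+ 2))%:E)); last first.
  by congr tint; apply/funext => z; rewrite avg_cst.
rewrite (@tint_avg _ _ K (fun=> fun z => phi z ^+ 2))//.
  by move=> g; exact: measurable_funX.
by move=> g z; rewrite sqr_ge0.
Qed.

Lemma measurable_qnorm : measurable_fun setT (@qnorm R : mplane -> R).
Proof.
have ms : measurable_fun setT (Num.sqrt : measurableTypeR R -> measurableTypeR R).
  exact: (continuous_measurable_fun (@sqrt_continuous R)).
have m1 : measurable_fun setT (fst : mplane -> measurableTypeR R) by exact: measurable_fst.
have m2 : measurable_fun setT (snd : mplane -> measurableTypeR R) by exact: measurable_snd.
have mq : measurable_fun setT (fun v : mplane => quart v.1 v.2 : measurableTypeR R).
  rewrite /quart; apply: measurable_funD; last exact: measurable_funX.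
  apply: measurable_funD; first exact: measurable_funX.
  by apply: measurable_funM => //; apply: measurable_funM; exact: measurable_funX.
exact: (measurableT_comp ms (measurableT_comp ms mq)).
Qed.

Lemma energy_contracted0 L : (energy (contracted L 0) <= 4%:E)%E.
Proof.
rewrite [energy _](_ : _ = tint (fun z => (\1_bump_set (tmap (diffvol_id R) z).2 ^+ 2)%:E))//.
rewrite /tint; apply: (@le_trans _ _ (\int[@tvol R]_x (cst 4%:E x)))%E; last first.
  by rewrite integral_cst// tvolT mule1.
apply: ge0_le_integral => //.
- by move=> x _; apply: integral_ge0 => v _; rewrite lee_fin sqr_ge0.
- have mc := measurable_sqr (measurable_contracted L 0).
  by apply: (measurable_tint mc) => z; rewrite lee_fin sqr_ge0.
move=> x _.
apply: (@le_trans _ _ (\int[@plam R]_v (\1_(`[-1, 1] `*` `[-1, 1]) v)%:E))%E.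
  apply: ge0_le_integral => //.
  - have mc := measurable_sqr (measurable_contracted L 0).
    by apply: (measurableT_comp mc); exact: measurable_pair1.
  - apply/measurable_EFinP/measurable_indic.
    by apply: measurableX; exact: measurable_itv.
  - move=> v _; rewrite lee_fin /tmap /= tdiff_id !indicE.
    have [|] := boolP (v \in bump_set); last by rewrite expr0n.
    by move=> /set_mem[vb _]; rewrite mem_set// expr1n.
rewrite integral_indic//; last by apply: measurableX; exact: measurable_itv.
rewrite setIT [leLHS](_ : _ = lam2 (`[-1, 1] `*` `[-1, 1]))// lam2_box; [|lra..].
by rewrite lee_fin; lra.
Qed.

(** In one letter, [f0] acts as an isometry, the average over [K] does not increase the energy, and
    the kicks contribute the factor of Schur's test. The initial 4 is the area of [[-1, 1]^2]. *)
Lemma energy_decay K e f0 n : (0 < size K)%N -> 0 < e <= 1 / (5 * 1000 * 1000) ->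
  (energy (contracted (steps K e f0) n) <= (((1 - e ^+ 2 / 160) ^+ 2) ^+ n * 4)%:E)%E.
Proof.
move=> K0 e01; have /andP[e0 e1] := e01.
have r0 : 0 <= 1 - e ^+ 2 / 160.
  have e1' : e <= 1 by lra.
  by have := exprn_ile1 2 (ltW e0) e1'; lra.
elim: n => [|n IH]; first by rewrite mul1r; exact: energy_contracted0.
have mc := measurable_contracted (steps K e f0) n.
pose u z := avg K (fun g => contracted (steps K e f0) n (tmap g z)).
have mu : measurable_fun setT u.
  by apply: measurable_avg => g; exact: (measurableT_comp mc (measurable_tmap g)).
pose w z := avg (kicks e) (fun t => u (tmap (kick t) z)).
have mw : measurable_fun setT w.
  by apply: measurable_avg => g; exact: (measurableT_comp mu (measurable_tmap _)).
rewrite (_ : contracted _ n.+1 = w \o tmap f0); last first.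
  by apply/funext => z; rewrite contractedS.
rewrite energy_tmap//.
apply: (@le_trans _ _ (((1 - e ^+ 2 / 160) ^+ 2)%:E * energy u)%E).
  apply: (@schur_test R _ (kicks e) (@kick R) (@kick_inv R) (@qnorm R)).
  - by [].
  - exact: r0.
  - exact: measurable_qnorm.
  - exact: qnorm_ge0.
  - exact: qnorm_eq0.
  - exact: kickK.
  - move=> x v v0; exact: (proj1 (kicks_weight x e01 v0)).
  - move=> x v v0; exact: (proj2 (kicks_weight x e01 v0)).
  - exact: mu.
  - move=> x; rewrite /u /avg big1 ?mulr0// => g _.
    by rewrite /tmap /= tdiff0 contracted0.
rewrite (exprS _ n) -mulrA (EFinM ((1 - e ^+ 2 / 160) ^+ 2)).
apply: lee_wpmul2l; first by rewrite lee_fin sqr_ge0.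
exact: le_trans (energy_avg K0 mc) IH.
Qed.

Lemma energy_ge (I : Type) (s : seq I) (B : I -> set (torus R)) (E : set mplane)
    (beta : I -> R) phi : measurable_fun setT phi ->
  (forall i, measurable (B i)) -> measurable E ->
  (forall z, \sum_(i <- s) beta i ^+ 2 * \1_(B i) z.1 * \1_E z.2 <= phi z ^+ 2) ->
  (\sum_(i <- s) (beta i ^+ 2)%:E * vol (B i) * lam2 E <= energy phi)%E.
Proof.
move=> mphi mB mE le.
pose psi i z := (beta i ^+ 2 * \1_(B i) z.1 * \1_E z.2)%:E.
have mpsi i : measurable_fun setT (psi i).
  have m1 : measurable_fun setT (\1_(B i) : torus R -> R) by exact: measurable_indic.
  have m2 : measurable_fun setT (\1_E : mplane -> R) by exact: measurable_indic.
  have m1' : measurable_fun setT (fun z : bundle => \1_(B i) z.1 : R).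
    exact: (measurableT_comp m1 measurable_fst).
  have m2' : measurable_fun setT (fun z : bundle => \1_E z.2 : R).
    exact: (measurableT_comp m2 measurable_snd).
  by apply/measurable_EFinP; apply: measurable_funM => //; apply: measurable_funM.
have psi0 i z : (0 <= psi i z)%E.
  by rewrite lee_fin mulr_ge0// mulr_ge0// sqr_ge0.
apply: (@le_trans _ _ (tint (fun z => \sum_(i <- s) psi i z)%E)); last first.
  apply: le_tint.
  - exact: emeasurable_sum.
  - exact: measurable_sqr.
  - by move=> z; exact: sume_ge0.
  - by move=> z; rewrite /psi sumEFin lee_fin.
rewrite tint_sum//; apply: lee_sum => i _; rewrite /tint.
have mE1 : measurable_fun setT (fun v : mplane => (\1_E v)%:E : \bar R).
  by apply/measurable_EFinP; exact: measurable_indic.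
have mB1 : measurable_fun setT (fun x : torus R => (\1_(B i) x)%:E : \bar R).
  by apply/measurable_EFinP; exact: measurable_indic.
have E0 (v : mplane) : setT v -> (0 <= (\1_E v)%:E :> \bar R)%E by rewrite lee_fin.
have B0 (x : torus R) : setT x -> (0 <= (\1_(B i) x)%:E :> \bar R)%E by rewrite lee_fin.
have b0 : (0 <= (beta i ^+ 2)%:E)%E by rewrite lee_fin sqr_ge0.
have lamE : (\int[@plam R]_v (\1_E v)%:E = lam2 E)%E by rewrite integral_indic// setIT.
have volB : (\int[@tvol R]_x (\1_(B i) x)%:E = vol (B i))%E by rewrite integral_indic// setIT.
have lE0 : (0 <= lam2 E)%E by rewrite -lamE; exact: integral_ge0.
have inner (x : torus R) : (\int[@plam R]_v psi i (x, v) =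
    lam2 E * ((beta i ^+ 2)%:E * (\1_(B i) x)%:E))%E.
  have c0 : (0 <= (beta i ^+ 2 * \1_(B i) x)%:E)%E by rewrite lee_fin mulr_ge0// sqr_ge0.
  rewrite /psi /=; under eq_integral do rewrite EFinM.
  by rewrite (@ge0_integralZl _ _ _ (@plam R) setT measurableT _ mE1 _ E0 c0) lamE EFinM muleC.
under eq_integral do rewrite inner.
have mbB := measurable_funeM (beta i ^+ 2)%:E mB1.
rewrite (@ge0_integralZl _ _ _ (@tvol R) setT measurableT _ mbB _ _ lE0); last first.
  by move=> x _; rewrite mule_ge0// B0.
by rewrite (@ge0_integralZl _ _ _ (@tvol R) setT measurableT _ mB1 _ B0 b0) volB muleC.
Qed.

End random_products.

(** * Modulus of continuity of the derivatives of words *)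

Section modulus.
Context (R : realType).
Implicit Types (f g : DiffVol R) (x : torus R) (p q t u v : plane R).

Lemma tpartials_bounded (f : torus R -> torus R) (s : seq bool) : s != [::] -> tsmooth f ->
  exists2 C, 0 < C & forall x, enorm (tpartials s f x : plane R) <= C.
Proof.
move=> s0 sf; have [C C0 h] := torus_bounded (continuous_tpartials s0 sf).
by exists C => // x; have [p <-] := h x.
Qed.

Lemma tnorm_bounded f : exists2 C, 1 <= C & forall x, tnorm f x <= C.
Proof.
have sf := @diffvol_tsmooth R f.
have [C1 C10 h1] := tpartials_bounded (s := [:: false]) erefl sf.
have [C2 C20 h2] := tpartials_bounded (s := [:: true]) erefl sf.
exists (1 + C1 + C2); first by rewrite -addrA lerDl addr_ge0// ltW.
move=> x; rewrite -(ler_pXn2r (n := 2)) ?nnegrE ?tnorm_ge0//; last first.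
  by rewrite !addr_ge0// ltW.
have := h1 x; rewrite -(tdiff_basis _ _ sf) => h1x.
have := h2 x; rewrite -(tdiff_basis _ _ sf) => h2x.
rewrite sqr_tnorm; have n1 := enorm_ge0 (tdiff f x (1, 0)); have n2 := enorm_ge0 (tdiff f x (0, 1)).
have : enorm (tdiff f x (1, 0)) ^+ 2 <= C1 ^+ 2 by rewrite lerXn2r// nnegrE// ltW.
have : enorm (tdiff f x (0, 1)) ^+ 2 <= C2 ^+ 2 by rewrite lerXn2r// nnegrE// ltW.
move: (enorm (tdiff f x (1, 0)) ^+ 2) (enorm (tdiff f x (0, 1)) ^+ 2) => a b hb ha.
have := mulr_gt0 C10 C20; lra.
Qed.

Lemma ltD_half (a b k : R) : a < k / 2 -> b < k / 2 -> a + b < k.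
Proof. by move=> *; lra. Qed.

Lemma subr_through (V : zmodType) (a b c : V) : a - b = (c - b) - (c - a).
Proof. by rewrite opprB [RHS]addrC addrA subrK. Qed.

Lemma subr_scale2 (V : lmodType R) (a b : R) (x y x' y' : V) :
  (a *: x' + b *: y') - (a *: x + b *: y) = a *: (x' - x) + b *: (y' - y).
Proof. by rewrite opprD addrACA -!scalerBr. Qed.

Lemma tdiff_sub (f g : torus R -> torus R) x y u : tdiff g y u - tdiff f x u =
  u.1 *: (tdiff g y (basis2 R false) - tdiff f x (basis2 R false)) +
  u.2 *: (tdiff g y (basis2 R true) - tdiff f x (basis2 R true)).
Proof.
rewrite -subr_scale2; exact: (f_equal2 (fun v w => v - w) (tdiffl _ _ _) (tdiffl _ _ _)).
Qed.

(** Nearby points are compared through the translation vector that joins them, because such a vector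
    is unchanged by the translations inside a word. *)
Definition tame f (e : R) x t := (exists2 t' : plane R, `|t'| < e &
    f (transl t x) = transl t' (f x)) /\
  (forall u, enorm (tdiff f (transl t x) u - tdiff f x u) <= e * enorm u).

Lemma tame_uniform f (e : R) : 0 < e ->
  exists2 r, 0 < r & forall x t, `|t| < r -> tame f e x t.
Proof.
move=> e0; have sf := @diffvol_tsmooth R f.
pose k := e / 4; have k0 : 0 < k by rewrite divr_gt0.
pose P (r : R) q := forall t, `|t| < r -> tame f e (tpi q) t.
have loc p : \forall q \near p & r \near 0^'+, P r q.
  have [F lF] := sf p.
  have cF := smooth_near_continuous lF.2.
  have c1 := @continuous_tpartials R f [:: false] erefl sf p.
  have c2 := @continuous_tpartials R f [:: true] erefl sf p.
  have /nbhs_ballP[r1 /= r10 h1] := lF.1.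
  have e20 : 0 < e / 2 by rewrite divr_gt0.
  have k20 : 0 < k / 2 by rewrite divr_gt0.
  have /cvgrPdist_lt /(_ _ e20) /nbhs_ballP[r2 /= r20 h2] := cF.
  have /cvgrPdist_lt /(_ _ k20) /nbhs_ballP[r3 /= r30 h3] := c1.
  have /cvgrPdist_lt /(_ _ k20) /nbhs_ballP[r4 /= r40 h4] := c2.
  pose r := Num.min (Num.min r1 r2) (Num.min r3 r4).
  have r0 : 0 < r by rewrite !lt_min r10 r20 r30 r40.
  have rle : [/\ r <= r1, r <= r2, r <= r3 & r <= r4].
    by have : r <= r := lexx r; rewrite {2}/r !le_min => /andP[/andP[-> ->] /andP[-> ->]].
  have [rr1 rr2 rr3 rr4] := rle.
  have in_ball q : `|q - p| < r -> forall r', r <= r' -> ball p r' q.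
    by move=> qr r' rr'; rewrite -ball_normE /= distrC (lt_le_trans qr).
  exists (ball p (r / 2), [set s : R | s < r / 2]).
    split => /=; first by apply: nbhsx_ballx; rewrite divr_gt0.
    by apply: nbhs_right_lt; rewrite divr_gt0.
  move=> [q s] /= [qp sr] t ts.
  have q1 : `|q - p| < r.
    by move: qp; rewrite -ball_normE /= distrC => h; lra.
  have q2 : `|q + t - p| < r.
    rewrite addrAC; apply: le_lt_trans (ler_normD _ _) _.
    by move: qp; rewrite -ball_normE /= distrC => h; lra.
  split.
    exists (F (q + t) - F q).
      have a1 := h2 _ (in_ball _ q1 _ rr2); have a2 := h2 _ (in_ball _ q2 _ rr2).
      have -> : F (q + t) - F q = (F p - F q) - (F p - F (q + t)).
        exact: subr_through.
      by apply: le_lt_trans (ler_normB _ _) _; lra.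
    rewrite transl_tpi -(h1 _ (in_ball _ q1 _ rr1)) -(h1 _ (in_ball _ q2 _ rr1)).
    by rewrite transl_tpi (addrC (F q)) subrK.
  move=> u; rewrite transl_tpi.
  have dist i : `|tpartials [:: i] f (tpi (q + t)) - tpartials [:: i] f (tpi q)| <= k.
    have near_p q' : `|q' - p| < r -> `|tpartials [:: i] f (tpi p) - tpartials [:: i] f (tpi q')| < k / 2.
      move=> q'r; case: (i); first exact: (h4 _ (in_ball _ q'r _ rr4)).
      exact: (h3 _ (in_ball _ q'r _ rr3)).
    have a1 := near_p q q1; have a2 := near_p (q + t) q2.
    have -> : tpartials [:: i] f (tpi (q + t)) - tpartials [:: i] f (tpi q) =
        (tpartials [:: i] f (tpi p) - tpartials [:: i] f (tpi q)) -
        (tpartials [:: i] f (tpi p) - tpartials [:: i] f (tpi (q + t))).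
      exact: subr_through.
    exact: le_trans (ler_normB _ _) (ltW (ltD_half a1 a2)).
  have edist i : enorm (tdiff f (tpi (q + t)) (basis2 R i) - tdiff f (tpi q) (basis2 R i)) <= 2 * k.
    rewrite !(tdiff_basis _ _ sf); apply: le_trans (enorm_le _) _.
    by have := dist i; rewrite prod_normE ge_max (mulr_natl k 2) mulr2n => /andP[]; exact: lerD.
  rewrite tdiff_sub.
  apply: le_trans (enormD _ _) _; rewrite !enormZ.
  have b1 : `|u.1| * enorm (tdiff f (tpi (q + t)) (basis2 R false) - tdiff f (tpi q) (basis2 R false))
      <= enorm u * (2 * k) by apply: ler_pM => //; [exact: enorm_ge0|exact: enorm_fst].
  have b2 : `|u.2| * enorm (tdiff f (tpi (q + t)) (basis2 R true) - tdiff f (tpi q) (basis2 R true))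
      <= enorm u * (2 * k) by apply: ler_pM => //; [exact: enorm_ge0|exact: enorm_snd].
  apply: le_trans (lerD b1 b2) _; rewrite le_eqVlt; apply/orP; left; apply/eqP.
  by rewrite /k; field.
(* Compactness, in the form of near coverings, replaces the local radii by one valid on the whole
   square. *)
have := (iffLR (compact_near_coveringP _) (@compact_unit_square R)) R 0^'+ P _ (fun p _ => loc p).
move=> /(_ _) H.
have [r r0 hr] : exists2 r : R, 0 < r & (`[0 : R, 1] `*` `[0 : R, 1]) `<=` P r.
  have /filter_ex[r [/= r0 hr]] : \forall r \near 0^'+, 0 < r /\ (`[0 : R, 1] `*` `[0 : R, 1]) `<=` P r.
    near=> r; split; first by near: r; exact: nbhs_right_gt.
    by near: r; exact: H.
  by exists r.
exists r => // x t tr.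
have [p pK <-] := torus_unit_square x.
exact: hr.
Unshelve. all: by end_near. Qed.

(** The translations are unrestricted: estimates for [word] depend on [G] and the length only, hence
    hold before the grid is known. *)
Inductive word (G : seq (DiffVol R)) : nat -> DiffVol R -> Prop :=
| word0 : word G 0 (diffvol_id R)
| wordS n g f (a : plane R) : word G n g -> f \in G ->
    word G n.+1 (diffvol_comp g (diffvol_comp (transl a) f)).

Lemma wordS_inv G n g : word G n.+1 g -> exists g' f a,
  [/\ word G n g', f \in G & g = diffvol_comp g' (diffvol_comp (transl a) f)].
Proof.
move Em : n.+1 => m w; case: w Em => // m' g' f a wg fG [->].
by exists g', f, a.
Qed.

Lemma tame_uniform_seq (G : seq (DiffVol R)) (e : R) : 0 < e ->
  exists2 r, 0 < r & forall f, f \in G -> forall x t, `|t| < r -> tame f e x t.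
Proof.
move=> e0; elim: G => [|f G [r r0 IH]]; first by exists 1.
have [r' r'0 h] := tame_uniform f e0.
exists (Num.min r r'); first by rewrite lt_min r0.
move=> g; rewrite inE => /predU1P[->|gG] x t; rewrite lt_min => /andP[t1 t2].
  exact: h.
exact: IH.
Qed.

Lemma translD (a b : plane R) x : transl a (transl b x) = transl (b + a) x.
Proof. by rewrite -(tpi_repr x) !transl_tpi addrA. Qed.

Lemma tdiffD f x u v : tdiff f x (u + v) = tdiff f x u + tdiff f x v.
Proof.
rewrite (tdiff_lin2 f x (u + v)) (tdiff_lin2 f x u) (tdiff_lin2 f x v) /lin2.
move: (tdiff f x (1, 0)) (tdiff f x (0, 1)) => [a c] [b d].
by rewrite [RHS]surjective_pairing; congr pair => /=; ring.
Qed.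

Lemma diffvol_compE (g f : DiffVol R) x : diffvol_comp g f x = g (f x).
Proof. by []. Qed.

Lemma tdiff_compE (g f : DiffVol R) x v :
  tdiff (diffvol_comp g f) x v = tdiff g (f x) (tdiff f x v).
Proof. exact: (tdiff_comp x v (diffvol_tsmooth g) (diffvol_tsmooth f)). Qed.

Lemma tdiff_step g f a x v : tdiff (diffvol_comp g (diffvol_comp (transl a) f)) x v =
  tdiff g (transl a (f x)) (tdiff f x v).
Proof.
move: (transl a) (@tdiff_transl R a) => h hE.
by rewrite (tdiff_compE g) (tdiff_compE h) hE diffvol_compE.
Qed.

Lemma tnorm_bounded_seq (G : seq (DiffVol R)) :
  exists2 C, 1 <= C & forall f, f \in G -> forall x, tnorm f x <= C.
Proof.
elim: G => [|f G [C C1 IH]]; first by exists 1.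
have [C' C'1 h] := tnorm_bounded f.
exists (Num.max C C'); first by rewrite le_max C1.
move=> g; rewrite inE => /predU1P[->|gG] x; rewrite le_max.
  by apply/orP; right; exact: h.
by apply/orP; left; exact: IH.
Qed.

Lemma word_bounded (G : seq (DiffVol R)) (C : R) : 1 <= C ->
  (forall f, f \in G -> forall x, tnorm f x <= C) ->
  forall n g, word G n g -> forall x v,
  enorm (tdiff g x v) <= C ^+ n * enorm v /\ enorm v <= C ^+ n * enorm (tdiff g x v).
Proof.
move=> C1 hC n g; elim: n g / => [|n g f a _ IH fG] x v.
  by rewrite expr0 !mul1r tdiff_id.
have C0 : 0 < C by exact: lt_le_trans C1.
rewrite tdiff_step; have [h1 h2] := IH (transl a (f x)) (tdiff f x v).
split.
  apply: le_trans h1 _; rewrite exprSr -mulrA ler_wpM2l ?exprn_ge0 ?(ltW C0)//.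
  apply: le_trans (enorm_tdiff_le _ _ _) _; rewrite ler_wpM2r ?enorm_ge0//.
  exact: hC.
apply: le_trans (enorm_tdiff_ge f x v) _; rewrite exprS -mulrA.
apply: ler_pM; [exact: tnorm_ge0|exact: enorm_ge0|exact: hC|exact: h2].
Qed.

Lemma tdiff_perturb g y (w w' u : plane R) (B B' d : R) : 0 <= B -> 0 <= d ->
  (forall v, enorm (tdiff g y v) <= B * enorm v) -> enorm (w' - w) <= d * enorm u ->
  enorm u <= B' * enorm (tdiff g y w) ->
  enorm (tdiff g y w') <= (1 + B * (d * B')) * enorm (tdiff g y w).
Proof.
move=> B0 d0 hB hw hu; rewrite -[in leLHS](subrK w w') [X in tdiff g y X]addrC tdiffD.
apply: le_trans (enormD _ _) _; rewrite mulrDl mul1r lerD2l.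
apply: le_trans (hB _) _; rewrite -!mulrA; apply: ler_wpM2l => //.
by apply: le_trans hw _; exact: ler_wpM2l.
Qed.

Lemma sqr_1D (e l : R) : 0 < e -> e <= 1 -> 3 * e <= l - 1 -> (1 + e) * (1 + e) <= l.
Proof.
move=> e0 e1 el; have : e * e <= e * 1 by apply: ler_wpM2l => //; exact: ltW.
by lra.
Qed.

(** Induction on the length for all [l] at once: a letter spends a factor [1 + e] on the change of
    its own derivative, and another on the displacement passed to the rest of the word, with
    [(1 + e)^2 <= l]. *)
Lemma tame_word (G : seq (DiffVol R)) n (l : R) : 1 < l ->
  exists2 r, 0 < r & forall g, word G n g -> forall x t, `|t| < r ->
    forall u, enorm (tdiff g (transl t x) u) <= l * enorm (tdiff g x u).
Proof.
have [C C1 hC] := tnorm_bounded_seq G; have C0 : 0 < C by exact: lt_le_trans C1.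
elim: n l => [|n IH] l l1.
  exists 1 => // g; move En : 0%N => m wg; case: wg En => // _ x t _ u.
  by rewrite !tdiff_id ler_peMl ?enorm_ge0// ltW.
pose e := Num.min 1 ((l - 1) / 3).
have e0 : 0 < e by rewrite lt_min ltr01 divr_gt0// subr_gt0.
have e1 : e <= 1 by rewrite ge_min lexx.
have el : 3 * e <= l - 1.
  have : e <= (l - 1) / 3 by rewrite ge_min lexx orbT.
  by lra.
have [r r0 IHr] := IH (1 + e) (ltr_pwDr e0 (lexx 1)).
(* The additive error on the first derivative is amplified by at most [C ^+ n], and the final vector
   is at least [C ^- n.+1] times the initial one; their quotient turns it into a relative error. *)
pose K := C ^+ n * C ^+ n.+1; have K0 : 0 < K by rewrite mulr_gt0// exprn_gt0.
pose e' := Num.min (e / K) r.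
have e'0 : 0 < e' by rewrite lt_min divr_gt0.
have [r' r'0 h] := tame_uniform_seq G e'0.
exists r' => // g /wordS_inv[g' [f [a [wg' fG ->]]]] x t tr u.
have hT := h f fG x t tr; have [[t' t'e ft] df] := hT.
have t'r : `|t'| < r by move: t'e; rewrite lt_min => /andP[].
have [_] := word_bounded C1 hC (wordS a wg' fG) x u.
rewrite !tdiff_step ft translD addrC -translD => hu.
have hB := fun v => (word_bounded C1 hC wg' (transl a (f x)) v).1.
have B0 : 0 <= C ^+ n by rewrite exprn_ge0// ltW.
have h2 := tdiff_perturb B0 (ltW e'0) hB (df u) hu.
apply: le_trans (IHr _ wg' (transl a (f x)) _ t'r (tdiff f (transl t x) u)) _.
apply: (@le_trans _ _ ((1 + e) * ((1 + e) * enorm (tdiff g' (transl a (f x)) (tdiff f x u))))).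
  apply: ler_wpM2l; first by rewrite addr_ge0// ltW.
  apply: le_trans h2 _; apply: ler_wpM2r; first exact: enorm_ge0.
  rewrite lerD2l mulrCA -ler_pdivlMr// -/K.
  by rewrite ge_min lexx.
rewrite mulrA; apply: ler_wpM2r; first exact: enorm_ge0.
exact: sqr_1D.
Qed.

End modulus.

(** * Twists *)

Section few_exceptions.
Context (R : realType).

Lemma count_no_three (s : seq nat) (P : pred nat) : uniq s ->
  (forall a b c, a \in s -> b \in s -> c \in s -> P a -> P b -> P c ->
     a != b -> a != c -> b != c -> False) -> (count P s <= 2)%N.
Proof.
move=> us h; rewrite -size_filter leqNgt; apply/negP.
have : {subset [seq x <- s | P x] <= [pred a | P a & a \in s]} by move=> a; rewrite mem_filter.
have := filter_uniq P us; case: [seq x <- s | P x] => [|a [|b [|c t]]]//=.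
rewrite !inE !negb_or => /andP[/andP[ab /andP[ac _]] /andP[/andP[bc _] _]] sub _.
have /andP[Pa sa] := sub a (mem_head _ _).
have /andP[Pb sb] : P b && (b \in s) by apply: sub; rewrite !inE eqxx orbT.
have /andP[Pc sc] : P c && (c \in s) by apply: sub; rewrite !inE eqxx !orbT.
exact: (h a b c).
Qed.

Lemma sum_count (s : seq nat) (P : pred nat) :
  \sum_(m <- s) (P m)%:R = (count P s)%:R :> R.
Proof. by elim: s => [|m s IH] /=; rewrite ?big_nil// big_cons IH natrD. Qed.

(** At most two of the sixteen indices are exceptional, so the average is at least
    [(2 lo + 14 hi) / 16]. *)
Lemma avg_few_exceptions (F : nat -> R) (P : pred nat) (lo hi : R) : lo <= hi ->
  (forall a b c : nat, (a < 16)%N -> (b < 16)%N -> (c < 16)%N -> P a -> P b -> P c ->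
     a != b -> a != c -> b != c -> False) ->
  (forall m, (m < 16)%N -> lo <= F m) -> (forall m, (m < 16)%N -> ~~ P m -> hi <= F m) ->
  (lo + 7 * hi) / 8 <= avg (iota 0 16) F.
Proof.
move=> lohi h3 hlo hhi.
have cnt : (count P (iota 0 16) <= 2)%N.
  apply: count_no_three; first exact: iota_uniq.
  by move=> a b c; rewrite !mem_iota /= !add0n; exact: h3.
have : avg (iota 0 16) (fun m => hi - (hi - lo) * (P m)%:R) <= avg (iota 0 16) F.
  apply: ler_avg => m; rewrite mem_iota /= add0n => m16; case: (boolP (P m)) => Pm.
    by rewrite mulr1 opprB addrC subrK; exact: hlo.
  by rewrite mulr0 subr0; exact: hhi.
apply: le_trans; rewrite /avg size_iota sumrB -mulr_sumr.
rewrite big_const_seq count_predT size_iota iter_addr addr0 sum_count.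
have : (count P (iota 0 16))%:R <= 2 :> R by rewrite ler_nat.
move: (count _ _) => c; rewrite -subr_ge0 => c2; have lh : 0 <= hi - lo by rewrite subr_ge0.
have := mulr_ge0 lh c2; rewrite -[hi *+ 16]mulr_natr; lra.
Qed.

End few_exceptions.

Section twists.
Context (R : realType).
Implicit Types (e y : R) (x : torus R) (p v w : plane R) (m : nat).

(** The coefficients [m] and [m^2] lie on a parabola, so that at no base point are three of the
    slopes close to one another. With multiples of a single profile all slopes would coincide at the
    zeros of its derivative. *)
Definition tcoef e m : R * R * R :=
  (0, m%:R * (e / (pi *+ 2)), m%:R ^+ 2 * (e / (pi *+ 2))).

Definition tslope y m : R :=
  m%:R * cos (pi *+ 2 * y) - m%:R ^+ 2 * sin (pi *+ 2 * y).

Definition twist e1 e2 (m n : nat) : DiffVol R :=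
  diffvol_comp (kick (true, tcoef e2 n)) (kick (false, tcoef e1 m)).

Definition twists e1 e2 : seq (DiffVol R) :=
  allpairs (twist e1 e2) (iota 0 16) (iota 0 16).

Lemma tdiff_twist e1 e2 m n x v : tdiff (twist e1 e2 m n) x v =
  let a := v.1 + v.2 * (e1 * tslope (repr x).2 m) in
  (a, v.2 + a * (e2 * tslope (repr (kick (false, tcoef e1 m) x)).1 n)).
Proof.
rewrite /twist (tdiff_compE (kick (true, tcoef e2 n))) !tdiff_kick.
by rewrite !wave_dwave_kick.
Qed.

Lemma tslope_le y m : (m < 16)%N -> `|tslope y m| <= 272.
Proof.
move=> m16; have m16' : m%:R <= 16 :> R by rewrite ler_nat ltnW.
have m0 : 0 <= m%:R :> R by [].
have c1 : `|m%:R * cos (pi *+ 2 * y)| <= m%:R by rewrite normrM ger0_norm// ler_piMr// cos_max.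
have s1 : `|m%:R ^+ 2 * sin (pi *+ 2 * y)| <= m%:R ^+ 2.
  by rewrite normrM ger0_norm ?exprn_ge0// ler_piMr ?exprn_ge0// sin_max.
have m2 : m%:R ^+ 2 <= 16 ^+ 2 :> R by rewrite lerXn2r// nnegrE.
by rewrite /tslope; apply: le_trans (ler_normB _ _) _; lra.
Qed.

Lemma shear_coord (a b k : R) : `|k| <= 1 / 4 ->
  enorm (a + b * k, b) <= 5 / 4 * enorm (a, b) /\
  3 / 4 * enorm (a, b) <= enorm (a + b * k, b).
Proof.
move=> k4; have b0 : enorm (b * k, 0) <= 1 / 4 * enorm (a, b).
  apply: le_trans (enorm_le _) _; rewrite /= normr0 addr0 normrM mulrC.
  by apply: ler_pM => //; exact: (enorm_snd (a, b)).
have h1 := enormD (a, b) (b * k, 0); have h2 := enormB (b * k, 0) 0.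
have E : (a, b) + (b * k, 0) = (a + b * k, b) by congr (_, _); exact: addr0.
have h3 := enormD (a + b * k, b) (0 - (b * k, 0)).
rewrite -h2 -{1}E sub0r addrK subr0 in h3; rewrite E in h1; split; lra.
Qed.

Lemma enorm_swap (a b : R) : enorm (a, b) = enorm (b, a).
Proof. by rewrite /enorm /= addrC. Qed.

Lemma slope_small e y m : 0 < e -> e <= 1 / 2000 -> (m < 16)%N -> `|e * tslope y m| <= 1 / 4.
Proof.
move=> e0 e1 m16; rewrite normrM gtr0_norm//.
have := tslope_le y m16; have := normr_ge0 (tslope y m); move: `|_| => d d0 d1.
have := ler_pM (ltW e0) d0 e1 d1; lra.
Qed.

Lemma twist_bounds e1 e2 m n x v : 0 < e1 <= 1 / 2000 -> 0 < e2 <= 1 / 2000 ->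
  (m < 16)%N -> (n < 16)%N ->
  enorm (tdiff (twist e1 e2 m n) x v) <= 2 * enorm v /\
  enorm v <= 2 * enorm (tdiff (twist e1 e2 m n) x v).
Proof.
move=> /andP[e10 e11] /andP[e20 e21] m16 n16; rewrite tdiff_twist /=.
have k1 := slope_small (repr x).2 e10 e11 m16.
have k2 := slope_small (repr (kick (false, tcoef e1 m) x)).1 e20 e21 n16.
move: (_ * tslope _ m) (_ * tslope _ n) k1 k2 => k1 k2 hk1 hk2.
have [u1 l1] := shear_coord v.1 v.2 hk1.
have [u2 l2] := shear_coord v.2 (v.1 + v.2 * k1) hk2.
rewrite [X in X <= _ /\ _]enorm_swap [X in _ /\ _ <= _ * X]enorm_swap.
move: u2 l2; rewrite [enorm (v.2, _)]enorm_swap => u2 l2.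
move: u1 l1; rewrite -surjective_pairing => u1 l1.
have := enorm_ge0 v; move: u1 l1 u2 l2.
move: (enorm _) (enorm _) (enorm _) => a b c; clear; lra.
Qed.

Lemma natr_dist_ge1 m n : m != n -> 1 <= `|m%:R - n%:R| :> R.
Proof.
wlog mn : m n / (m < n)%N.
  move=> h mn; have := mn; rewrite neq_ltn => /orP[/h->//|nm].
  by rewrite distrC h// eq_sym.
by move=> _; rewrite distrC -(natrB _ (ltnW mn)) normr_nat (ler_nat _ 1) subn_gt0.
Qed.

(* The differences of [tslope y] are [(m - n) * (C - (m + n) * S)]: two small ones
   would force [C] and [S] to be small together. *)
Lemma trig_separated (C S p q : R) : C ^+ 2 + S ^+ 2 = 1 -> 0 <= p <= 30 ->
  1 <= `|p - q| -> `|C - p * S| < 1 / 70 -> `|C - q * S| < 1 / 70 -> False.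
Proof.
move=> CS /andP[p0 p30] pq1 hp hq.
have S1 : `|S| <= 1 / 35.
  have : `|(p - q) * S| <= 1 / 35.
    have -> : (p - q) * S = (C - q * S) - (C - p * S) by ring.
    by apply: le_trans (ler_normB _ _) _; lra.
  by apply: le_trans; rewrite normrM ler_peMl.
have C1 : `|C| <= 61 / 70.
  have -> : C = (C - p * S) + p * S by rewrite subrK.
  apply: le_trans (ler_normD _ _) _; rewrite normrM (ger0_norm p0).
  have := ler_pM p0 (normr_ge0 S) p30 S1; lra.
have : `|S| ^+ 2 <= (1 / 35) ^+ 2 by rewrite lerXn2r// nnegrE//; lra.
have : `|C| ^+ 2 <= (61 / 70) ^+ 2 by rewrite lerXn2r// nnegrE//; lra.
rewrite !real_normK ?num_real// => h1 h2; move: CS h1 h2; clear; lra.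
Qed.

Lemma tslope_separated y a b c : (a < 16)%N -> (b < 16)%N -> (c < 16)%N ->
  a != b -> a != c -> b != c ->
  `|tslope y a - tslope y b| < 1 / 70 -> `|tslope y a - tslope y c| < 1 / 70 -> False.
Proof.
move=> a16 b16 c16 ab ac bc.
have E n : tslope y a - tslope y n =
    (a%:R - n%:R) * (cos (pi *+ 2 * y) - (a + n)%:R * sin (pi *+ 2 * y)).
  by rewrite /tslope natrD; ring.
have red n : a != n -> `|tslope y a - tslope y n| < 1 / 70 ->
    `|cos (pi *+ 2 * y) - (a + n)%:R * sin (pi *+ 2 * y)| < 1 / 70.
  by move=> an; rewrite E; apply: le_lt_trans; rewrite normrM ler_peMl// natr_dist_ge1.
move=> /(red _ ab) h1 /(red _ ac) h2.
apply: (trig_separated _ _ _ h1 h2); first exact: cos2Dsin2.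
  by rewrite ler0n ler_nat; lia.
by rewrite !natrD opprD addrACA subrr add0r natr_dist_ge1.
Qed.

End twists.

Section spreading.
Context (R : realType).
Implicit Types (e y : R) (x z : torus R) (p v w : plane R) (m n : nat) (g : DiffVol R).

Lemma tnorm_le_sum g z : tnorm g z <= enorm (tdiff g z (1, 0)) + enorm (tdiff g z (0, 1)).
Proof.
rewrite -(ler_pXn2r (n := 2)) ?nnegrE ?tnorm_ge0 ?addr_ge0 ?enorm_ge0// sqr_tnorm.
have := mulr_ge0 (enorm_ge0 (tdiff g z (1, 0))) (enorm_ge0 (tdiff g z (0, 1))).
by move: (enorm _) (enorm _) => a b; lra.
Qed.

(** By Cramer's rule, each basis vector times the determinant of [v] and [w] is a combination of
    these two. Hence two transverse vectors cannot both have images much shorter than the norm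
    allows. *)
Lemma tnorm_det g z v w : `|v.1 * w.2 - v.2 * w.1| * tnorm g z <=
  2 * (enorm w * enorm (tdiff g z v) + enorm v * enorm (tdiff g z w)).
Proof.
set d := v.1 * w.2 - v.2 * w.1.
have bound (a b : R) (u : plane R) : `|a| <= enorm w -> `|b| <= enorm v ->
    d *: u = a *: v + b *: w ->
    `|d| * enorm (tdiff g z u) <= enorm w * enorm (tdiff g z v) + enorm v * enorm (tdiff g z w).
  move=> ha hb E; rewrite -enormZ -tdiffZ E tdiffD !tdiffZ.
  apply: le_trans (enormD _ _) _; rewrite !enormZ.
  by apply: lerD; apply: ler_wpM2r => //; exact: enorm_ge0.
have h1 : `|d| * enorm (tdiff g z (1, 0)) <=
    enorm w * enorm (tdiff g z v) + enorm v * enorm (tdiff g z w).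
  apply: (bound w.2 (- v.2)); rewrite ?normrN ?enorm_snd//.
  by congr (_, _) => /=; rewrite /GRing.scale /= /d; ring.
have h2 : `|d| * enorm (tdiff g z (0, 1)) <=
    enorm w * enorm (tdiff g z v) + enorm v * enorm (tdiff g z w).
  apply: (bound (- w.1) v.1); rewrite ?normrN ?enorm_fst//.
  by congr (_, _) => /=; rewrite /GRing.scale /= /d; ring.
apply: le_trans (ler_wpM2l (normr_ge0 d) (tnorm_le_sum g z)) _.
by rewrite mulrDr mulr_natl mulr2n; apply: lerD.
Qed.

(** The aim is a first coordinate bounded away from 0, on which the effect of the second shear
    depends. If [|w.2| >= 1 / 2], bad shears have slopes closer than
    [2 * (1 / 280) / (1 / 2) = 1 / 70]; otherwise [|w.1| >= 3 / 4] and no shear is bad. *)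
Lemma first_shear_exceptions e y w : 0 < e <= 1 / 2000 -> enorm w = 1 ->
  forall a b c : nat, (a < 16)%N -> (b < 16)%N -> (c < 16)%N ->
  let bad m := `|w.1 + w.2 * (e * tslope y m)| < e / 280 in
  bad a -> bad b -> bad c -> a != b -> a != c -> b != c -> False.
Proof.
move=> /andP[e0 e1] w1 a b c a16 b16 c16 bad ha hb hc ab ac bc.
have [w2|w2] := lerP (1 / 2) `|w.2|.
  have sep n : bad n -> `|tslope y a - tslope y n| < 1 / 70.
    move=> hn; have : `|(w.2 * e) * (tslope y a - tslope y n)| < e / 140.
      have -> : (w.2 * e) * (tslope y a - tslope y n) =
        (w.1 + w.2 * (e * tslope y a)) - (w.1 + w.2 * (e * tslope y n)) by ring.
      apply: le_lt_trans (ler_normB _ _) _.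
      by move: ha hn; rewrite /bad; move: `|_| `|_| => p q; clear -e0; lra.
    rewrite !normrM (gtr0_norm e0) => h; rewrite ltNge; apply/negP => h'.
    have p1 : 1 / 2 * e <= `|w.2| * e by rewrite ler_pM2r.
    have p2 : 0 <= 1 / 2 * e by rewrite mulr_ge0// ltW.
    have p3 : 0 <= 1 / 70 :> R by lra.
    have := le_lt_trans (ler_pM p2 p3 p1 h') h.
    by rewrite (_ : 1 / 2 * e * (1 / 70) = e / 140) ?ltxx//; field.
  exact: (tslope_separated a16 b16 c16 ab ac bc (sep b hb) (sep c hc)).
have k := slope_small y e0 e1 a16.
have w1ge : 3 / 4 <= `|w.1|.
  rewrite leNgt; apply/negP => w1lt; have := sqr_enorm w; rewrite w1 expr1n.
  have : `|w.1| ^+ 2 <= (3 / 4) ^+ 2 by rewrite lerXn2r ?nnegrE// ltW.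
  have : `|w.2| ^+ 2 <= (1 / 2) ^+ 2 by rewrite lerXn2r ?nnegrE// ltW.
  by rewrite !real_normK ?num_real//; move: (w.1 ^+ 2) (w.2 ^+ 2) => p q; lra.
have wk : `|w.2 * (e * tslope y a)| <= 1 / 8.
  rewrite normrM; apply: le_trans (ler_pM (normr_ge0 _) (normr_ge0 _) (ltW w2) k) _.
  by lra.
have := ler_normB (w.1 + w.2 * (e * tslope y a)) (w.2 * (e * tslope y a)).
rewrite addrK; move: ha wk; rewrite /bad; move: `|_ + _| `|_ * _| => p q; lra.
Qed.

Lemma second_shear_exceptions e y d w g z : 0 < e <= 1 / 2000 -> 0 < d ->
  d <= `|w.1| -> enorm w <= 5 / 4 ->
  forall a b c : nat, (a < 16)%N -> (b < 16)%N -> (c < 16)%N ->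
  let bad m := enorm (tdiff g z (w.1, w.2 + w.1 * (e * tslope y m))) <
    e * d ^+ 2 / 840 * tnorm g z in
  bad a -> bad b -> bad c -> a != b -> a != c -> b != c -> False.
Proof.
move=> /andP[e0 e1] d0 dw wb a b c a16 b16 c16 bad ha hb hc ab ac bc.
have T0 : 0 < tnorm g z by exact: lt_le_trans (tnorm_ge1 g z).
have nrm m : (m < 16)%N -> enorm (w.1, w.2 + w.1 * (e * tslope y m)) <= 3.
  move=> m16; have [h _] := shear_coord w.2 w.1 (slope_small y e0 e1 m16).
  move: h wb; rewrite (enorm_swap (w.2 + _)) (enorm_swap w.2 w.1) -surjective_pairing.
  by move: (enorm _) (enorm _) => p q; lra.
have sep n : (n < 16)%N -> bad n -> `|tslope y a - tslope y n| < 1 / 70.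
  move=> n16 hn; have := tnorm_det g z (w.1, w.2 + w.1 * (e * tslope y a))
    (w.1, w.2 + w.1 * (e * tslope y n)).
  rewrite [X in `|X|](_ : _ = w.1 ^+ 2 * e * (tslope y n - tslope y a)); last by rewrite /=; ring.
  rewrite !normrM (gtr0_norm e0) -expr2 distrC.
  have := nrm a a16; have := nrm n n16; move: ha hn; rewrite /bad.
  move: (enorm_ge0 (tdiff g z (w.1, w.2 + w.1 * (e * tslope y a)))).
  move: (enorm_ge0 (tdiff g z (w.1, w.2 + w.1 * (e * tslope y n)))).
  move: (enorm (tdiff g z _)) (enorm (tdiff g z _)) => A B A0 B0.
  move: (enorm _) (enorm _) (tnorm g z) T0 => p q T T0 hB hA p3 q3 h.
  have p1 : p * B <= 3 * B by exact: ler_wpM2r.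
  have p2 : q * A <= 3 * A by exact: ler_wpM2r.
  have k1 : `|w.1| ^+ 2 * e * `|tslope y a - tslope y n| * T < (e * d ^+ 2 / 70) * T.
    apply: le_lt_trans h _; move: hA hB p1 p2; clear; lra.
  rewrite ltr_pM2r// in k1; rewrite ltNge; apply/negP => h'.
  have dd : d ^+ 2 <= `|w.1| ^+ 2 by rewrite lerXn2r// nnegrE// ltW.
  have dd0 : 0 <= d ^+ 2 * e by rewrite mulr_ge0// ?exprn_ge0// ltW.
  have k2 : d ^+ 2 * e <= `|w.1| ^+ 2 * e by rewrite ler_pM2r.
  have k3 : 0 <= 1 / 70 :> R by rewrite divr_ge0.
  have := le_lt_trans (ler_pM dd0 k3 k2 h') k1.
  by rewrite (_ : d ^+ 2 * e * (1 / 70) = e * d ^+ 2 / 70) ?ltxx//; field.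
exact: (tslope_separated a16 b16 c16 ab ac bc (sep b b16 hb) (sep c c16 hc)).
Qed.

Lemma ln_ge_inv (T d a : R) : 0 < T -> 0 < d -> d <= 1 / 2 -> 1 <= 2 * (T * a) -> - ln T + ln d <= ln a.
Proof.
move=> T0 d0 d1 h; have a0 : 0 < a.
  by rewrite -(pmulr_rgt0 _ T0) -(pmulr_rgt0 _ (@ltr0Sn R 1)); exact: lt_le_trans h.
have -> : - ln T + ln d = ln (d / T) by rewrite ln_div ?posrE// addrC.
rewrite ler_ln ?posrE ?divr_gt0// ler_pdivrMr// mulrC; lra.
Qed.

Lemma spread_le e1 e2 : 0 < e1 -> e1 <= 1 / 2000 -> 0 < e2 -> e2 <= 1 / 2000 ->
  e2 * (e1 / 280) ^+ 2 / 840 <= 1 / 2.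
Proof.
move=> e10 e11 e20 e21; have : 0 <= e1 / 280 <= 1 by apply/andP; split; lra.
move=> /andP[d0 d1]; have d2 := exprn_ile1 2 d0 d1.
by have := ler_pM (ltW e20) (sqr_ge0 (e1 / 280)) e21 d2; move: (_ * _ ^+ 2) => d; lra.
Qed.

Lemma spread_constants e1 e2 : 0 < e1 <= 1 / 2000 -> 0 < e2 <= 1 / 2000 ->
  exists d d', [/\ 0 < d, d = e1 / 280, 0 < d', d' <= 1 / 2 & d' = e2 * d ^+ 2 / 840].
Proof.
have p280 : 0 < 280 :> R by rewrite ltr0n.
have p840 : 0 < 840 :> R by rewrite ltr0n.
move=> /andP[e10 e11] /andP[e20 e21]; have d0 := divr_gt0 e10 p280.
exists (e1 / 280), (e2 * (e1 / 280) ^+ 2 / 840); split.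
- exact: d0.
- by [].
- exact: (divr_gt0 (mulr_gt0 e20 (exprn_gt0 2 d0)) p840).
- exact: (spread_le e10 e11 e20 e21).
- by [].
Qed.

(** Write [T = ln (tnorm g z)]. In the worst case a vector loses [T]. For a good first shear, the
    second one gives on average [(- T + 7 T) / 8 = 3 T / 4]; averaging over the first gives
    [(- T + 7 * (3 T / 4)) / 8 = 17 T / 32], which is at least [T / 2]. *)
Lemma twists_stretch e1 e2 : 0 < e1 <= 1 / 2000 -> 0 < e2 <= 1 / 2000 ->
  exists C, forall g z x w, enorm w = 1 ->
  ln (tnorm g z) / 2 - C <= avg (twists e1 e2) (fun f => ln (enorm (tdiff g z (tdiff f x w)))).
Proof.
move=> he1 he2.
have [d [d' [d0 dE d'0 d'1 d'E]]] := spread_constants he1 he2.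
exists (- ln d') => g z x w w1.
have T1 := tnorm_ge1 g z; have T0 := lt_le_trans ltr01 T1.
have a0 := ln_ge0 T1.
rewrite [leRHS]avg_allpairs.
pose F m n := ln (enorm (tdiff g z (tdiff (twist e1 e2 m n) x w))).
have lo m n : (m < 16)%N -> (n < 16)%N -> - ln (tnorm g z) + ln d' <= F m n.
  move=> m16 n16; have [_] := twist_bounds x w he1 he2 m16 n16; rewrite w1 => h.
  apply: ln_ge_inv => //; apply: le_trans h _; apply: ler_wpM2l => //.
  exact: enorm_tdiff_ge.
have lo_avg m : (m < 16)%N -> - ln (tnorm g z) + ln d' <= avg (iota 0 16) (F m).
  move=> m16; rewrite -[leLHS](@avg_cst R nat (iota 0 16))//.
  by apply: ler_avg => n; rewrite mem_iota /= add0n; exact: lo.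
pose y := (repr x).2; pose k m := e1 * tslope y m.
have hi m : (m < 16)%N -> ~~ (`|w.1 + w.2 * k m| < d) ->
    3 / 4 * ln (tnorm g z) + ln d' <= avg (iota 0 16) (F m).
  move=> m16; rewrite -leNgt => dw.
  pose y' := (repr (kick (false, tcoef e1 m) x)).1.
  pose w' := (w.1 + w.2 * k m, w.2).
  have w'1 : enorm w' <= 5 / 4.
    case/andP: (he1) => e10 e11; have [+ _] := shear_coord w.1 w.2 (slope_small y e10 e11 m16).
    by rewrite -surjective_pairing w1 mulr1.
  have -> : 3 / 4 * ln (tnorm g z) + ln d' =
      (- ln (tnorm g z) + ln d' + 7 * (ln (tnorm g z) + ln d')) / 8 by field.
  have FE n : F m n = ln (enorm (tdiff g z (w'.1, w'.2 + w'.1 * (e2 * tslope y' n)))).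
    by rewrite /F tdiff_twist.
  apply: (avg_few_exceptions (P := fun n =>
     enorm (tdiff g z (w'.1, w'.2 + w'.1 * (e2 * tslope y' n))) < d' * tnorm g z)).
  - by move: (ln (tnorm g z)) (ln d') a0 => a b; clear; lra.
  - move=> a b c a16 b16 c16 /=; rewrite d'E.
    exact: (@second_shear_exceptions e2 y' d w' g z he2 d0 dw w'1 a b c a16 b16 c16).
  - by move=> n; exact: lo.
  - move=> n n16; rewrite -leNgt FE => h; rewrite addrC -lnM ?posrE//.
    have dT := mulr_gt0 d'0 T0; rewrite ler_ln ?posrE//.
    exact: lt_le_trans h.
apply: le_trans (_ : (- ln (tnorm g z) + ln d' + 7 * (3 / 4 * ln (tnorm g z) + ln d')) / 8 <= _).
  by rewrite opprK; move: (ln (tnorm g z)) (ln d') a0 => a b; clear; lra.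
apply: (avg_few_exceptions (P := fun m => `|w.1 + w.2 * k m| < d)).
- by rewrite lerD2r; move: (ln (tnorm g z)) a0 => a; clear; lra.
- move=> a b c a16 b16 c16 /=; rewrite dE.
  exact: (@first_shear_exceptions e1 y w he1 w1 a b c a16 b16 c16).
- exact: lo_avg.
- exact: hi.
Qed.

Lemma wave_tcoef_le e y m : 0 < e -> (m < 16)%N -> `|wave (tcoef e m) y| <= 272 * e.
Proof.
move=> e0 m16; have m16' : m%:R <= 16 :> R by rewrite ler_nat ltnW.
have m0 : 0 <= m%:R :> R by [].
have p2 : 1 <= pi *+ 2 :> R by have := @pi_ge2 R; rewrite mulr2n; lra.
have s0 : 0 <= e / (pi *+ 2) by rewrite divr_ge0 ?(ltW e0)// (le_trans ler01).
have s1 : e / (pi *+ 2) <= e by rewrite ler_pdivrMr ?(lt_le_trans ltr01)// ler_peMr// ltW.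
rewrite /wave /tcoef /= add0r; move: (_ / _) s0 s1 => s s0 s1.
have m2 : m%:R ^+ 2 <= 16 ^+ 2 :> R by rewrite lerXn2r// nnegrE.
have c1 : `|m%:R * s * sin (pi *+ 2 * y)| <= 16 * e.
  rewrite normrM; apply: (@le_trans _ _ (m%:R * s)); last exact: ler_pM.
  by rewrite ger0_norm ?mulr_ge0// ler_piMr ?mulr_ge0// sin_max.
have c2 : `|m%:R ^+ 2 * s * cos (pi *+ 2 * y)| <= 16 ^+ 2 * e.
  rewrite normrM; apply: (@le_trans _ _ (m%:R ^+ 2 * s)); last by apply: ler_pM => //; exact: sqr_ge0.
  by rewrite ger0_norm ?mulr_ge0 ?sqr_ge0// ler_piMr ?mulr_ge0 ?sqr_ge0// cos_max.
apply: le_trans (ler_normD _ _) _; move: `|_| `|_| c1 c2 => a b; clear; lra.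
Qed.

Lemma twist_displacement (e e1 e2 : R) m n p : 0 < e1 <= e -> 0 < e2 <= e ->
  (m < 16)%N -> (n < 16)%N ->
  exists2 d : plane R, `|d| <= 272 * e & twist e1 e2 m n (tpi p) = tpi (p + d).
Proof.
move=> /andP[e10 e1e] /andP[e20 e2e] m16 n16.
pose q := pshear false (tcoef e1 m) p.
exists (wave (tcoef e1 m) p.2, wave (tcoef e2 n) q.1).
  rewrite prod_normE ge_max; apply/andP; split.
    exact: le_trans (wave_tcoef_le _ e10 m16) (ler_wpM2l (ler0n _ _) e1e).
  exact: le_trans (wave_tcoef_le _ e20 n16) (ler_wpM2l (ler0n _ _) e2e).
rewrite /twist (diffvol_compE (kick _)) /kick.
rewrite [LHS](_ : _ = tshear true (tcoef e2 n) (tshear false (tcoef e1 m) (tpi p)))//.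
rewrite !tshear_tpi -/q pshearE /=; congr tpi.
by rewrite addr0.
Qed.

End spreading.

(** * Perturbations in the smooth topology *)

Section smooth_closeness.
Context (R : realType).
Implicit Types (F G : plane R -> plane R) (f g h : DiffVol R) (x : torus R) (p q v : plane R).

Lemma partials_comb F G (a b : R) (A : set (plane R)) : open A ->
  (forall q, A q -> forall s, differentiable (partials s F) q) ->
  (forall q, A q -> forall s, differentiable (partials s G) q) ->
  forall s q, A q -> partials s (fun r => a *: F r + b *: G r) q =
    a *: partials s F q + b *: partials s G q.
Proof.
move=> oA dF dG; elim=> [//|i s IH] q Aq /=.
have dFq := dF q Aq s; have dGq := dG q Aq s.
transitivity ('D_(basis2 R i) (fun r => a *: partials s F r + b *: partials s G r) q).
  apply: near_eq_derive; near=> r; apply: IH; near: r.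
  exact: open_nbhs_nbhs.
rewrite [LHS](deriveD (f := fun r => a *: partials s F r) (g := fun r => b *: partials s G r)).
- by rewrite !deriveZ//; exact: diff_derivable.
- by apply: derivableZ; exact: diff_derivable.
- by apply: derivableZ; exact: diff_derivable.
Unshelve. all: by end_near. Qed.

Lemma smooth_near_open F G p : smooth_near F p -> smooth_near G p ->
  exists A : set (plane R), [/\ open A, A p,
    forall q, A q -> forall s, differentiable (partials s F) q &
    forall q, A q -> forall s, differentiable (partials s G) q].
Proof.
move=> sF sG; have : nbhs p ([set q | forall s, differentiable (partials s F) q] `&`
    [set q | forall s, differentiable (partials s G) q]) by exact: filterI.
rewrite nbhsE => -[A [oA Ap] AB]; exists A.
by split => // q /AB[].
Qed.

Definition scale3 (e : R) (c : R * R * R) : R * R * R := (e * c.1.1, e * c.1.2, e * c.2).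

Lemma pshear_scale e b c p :
  pshear b (scale3 e c) p = (1 - e) *: p + e *: pshear b c p.
Proof.
rewrite !pshearE /wave /scale3; case: b; case: p => x y;
  by congr (_, _); rewrite /= /GRing.scale /=; ring.
Qed.

Lemma smooth_lift_shear g b c p G : smooth_lift g p G ->
  smooth_lift (diffvol_comp (shear b c) g) p (pshear b c \o G).
Proof. by move=> lG; exact: smooth_lift_comp lG (smooth_lift_tshear b c (G p)). Qed.

(** The lift is affine in the amplitude by [pshear_scale], and partial derivatives are linear.
    Closeness for small amplitudes thus follows from bounds on two fixed maps, without estimating
    derivatives of a composition. *)
Lemma tpartials_shear_scale g e b c (s : seq bool) x : s != [::] ->
  tpartials s (diffvol_comp (shear b (scale3 e c)) g) x =
  (1 - e) *: (tpartials s g x : plane R) +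
  e *: (tpartials s (diffvol_comp (shear b c) g) x : plane R).
Proof.
move=> s0; have [G lG] := @diffvol_tsmooth R g (repr x).
have sm := @diffvol_tsmooth R.
have lift_c c' := smooth_lift_shear b c' lG.
rewrite -(tpi_repr x).
rewrite (smooth_lift_tpartials s0 (sm _) (lift_c (scale3 e c))).
rewrite (smooth_lift_tpartials s0 (sm _) (lift_c c)) (smooth_lift_tpartials s0 (sm _) lG).
have [A [oA Ap dG dH]] := smooth_near_open lG.2 (lift_c c).2.
rewrite -(partials_comb (1 - e) e oA dG dH s Ap); congr (partials s _ _).
by apply/funext => r /=; rewrite pshear_scale.
Qed.

Lemma all_words k : exists S : seq (seq bool), forall s : seq bool, (size s <= k)%N -> s \in S.
Proof.
elim: k => [|k [S hS]]; first by exists [:: [::]] => -[].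
exists ([::] :: (map (cons true) S ++ map (cons false) S)) => -[//|i s] /= sk.
rewrite inE mem_cat; apply/orP; right; apply/orP.
by case: i; [left|right]; apply: map_f; exact: hS.
Qed.

Lemma tpartials_bounded_upto f k : exists2 C, 0 < C &
  forall s x, (0 < size s <= k)%N -> enorm (tpartials s f x : plane R) <= C.
Proof.
have [S hS] := all_words k.
suff [C C0 hC] : exists2 C, 0 < C & forall s, s \in S -> s != [::] ->
    forall x, enorm (tpartials s f x : plane R) <= C.
  exists C => // s x /andP[s0 sk]; apply: hC; first exact: hS.
  by rewrite -size_eq0 -lt0n.
elim: S {hS} => [|s S [C C0 IH]]; first by exists 1.
have [->|s0] := eqVneq s [::].
  by exists C => // t; rewrite inE => /predU1P[->//|]; exact: IH.
have [C' C'0 hC'] := tpartials_bounded s0 (@diffvol_tsmooth R f).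
exists (C + C'); first exact: addr_gt0.
move=> t; rewrite inE => /predU1P[->|tS] t0 x.
  by apply: le_trans (hC' x) _; rewrite lerDr ltW.
by apply: le_trans (IH t tS t0 x) _; rewrite lerDl ltW.
Qed.

Lemma wave_bound (c : R * R * R) y : `|wave c y| <= `|c.1.1| + `|c.1.2| + `|c.2|.
Proof.
rewrite /wave; apply: le_trans (ler_normD _ _) _; apply: lerD.
  by apply: le_trans (ler_normD _ _) _; rewrite lerD2l normrM ler_piMr// sin_max.
by rewrite normrM ler_piMr// cos_max.
Qed.

Lemma enorm_push b (c : R * R * R) p : enorm (push b c p) <= `|c.1.1| + `|c.1.2| + `|c.2|.
Proof.
apply: le_trans (enorm_le _) _; rewrite /push.
by case: b; rewrite /= normr0 ?addr0 ?add0r; exact: wave_bound.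
Qed.

Lemma subr_comb (V : lmodType R) (e : R) (u v : V) :
  u - ((1 - e) *: u + e *: v) = e *: (u - v).
Proof. by rewrite scalerBl scale1r opprD opprB addrA addrCA subrr addr0 scalerBr. Qed.

Lemma near_shear_Ck_ball g k (E : R) b c : 0 < E ->
  \forall e \near 0^'+, Ck_ball k E g (diffvol_comp (shear b (scale3 e c)) g).
Proof.
move=> E0; have [C1 C10 h1] := tpartials_bounded_upto g k.
have [C2 C20 h2] := tpartials_bounded_upto (diffvol_comp (shear b c) g) k.
pose C := C1 + C2 + (`|c.1.1| + `|c.1.2| + `|c.2|).
have C0 : 0 < C by rewrite /C ltr_wpDr ?addr_ge0// addr_gt0.
near=> e.
have e0 : 0 < e by near: e; exact: nbhs_right_gt.
have eE : e * C < E.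
  by rewrite -ltr_pdivlMr//; near: e; apply: nbhs_right_lt; rewrite divr_gt0.
move=> x; split.
  rewrite diffvol_compE -(tpi_repr (g x)).
  rewrite [X in tdist _ X](_ : _ = tpi (pshear b (scale3 e c) (repr (g x)))); last exact: tshear_tpi.
  apply: le_lt_trans (tdist_le _ _) _; apply: le_lt_trans eE.
  rewrite /pshear enormB addrAC subrr add0r; apply: le_trans (enorm_push _ _ _) _.
  rewrite /scale3 /= !normrM !(gtr0_norm e0) -!mulrDr ler_pM2l//.
  by rewrite /C lerDr addr_ge0// ltW.
move=> s sk; have s0 : s != [::] by case/andP: sk; case: (s).
rewrite tpartials_shear_scale// subr_comb enormZ (gtr0_norm e0).
apply: le_lt_trans eE; rewrite ler_pM2l//.
apply: le_trans (enormD _ _) _; rewrite enormN.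
apply: le_trans (lerD (h1 s x sk) (h2 s x sk)) _.
by rewrite /C lerDl !addr_ge0.
Unshelve. all: by end_near. Qed.

Lemma Ck_ball_trans k (e1 e2 : R) f g h : Ck_ball k e1 f g -> Ck_ball k e2 g h ->
  Ck_ball k (e1 + e2) f h.
Proof.
move=> fg gh x; have [a1 b1] := fg x; have [a2 b2] := gh x; split.
  by apply: le_lt_trans (tdist_triangle _ (g x) _) _; exact: ltrD.
move=> s sk; rewrite -(subrK (tpartials s g x : plane R) (tpartials s f x)) -addrA.
by apply: le_lt_trans (enormD _ _) _; apply: ltrD; [exact: b1|exact: b2].
Qed.

Lemma transl_Ck_ball k (E : R) g (a : plane R) : enorm a < E ->
  Ck_ball k E g (diffvol_comp (transl a) g).
Proof.
move=> aE x; split.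
  rewrite diffvol_compE -(tpi_repr (g x)) transl_tpi.
  by apply: le_lt_trans (tdist_le _ _) _; rewrite enormB addrAC subrr add0r.
move=> s sk; have s0 : s != [::] by case/andP: sk; case: (s).
have [G lG] := @diffvol_tsmooth R g (repr x); have sm := @diffvol_tsmooth R.
have lH : smooth_lift (diffvol_comp (transl a) g) (repr x) (fun q => G q + a).
  have := smooth_lift_shear true (a.2, 0, 0) (smooth_lift_shear false (a.1, 0, 0) lG).
  rewrite diffvol_compA; congr smooth_lift; apply/funext => q /=.
  by rewrite !pshearE !wave_cst.
rewrite -(tpi_repr x) (smooth_lift_tpartials s0 (sm _) lH) (smooth_lift_tpartials s0 (sm _) lG).
have GE : \forall q \near (repr x : plane R), G q + a = G q + a by near=> q.
rewrite (nbhs_singleton (partials_addc s0 GE)) subrr enorm0.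
exact: le_lt_trans (enorm_ge0 a) aE.
Unshelve. all: by end_near. Qed.

End smooth_closeness.

Section small_perturbations.
Context (R : realType).
Implicit Types (f g h : DiffVol R).

Lemma near_seq (T : eqType) (U : Type) (F : set_system U) (s : seq T) (P : T -> U -> Prop) :
  Filter F -> (forall t, t \in s -> \forall e \near F, P t e) ->
  \forall e \near F, forall t, t \in s -> P t e.
Proof.
move=> FF; elim: s => [|t s IH] h; first by near=> e.
have h1 := h t (mem_head _ _).
have h2 : \forall e \near F, forall t, t \in s -> P t e.
  by apply: IH => u us; apply: h; rewrite inE us orbT.
near=> e => u; rewrite inE => /predU1P[->|]; first by near: e.
by move: u; near: e.
Unshelve. all: by end_near. Qed.

Lemma scale3_kicks (e : R) : kicks e = [seq (t.1, scale3 e t.2) | t <- kicks 1].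
Proof.
rewrite /kicks /scale3 /= !mulr0 div1r.
by have -> : - (e / (pi *+ 2)) = e * - (pi *+ 2)^-1 by rewrite mulrN.
Qed.

Lemma scale3_tcoef (e : R) m : tcoef e m = scale3 e (tcoef 1 m).
Proof. by rewrite /tcoef /scale3 /= mulr0 div1r !(mulrCA e). Qed.

Lemma kicks_close f k (E b : R) : 0 < E -> 0 < b ->
  exists e, [/\ 0 < e, e <= b & forall t, t \in kicks e -> Ck_ball k E f (diffvol_comp (kick t) f)].
Proof.
move=> E0 b0.
have near_k : \forall e \near (0 : R)^'+, forall t, t \in kicks (1 : R) ->
    Ck_ball k E f (diffvol_comp (shear t.1 (scale3 e t.2)) f).
  by apply: near_seq => t _; exact: near_shear_Ck_ball.
have /filter_ex[e [/= e0 [eb he]]] : \forall e \near (0 : R)^'+, 0 < e /\ (e < b /\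
    forall t, t \in kicks (1 : R) -> Ck_ball k E f (diffvol_comp (shear t.1 (scale3 e t.2)) f)).
  near=> e; split; first by near: e; exact: nbhs_right_gt.
  by split; near: e => //; exact: nbhs_right_lt.
exists e; split => //; first exact: ltW.
by move=> t; rewrite scale3_kicks => /mapP[u /he hu ->].
Unshelve. all: by end_near. Qed.

Lemma tcoef_close (S : seq (DiffVol R)) b k (E c : R) : 0 < E -> 0 < c ->
  exists e, [/\ 0 < e, e <= c & forall f, f \in S -> forall m, (m < 16)%N ->
    Ck_ball k E f (diffvol_comp (kick (b, tcoef e m)) f)].
Proof.
move=> E0 c0.
have near_k : \forall e \near (0 : R)^'+, forall f, f \in S -> forall m, m \in iota 0 16 ->
    Ck_ball k E f (diffvol_comp (shear b (scale3 e (tcoef 1 m))) f).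
  by apply: near_seq => f _; apply: near_seq => m _; exact: near_shear_Ck_ball.
have /filter_ex[e [/= e0 [ec he]]] : \forall e \near (0 : R)^'+, 0 < e /\ (e < c /\
    forall f, f \in S -> forall m, m \in iota 0 16 ->
    Ck_ball k E f (diffvol_comp (shear b (scale3 e (tcoef 1 m))) f)).
  near=> e; split; first by near: e; exact: nbhs_right_gt.
  by split; near: e => //; exact: nbhs_right_lt.
exists e; split => //; first exact: ltW.
move=> f fS m m16; rewrite scale3_tcoef.
have mi : m \in iota 0 16 by rewrite mem_iota add0n.
exact: he.
Unshelve. all: by end_near. Qed.

Lemma twists_close (S : seq (DiffVol R)) k (E c : R) : 0 < E -> 0 < c ->
  exists e1 e2, [/\ 0 < e1 <= c, 0 < e2 <= c & forall f, f \in S ->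
    forall g, g \in twists e1 e2 -> Ck_ball k (E + E) f (diffvol_comp g f)].
Proof.
move=> E0 c0; have [e1 [e10 e1c h1]] := tcoef_close S false k E0 c0.
(* The second amplitude is chosen after the first, so as to suit every map already composed with a
   first shear. *)
have [e2 [e20 e2c h2]] := tcoef_close
  [seq diffvol_comp (kick (false, tcoef e1 m)) f | f <- S, m <- iota 0 16] true k E0 c0.
exists e1, e2; split; [by rewrite e10|by rewrite e20|].
move=> f fS g /allpairsP[[m n] [mi ni ->]].
move: (mi) (ni); rewrite !mem_iota !add0n => m16 n16.
apply: Ck_ball_trans (h1 f fS m m16) _; rewrite /twist -diffvol_compA.
by apply: h2 => //; apply/allpairsP; exists (f, m).
Qed.

End small_perturbations.

(** * Grids of base points *)

Section bad_points.
Context (R : realType).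
Local Notation mplane := (measurableTypeR R * measurableTypeR R)%type.
Local Notation bundle := (torus R * mplane)%type.
Local Notation lam := (@lebesgue_measure R).
Local Notation lam2 := (lam \x lam)%E.
Implicit Types (L G : seq (DiffVol R)) (f g : DiffVol R) (y v : plane R) (z : bundle) (x : torus R)
  (l : nat * nat) (n k p : nat) (M X rho : R).

Lemma ler_Ex_word L G n (Phi Psi : DiffVol R -> R) :
  (forall f, f \in L -> exists a f', f' \in G /\ f = diffvol_comp (transl a) f') ->
  (forall g, word G n g -> Phi g <= Psi g) -> Ex L n Phi <= Ex L n Psi.
Proof.
move=> hL; elim: n Phi Psi => [|n IH] Phi Psi h /=; first exact/h/word0.
apply: ler_avg => f /hL[a [f' [f'G ->]]]; apply: IH => g wg.
exact/h/wordS.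
Qed.

Lemma sum_disjoint_le (I : eqType) (s : seq I) (F : I -> R) (c : R) : uniq s -> 0 <= c ->
  (forall i j, i \in s -> j \in s -> F i != 0 -> F j != 0 -> i = j) ->
  (forall i, i \in s -> F i <= c) -> \sum_(i <- s) F i <= c.
Proof.
move=> us c0 dj hc; case: (boolP (has (fun i => F i != 0) s)) => [/hasP[i is_ Fi]|/hasPn no].
  rewrite (bigD1_seq i)//= big_seq_cond big1 ?addr0; first exact: hc.
  move=> j /andP[js ji]; apply/eqP; apply: contraNT ji => Fj.
  by rewrite (dj j i).
by rewrite big_seq big1// => i /no; rewrite negbK => /eqP.
Qed.

Definition grid p : seq (nat * nat) := allpairs pair (iota 0 p) (iota 0 p).

Lemma mem_grid p l : (l \in grid p) = (l.1 < p)%N && (l.2 < p)%N.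
Proof.
apply/allpairsP/andP => [[[i j] [+ + ->]]|[l1 l2]].
  by rewrite !mem_iota !add0n.
by exists l; rewrite !mem_iota !add0n l1 l2; case: l {l1 l2}.
Qed.

Lemma grid_uniq p : uniq (grid p).
Proof. by apply: allpairs_uniq; rewrite ?iota_uniq// => -[a b] [c d]. Qed.

Definition gridpt k l : plane R := (l.1%:R / k%:R, l.2%:R / k%:R).

Definition gridcell k l : set mplane :=
  `[(gridpt k l).1, (gridpt k l).1 + k%:R^-1[ `*` `[(gridpt k l).2, (gridpt k l).2 + k%:R^-1[.

Lemma divn_succ (i k : nat) : i%:R / k%:R + k%:R^-1 = i.+1%:R / k%:R :> R.
Proof. by rewrite -natr1 mulrDl mul1r. Qed.

Lemma gridcell_inj k l l' (q : plane R) : (0 < k)%N -> gridcell k l q -> gridcell k l' q -> l = l'.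
Proof.
move=> k0; have k0' : 0 < k%:R :> R by rewrite ltr0n.
have one (i j : nat) (u : R) : i%:R / k%:R <= u -> u < j%:R / k%:R + k%:R^-1 -> (i <= j)%N.
  rewrite divn_succ => h1 h2; have := le_lt_trans h1 h2.
  by rewrite ltr_pM2r ?invr_gt0// ltr_nat.
move=> [/=]; rewrite !in_itv /= => /andP[a1 a2] /andP[b1 b2].
move=> [/=]; rewrite !in_itv /= => /andP[c1 c2] /andP[d1 d2].
case: l l' a1 a2 b1 b2 c1 c2 d1 d2 => [i j] [i' j'] /= a1 a2 b1 b2 c1 c2 d1 d2.
have ii : i = i' by apply/eqP; rewrite eqn_leq (one _ _ _ a1 c2) (one _ _ _ c1 a2).
have jj : j = j' by apply/eqP; rewrite eqn_leq (one _ _ _ b1 d2) (one _ _ _ d1 b2).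
by rewrite ii jj.
Qed.

Lemma gridcell_sub k p l : (0 < k)%N -> (p <= k)%N -> l \in grid p -> gridcell k l `<=` @cell R.
Proof.
move=> k0 pk; rewrite mem_grid => /andP[l1 l2]; have k0' : 0 < k%:R :> R by rewrite ltr0n.
have one (i : nat) (u : R) : (i < p)%N -> i%:R / k%:R <= u -> u < i%:R / k%:R + k%:R^-1 -> 0 <= u < 1.
  move=> ip h1 h2; apply/andP; split; first by apply: le_trans h1; rewrite divr_ge0.
  apply: lt_le_trans h2 _; rewrite divn_succ ler_pdivrMr// mul1r ler_nat.
  exact: leq_trans pk.
move=> q [/=]; rewrite !in_itv /= => /andP[a1 a2] /andP[b1 b2].
by split; rewrite /= in_itv /=; [apply: one a1 a2|apply: one b1 b2].
Qed.

Lemma gridcell_dist k l q : gridcell k l q -> `|(q : plane R) - gridpt k l| <= k%:R^-1.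
Proof.
move=> [/=]; rewrite !in_itv /= => /andP[a1 a2] /andP[b1 b2].
by rewrite prod_normE ge_max /= !itv_norm.
Qed.

Lemma bump_small M v (w : mplane) : 0 < M -> enorm (v : plane R) <= M^-1 / 2 -> v != 0 ->
  enorm (w : plane R) <= 2 * (M * enorm v) -> (w : plane R) != 0 -> bump_set w.
Proof.
move=> M0 vM v0 wv w0; have w1 : enorm (w : plane R) <= 1.
  apply: le_trans wv _; have := ler_wpM2l (ltW M0) vM.
  by rewrite (mulrA M M^-1) mulfV ?gt_eqF// mul1r; move: (M * _) => a; lra.
have h1 := le_trans (enorm_fst w) w1; have h2 := le_trans (enorm_snd w) w1.
split; first by split; rewrite /= in_itv /= -ler_norml.
move=> [/=]; rewrite !in_itv /= -!eq_le => /eqP e1 /eqP e2.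
by move/eqP: w0; apply; rewrite [w]surjective_pairing -e1 -e2.
Qed.

Definition bad L n M x : R := Ex L n (fun g => ((tnorm g x <= M)%R)%:R).

(** If [tnorm g x <= M], the derivative at the nearby point stretches by at most [2 M] and sends
    vectors of length at most [1 / (2 M)] into the unit ball, which lies in the box. *)
Lemma bad_le_contracted L G n M rho x t v :
  (forall f, f \in L -> exists a f', f' \in G /\ f = diffvol_comp (transl a) f') ->
  (forall g, word G n g -> forall x t, `|t| < rho ->
    forall u, enorm (tdiff g (transl t x) u) <= 2 * enorm (tdiff g x u)) ->
  0 < M -> `|t| < rho -> v != 0 -> enorm v <= M^-1 / 2 ->
  bad L n M x <= contracted L n (transl t x, v).
Proof.
move=> hL tame M0 tr v0 vM; apply: (ler_Ex_word hL) => g wg.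
case: (lerP (tnorm g x) M) => gM; last by rewrite indicE.
rewrite indicE mem_set//; apply: (bump_small M0 vM v0); last by rewrite /= tdiff_eq0.
apply: le_trans (tame g wg x t tr v) _; apply: ler_wpM2l => //.
by apply: le_trans (enorm_tdiff_le _ _ _) _; apply: ler_wpM2r => //; exact: enorm_ge0.
Qed.

(** Over the grid cell of [l] and for vectors in the fixed square [E], [contracted] is at least the
    value of [bad] at the grid point. The cells are disjoint of area [k^-2], so the energy bounds
    the sum of squares. *)
Lemma bad_grid_sum L G n k p M X rho y :
  (forall f, f \in L -> exists a f', f' \in G /\ f = diffvol_comp (transl a) f') ->
  (forall g, word G n g -> forall x t, `|t| < rho ->
    forall u, enorm (tdiff g (transl t x) u) <= 2 * enorm (tdiff g x u)) ->
  0 < M -> (0 < k)%N -> k%:R^-1 < rho -> (p <= k)%N ->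
  (energy (contracted L n) <= X%:E)%E ->
  \sum_(l <- grid p) bad L n M (tpi (y + gridpt k l)) ^+ 2 <= 64 * (k%:R ^+ 2 * M ^+ 2) * X.
Proof.
move=> hL tame M0 k0 kr pk en.
pose B l := transl (- y) @^-1` (@tpi R @` gridcell k l).
(* A vector of [E] has norm at most [4 c = 1 / (2 M)]; the area [c^2] of [E] accounts for the factor
   [64 * M^2]. *)
pose c := M^-1 / 8; have c0 : 0 < c by rewrite divr_gt0// invr_gt0.
pose E : set mplane := `[c, 2 * c] `*` `[c, 2 * c].
have mQ l : measurable (gridcell k l) by apply: measurableX; exact: measurable_itv.
have mB l : measurable (B l).
  have [mt _] := diffvol_preserves (transl (- y)).
  by rewrite -[X in measurable X]setTI; apply: mt => //; exact: (measurable_tpi_image (mQ l)).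
have mE : measurable E by apply: measurableX; exact: measurable_itv.
have vB l : l \in grid p -> vol (B l) = ((k%:R^-1) ^+ 2)%:E.
  move=> lp; have [_ vt] := diffvol_preserves (transl (- y)).
  rewrite vt; last exact: (measurable_tpi_image (mQ l)).
  rewrite vol_tpi_image; last exact: (gridcell_sub k0 pk lp).
  by rewrite lam2_boxo// invr_ge0.
have lE : lam2 E = (c ^+ 2)%:E.
  have c2 : c <= 2 * c by rewrite ler_peMl ?ler1n// ltW.
  by rewrite (lam2_box c2 c2); congr EFin; ring.
have ptw z : \sum_(l <- grid p) bad L n M (tpi (y + gridpt k l)) ^+ 2 * \1_(B l) z.1 * \1_E z.2
    <= contracted L n z ^+ 2.
  have memB l : \1_(B l) z.1 != 0 :> R -> exists2 q, gridcell k l q & z.1 = tpi (y + q).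
    rewrite indicE; case: (boolP (z.1 \in B l)); last by rewrite eqxx.
    rewrite inE => -[q Qq qz] _; exists q => //.
    by rewrite addrC -transl_tpi qz translD addNr -(tpi_repr z.1) transl_tpi addr0.
  apply: sum_disjoint_le; [exact: grid_uniq|exact: sqr_ge0| |].
    move=> l l' lp lp'; rewrite !mulf_eq0 !negb_or.
    move=> /andP[/andP[_ /memB[q Qq zq]] _] /andP[/andP[_ /memB[q' Qq' zq']] _].
    apply: (@gridcell_inj k l l' q) => //; suff <- : q' = q by [].
    apply: tpi_cell_inj; [exact: (gridcell_sub k0 pk lp' Qq')|exact: (gridcell_sub k0 pk lp Qq)|].
    have : tpi (y + q' + - y) = tpi (y + q + - y) by apply: tpiD; rewrite -zq -zq'.
    by rewrite ![y + _]addrC !addrK.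
  move=> l lp; case: (eqVneq (\1_(B l) z.1 : R) 0) => [->|B1].
    by rewrite mulr0 mul0r sqr_ge0.
  rewrite (indicE _ E); case: (boolP (z.2 \in E)) => zE; last by rewrite mulr0 sqr_ge0.
  have [q Qq zq] := memB l B1.
  have b0 : 0 <= bad L n M (tpi (y + gridpt k l)) by apply: Ex_ge0 => g; rewrite ler0n.
  rewrite mulr1; apply: (@le_trans _ _ (bad L n M (tpi (y + gridpt k l)) ^+ 2)).
    by rewrite ler_piMr ?sqr_ge0// indicE lern1 leq_b1.
  rewrite lerXn2r ?nnegrE ?contracted_ge0//.
  have zt : z = (transl (q - gridpt k l) (tpi (y + gridpt k l)), z.2).
    rewrite transl_tpi -addrA [_ + (q - _)]addrC subrK -zq.
    exact: surjective_pairing.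
  rewrite [in leRHS]zt.
  move: zE; rewrite inE => -[/=]; rewrite !in_itv /= => /andP[a1 a2] /andP[b1 b2].
  have key := @bad_le_contracted L G n M rho (tpi (y + gridpt k l)) (q - gridpt k l) z.2
    hL tame M0; apply: key.
  - exact: le_lt_trans (gridcell_dist Qq) kr.
  - by apply: contraTneq a1 => ->; rewrite -ltNge.
  - apply: le_trans (enorm_le _) _; rewrite !ger0_norm ?(le_trans (ltW c0))//.
    by move: a2 b2; rewrite /c; move: (M^-1) (z.2.1) (z.2.2) => m u w; clear; lra.
have := energy_ge (s := grid p) (measurable_contracted L n) mB mE ptw.
move=> /le_trans /(_ en).
rewrite [X in (X <= _)%E](_ : _ =
  (\sum_(l <- grid p) (bad L n M (tpi (y + gridpt k l)) ^+ 2 * ((k%:R^-1) ^+ 2 * c ^+ 2))%:E)%E); last first.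
  rewrite big_seq [RHS]big_seq; apply: eq_bigr => l lp.
  by rewrite vB// lE -!EFinM -mulrA.
rewrite sumEFin lee_fin -mulr_suml /c => h.
have k0' : k%:R != 0 :> R by rewrite pnatr_eq0 -lt0n.
rewrite -ler_pdivrMl; last by rewrite !mulr_gt0 ?ltr0n.
apply: le_trans h; rewrite mulrC le_eqVlt; apply/orP; left; apply/eqP; congr (_ * _).
by field; rewrite k0' gt_eqF.

Qed.

End bad_points.

(** * Matching of displaced grids and the resulting lower bound *)

Section coupling.
Context (R : realType).
Implicit Types (L G : seq (DiffVol R)) (f g : DiffVol R) (y v w d : plane R) (x : torus R)
  (l o : nat * nat) (n k p h : nat) (rho B : R).

Lemma Ex_affine L n (a c : R) (Phi : DiffVol R -> R) : (0 < size L)%N ->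
  Ex L n (fun g => a * Phi g + c) = a * Ex L n Phi + c.
Proof.
move=> L0; elim: n Phi => [//|n IH] Phi /=.
rewrite -avgZ -[c in RHS](avg_cst c L0) -avgD; apply: eq_avg => f.
exact: IH.
Qed.

Lemma ler_sum_subset (I : eqType) (s t : seq I) (F : I -> R) : uniq s -> uniq t ->
  {subset s <= t} -> (forall i, i \in t -> 0 <= F i) ->
  \sum_(i <- s) F i <= \sum_(i <- t) F i.
Proof.
move=> us ut st F0; rewrite [leRHS](bigID (mem s))/=.
have -> : \sum_(i <- t | i \in s) F i = \sum_(i <- s) F i.
  rewrite -big_filter; apply: perm_big; apply: uniq_perm => //; first exact: filter_uniq.
  by move=> i; rewrite mem_filter; case: (boolP (i \in s)) => //= /st ->.
rewrite lerDl big_seq_cond; apply: sumr_ge0 => i /andP[it _]; exact: F0.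
Qed.

Definition shift_idx o l : nat * nat := (l.1 + o.1, l.2 + o.2)%N.

Lemma sum_grid_shift n p o (F : nat * nat -> R) : (p + o.1 <= n)%N -> (p + o.2 <= n)%N ->
  (forall l, l \in grid n -> 0 <= F l) ->
  \sum_(l <- grid p) F (shift_idx o l) <= \sum_(l <- grid n) F l.
Proof.
move=> o1 o2 F0; rewrite -(big_map (shift_idx o) predT F).
apply: ler_sum_subset => //; [|exact: grid_uniq|].
  rewrite map_inj_uniq ?grid_uniq// => -[a b] [a' b'] [/addIn -> /addIn ->]//.
move=> _ /mapP[l + ->]; rewrite !mem_grid /= => /andP[l1 l2].
by rewrite (leq_trans _ o1) ?ltn_add2r// (leq_trans _ o2) ?ltn_add2r.
Qed.

(** The offset is [h - floor (d k)]: adding [h] makes it a natural number, at most [2 h]. *)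
Lemma floor_offset k h (d : R) : (0 < k)%N -> `|d| * k%:R <= h%:R ->
  exists2 o : nat, (o <= h.*2)%N & `|h%:R / k%:R - (d + o%:R / k%:R)| <= k%:R^-1.
Proof.
move=> k0 dk; have k0' : 0 < k%:R :> R by rewrite ltr0n.
set z := d * k%:R; have /andP[z1 z2] := floor_itv z; rewrite intrD1 in z2.
have zh : `|z| <= h%:R by rewrite normrM (ger0_norm (ltW k0')).
move: zh; rewrite ler_norml => /andP[zh1 zh2].
have a1 : (Num.floor z <= h%:Z)%R by rewrite -(ler_int R); exact: le_trans z1 zh2.
have a2 : (- h%:Z <= Num.floor z)%R.
  by rewrite floor_ge_int rmorphN.
exists `|h%:Z - Num.floor z|%N; first by lia.
have -> : `|h%:Z - Num.floor z|%N%:R = h%:R - (Num.floor z)%:~R :> R.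
  rewrite -[LHS](_ : (`|h%:Z - Num.floor z|%N%:Z)%:~R = _)//.
  by rewrite gez0_abs ?subr_ge0// rmorphB.
have -> : h%:R / k%:R - (d + (h%:R - (Num.floor z)%:~R) / k%:R) =
    - (z - (Num.floor z)%:~R) / k%:R by rewrite /z; field; rewrite gt_eqF.
rewrite normrM normrN normfV (gtr0_norm k0') ler_piMl ?invr_ge0 ?(ltW k0')//.
rewrite ger0_norm ?subr_ge0//; lra.
Qed.

(* Up to an error of norm at most [k^-1], the point [y + d + l / k] is the grid point of
   index [l + floor (k d)] based at [y]; all these index sets contain one box that does
   not depend on [d]. The constant [B] makes the terms nonnegative, so that those
   outside the box can be dropped. *)
Lemma coupled_sum L G N n p h k rho B y d w :
  (forall f, f \in L -> exists a f', f' \in G /\ f = diffvol_comp (transl a) f') ->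
  (forall g, word G N g -> forall x t, `|t| < rho ->
    forall u, enorm (tdiff g (transl t x) u) <= 2 * enorm (tdiff g x u)) ->
  (0 < size L)%N -> (0 < k)%N -> k%:R^-1 < rho -> (p + h.*2 <= n)%N -> w != 0 ->
  (forall g, word G N g -> forall x, - B <= ln (enorm (tdiff g x w))) ->
  `|d| * k%:R <= h%:R ->
  \sum_(m <- grid p) (Ex L N (fun g =>
      ln (enorm (tdiff g (tpi (y + gridpt R k (h, h) + gridpt R k m)) w))) + B - ln 2) <=
  \sum_(l <- grid n) (Ex L N (fun g =>
      ln (enorm (tdiff g (transl (gridpt R k l) (tpi (y + d))) w))) + B).
Proof.
move=> hL tame L0 k0 kr pn w0 hB dk.
have d1 : `|d.1| * k%:R <= h%:R.
  by apply: le_trans dk; rewrite ler_wpM2r// prod_normE le_max lexx.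
have d2 : `|d.2| * k%:R <= h%:R.
  by apply: le_trans dk; rewrite ler_wpM2r// prod_normE le_max lexx orbT.
have [i1 o1h e1] := floor_offset k0 d1; have [i2 o2h e2] := floor_offset k0 d2.
pose o := (i1, i2).
have lowerB (l : nat * nat) : 0 <= Ex L N (fun g =>
    ln (enorm (tdiff g (transl (gridpt R k l) (tpi (y + d))) w))) + B.
  rewrite -lerBlDr sub0r -[leLHS](addr0 (- B)) -[0](mul0r (Ex L N (fun=> 0))) addrC -Ex_affine//.
  by apply: (ler_Ex_word hL) => g wg; rewrite mul0r add0r; exact: hB.
have p1 : (p + o.1 <= n)%N by apply: leq_trans pn; rewrite leq_add2l.
have p2 : (p + o.2 <= n)%N by apply: leq_trans pn; rewrite leq_add2l.
apply: le_trans (sum_grid_shift p1 p2 (fun l _ => lowerB l)).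
apply: ler_sum => m _; rewrite addrAC lerD2r.
rewrite -[X in X - ln 2]mul1r -Ex_affine//; apply: (ler_Ex_word hL) => g wg.
rewrite mul1r lerBlDr -lnM ?posrE ?enorm_tdiff_gt0// mulrC.
rewrite ler_ln ?posrE ?mulr_gt0 ?enorm_tdiff_gt0//.
set q := gridpt R k (h, h) - (d + gridpt R k o).
have -> : tpi (y + gridpt R k (h, h) + gridpt R k m) =
    transl q (transl (gridpt R k (shift_idx o m)) (tpi (y + d))).
  rewrite !transl_tpi; congr tpi; rewrite /q /gridpt /=.
  by case: (y) (d) => [a b] [a' b']; congr (_, _) => /=; rewrite natrD mulrDl; ring.
apply: tame => //; apply: le_lt_trans kr.
by rewrite prod_normE ge_max; apply/andP; split.
Qed.

End coupling.

Section grid_average.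
Context (R : realType).
Implicit Types (L G J : seq (DiffVol R)) (f g : DiffVol R) (y v w d : plane R) (x : torus R)
  (l o : nat * nat) (n k p h : nat) (rho B M C : R).

Lemma avg_sum (I T : Type) (s : seq I) (t : seq T) (F : T -> I -> R) :
  avg t (fun u => \sum_(i <- s) F u i) = \sum_(i <- s) avg t (F^~ i).
Proof. by rewrite /avg exchange_big /= mulr_sumr. Qed.

Lemma size_grid n : size (grid n) = (n * n)%N.
Proof. by rewrite size_allpairs !size_iota. Qed.

Lemma sum_grid n (F : nat * nat -> R) : (0 < n)%N ->
  \sum_(l <- grid n) F l = n%:R ^+ 2 * avg (grid n) F.
Proof.
move=> n0; have n0' : n%:R != 0 :> R by rewrite pnatr_eq0 -lt0n.
by rewrite /avg size_grid natrM mulrA -expr2 mulfV ?mul1r// expf_neq0.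
Qed.

Lemma sum_grid_cst n (a : R) : \sum_(l <- grid n) a = n%:R ^+ 2 * a.
Proof. by rewrite big_const_seq count_predT size_grid iter_addr addr0 -(mulr_natl a) natrM. Qed.

(** Words of norm above [M] contribute [ln M / 2 - C] by the choice of the twists; the others still
    contribute [- C], as norms are at least 1. *)
Lemma bad_growth L G N M C J (z : torus R) (u : DiffVol R -> plane R) :
  (forall f, f \in L -> exists a f', f' \in G /\ f = diffvol_comp (transl a) f') ->
  (0 < size L)%N -> 1 <= M ->
  (forall g, ln (tnorm g z) / 2 - C <= avg J (fun f => ln (enorm (tdiff g z (u f))))) ->
  ln M / 2 * (1 - bad L N M z) - C <=
  avg J (fun f => Ex L N (fun g => ln (enorm (tdiff g z (u f))))).
Proof.
move=> hL L0 M1 hJ; rewrite -Ex_avg.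
have -> : ln M / 2 * (1 - bad L N M z) - C =
    (- (ln M / 2)) * bad L N M z + (ln M / 2 - C) by ring.
rewrite /bad -Ex_affine//; apply: (ler_Ex_word hL) => g _.
apply: le_trans (hJ g); have T1 := tnorm_ge1 g z; have a0 := ln_ge0 T1.
case: (lerP (tnorm g z) M) => gM /=.
  by rewrite mulr1; move: (ln M / 2) (ln (tnorm g z)) a0 => a b b0; lra.
have : ln M <= ln (tnorm g z).
  by rewrite ler_ln ?posrE ?(lt_le_trans ltr01)// ltW.
by rewrite mulr0; move: (ln M) (ln (tnorm g z)) => a b; lra.
Qed.

(** On the inner grid the average of [bad] is at most [1 / 4], which turns the coefficient [1 / 2]
    of [ln M] into [3 / 8]. The term [ln 2] pays for moving each point to its partner in the
    matching. *)
Lemma grid_average_ge L G J N n p h k rho B M C y w :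
  (forall f, f \in L -> exists a f', f' \in G /\ f = diffvol_comp (transl a) f') ->
  (forall g, word G N g -> forall x t, `|t| < rho ->
    forall u, enorm (tdiff g (transl t x) u) <= 2 * enorm (tdiff g x u)) ->
  (0 < size L)%N -> (0 < size J)%N -> (0 < k)%N -> (0 < n)%N -> k%:R^-1 < rho ->
  (p + h.*2 <= n)%N -> w != 0 -> 1 <= M ->
  (forall f, f \in J -> forall g, word G N g -> forall x,
     - B <= ln (enorm (tdiff g x (tdiff f (tpi y) w)))) ->
  (forall f, f \in J -> exists2 d : plane R, `|d| * k%:R <= h%:R & f (tpi y) = tpi (y + d)) ->
  (forall g z, ln (tnorm g z) / 2 - C <=
     avg J (fun f => ln (enorm (tdiff g z (tdiff f (tpi y) w))))) ->
  \sum_(m <- grid p) bad L N M (tpi (y + gridpt R k (h, h) + gridpt R k m)) <= p%:R ^+ 2 / 4 ->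
  p%:R ^+ 2 * (3 / 8 * ln M - C + B - ln 2) <=
  n%:R ^+ 2 * (avg (grid n) (fun l => avg J (fun f => Ex L N (fun g =>
    ln (enorm (tdiff g (transl (gridpt R k l) (f (tpi y))) (tdiff f (tpi y) w)))))) + B).
Proof.
move=> hL tame L0 J0 k0 n0 kr pn w0 M1 hB hd hJ hbad.
pose z m := tpi (y + gridpt R k (h, h) + gridpt R k m).
pose F f m := Ex L N (fun g => ln (enorm (tdiff g (z m) (tdiff f (tpi y) w)))).
pose T f l := Ex L N (fun g =>
  ln (enorm (tdiff g (transl (gridpt R k l) (f (tpi y))) (tdiff f (tpi y) w)))).
have cpl : avg J (fun f => \sum_(m <- grid p) (F f m + B - ln 2)) <=
    avg J (fun f => \sum_(l <- grid n) (T f l + B)).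
  apply: ler_avg => f fJ; have [d dk fy] := hd f fJ.
  have w1 : tdiff f (tpi y) w != 0 by rewrite tdiff_eq0.
  rewrite /T fy; exact: (@coupled_sum R L G N n p h k rho B y d (tdiff f (tpi y) w)
    hL tame L0 k0 kr pn w1 (hB f fJ) dk).
rewrite !avg_sum in cpl.
have avgB (s : seq (DiffVol R)) (Q : DiffVol R -> R) a : (0 < size s)%N ->
    avg s (fun f => Q f + a) = avg s Q + a.
  by move=> s0; rewrite avgD avg_cst.
have -> : n%:R ^+ 2 * (avg (grid n) (fun l => avg J (fun f => T f l)) + B) =
    \sum_(l <- grid n) avg J (fun f => T f l + B).
  rewrite mulrDr -sum_grid// -sum_grid_cst -big_split /=.
  by apply: eq_bigr => l _; rewrite avgB.
apply: le_trans cpl.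
apply: (@le_trans _ _ (\sum_(m <- grid p) (ln M / 2 - C + B - ln 2 - ln M / 2 * bad L N M (z m)))).
  rewrite sumrB sum_grid_cst -mulr_sumr.
  have M0 : 0 <= ln M / 2 by rewrite divr_ge0// ln_ge0.
  have := ler_wpM2l M0 hbad.
  by move: (ln M) (\sum_(_ <- _) _) (p%:R ^+ 2) (ln 2) => a b q l; lra.
apply: ler_sum => m _.
have key : ln M / 2 * (1 - bad L N M (z m)) - C <= avg J (fun f => F f m).
  exact: (@bad_growth L G N M C J (z m) (fun f => tdiff f (tpi y) w) hL L0 M1 (fun g => hJ g (z m))).
rewrite [leRHS](_ : _ = avg J (fun f => F f m) + (B - ln 2)); last first.
  by rewrite -avgB//; apply: eq_avg => f; rewrite addrA.
by move: key; move: (avg J _) (bad _ _ _ _) (ln M) (ln 2) => a b q l; clear; lra.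
Qed.

(** Here [q] is the proportion of the inner grid, and [d * B] the price of the border; [1 / 4] is
    [2 / 3 * 3 / 8]. *)
Lemma ratio_bound (a B C q d t : R) : 0 <= a -> 0 <= B -> 0 <= C -> 1 - d <= q -> q <= 1 ->
  d <= 1 / 3 -> q * (3 / 8 * a - C + B) <= t + B -> a / 4 - d * B - C <= t.
Proof.
move=> a0 B0 C0 q0 q1 d1 h.
have h1 : (1 - d) * B <= q * B by exact: ler_wpM2r.
have h2 : q * C <= 1 * C by exact: ler_wpM2r.
have h3 : 2 / 3 * a <= q * a by apply: ler_wpM2r => //; lra.
lra.
Qed.

End grid_average.

(** * Choice of the parameters and conclusion *)

Section parameters.
Context (R : realType).
Implicit Types (L G J : seq (DiffVol R)) (f g : DiffVol R) (y v w a : plane R) (x : torus R)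
  (n k p h D N : nat) (c lc d Q C M alpha : R).

Lemma ge_natr (z : R) : exists N, z <= N%:R.
Proof.
exists (Num.bound `|z|); apply: le_trans (ler_norm z) _.
by apply/ltW; exact: archi_boundP.
Qed.

Lemma choose_ratio lc c : 0 < c ->
  exists D, (10 <= D)%N /\ 4 / (D.+2)%:R * lc <= c / 16.
Proof.
move=> c0; have [D hD] := ge_natr (64 * lc / c).
exists (D + 10)%N; split; first by rewrite leq_addl.
have D0 : 0 < (D + 10).+2%:R :> R by rewrite ltr0n.
rewrite mulrAC ler_pdivrMr//; rewrite ler_pdivrMr// in hD.
have : D%:R * c <= (D + 10).+2%:R * c by rewrite ler_pM2r// ler_nat; lia.
by move: (D%:R) ((D + 10).+2%:R) hD => u z; lra.
Qed.

Lemma ratio_sqr D h : (0 < h)%N -> (10 <= D)%N ->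
  let q : R := ((D * h)%:R / (D.+2 * h)%:R) ^+ 2 in
  [/\ 1 - 4 / (D.+2)%:R <= q, q <= 1 & 0 <= (4 / (D.+2)%:R : R) <= 1 / 3].
Proof.
move=> h0 D10 q; have h0' : h%:R != 0 :> R by rewrite pnatr_eq0 -lt0n.
have D0 : 0 < (D.+2)%:R :> R by rewrite ltr0n.
have D12 : 12 <= (D.+2)%:R :> R by rewrite ler_nat; lia.
pose u : R := (D.+2)%:R^-1; have u0 : 0 < u by rewrite invr_gt0.
have u1 : u <= 1 / 12 by rewrite /u -div1r ler_pdivrMr//; lra.
have -> : q = (1 - 2 * u) ^+ 2.
  have DE : D%:R = (D.+2)%:R - 2 :> R by rewrite -addn2 natrD addrK.
  by rewrite /q !natrM /u DE; congr (_ ^+ 2); field; rewrite h0' gt_eqF.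
rewrite -/u; have u2 := sqr_ge0 u; have u3 : u ^+ 2 <= u by rewrite expr2 ler_piMl ?(ltW u0)//; lra.
by split; [lra|lra|apply/andP; split; lra].
Qed.

Lemma ln2_le1 : ln 2 <= 1 :> R.
Proof. by rewrite -[leRHS]expRK ler_ln ?posrE ?expR_gt0//; have := expR_ge1Dx (1 : R); lra. Qed.

(** The gain [c / 4] per letter exceeds the border loss [d * lc] per letter, so a long word
    outweighs every constant. The second condition, on [Q], serves to make bad grid points rare. *)
Lemma choose_length c lc d C Q : 0 < c -> 0 <= C -> d * lc <= c / 16 -> 0 <= d <= 1 / 3 ->
  exists N, 2 + C < c * N%:R / 4 - d * (N%:R * lc + ln 2) /\ 4096 * Q ^+ 2 <= 1 + 2 * (c * N%:R).
Proof.
move=> c0 C0 dl /andP[d0 d1]; have [N1 h1] := ge_natr (8 * (C + 4) / c).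
have [N2 h2] := ge_natr (2048 * Q ^+ 2 / c).
exists (N1 + N2)%N; set N := (N1 + N2)%:R.
rewrite !ler_pdivrMr// in h1 h2.
have e1 : N1%:R * c <= c * N by rewrite mulrC ler_pM2l// ler_nat leq_addr.
have e2 : N2%:R * c <= c * N by rewrite mulrC ler_pM2l// ler_nat leq_addl.
have N0 : 0 <= N by exact: ler0n.
have := ler_wpM2l N0 dl; have := ler_pM d0 (ln_ge0 (ler1n R 2)) d1 ln2_le1.
move: (N1%:R * c) (N2%:R * c) h1 h2 e1 e2 => u1 u2 h1 h2 e1 e2.
move: (ln 2) => l2; move: (N) N0 e1 e2 => z N0 e1 e2 g1 g2.
have -> : d * (z * lc + l2) = z * (d * lc) + d * l2 by ring.
by split; lra.
Qed.

(** A grid of [n] steps of length [1 / k] must have extent almost [alpha], whatever [n]; this keeps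
    the ratio of [k] to [n] bounded. *)
Lemma choose_mesh alpha n : 0 < alpha <= 1 -> (0 < n)%N ->
  exists k, [/\ (n <= k)%N, n%:R < alpha * k%:R & alpha * k%:R <= n%:R + alpha].
Proof.
move=> /andP[a0 a1] n0; pose z := n%:R / alpha.
have z0 : 0 <= z by rewrite divr_ge0// ltW.
have /andP[t1 t2] := truncn_itv z0; exists (Num.truncn z).+1.
have zE : alpha * z = n%:R by rewrite /z mulrC divfK// gt_eqF.
have nz : n%:R <= z by rewrite ler_pdivlMr// ler_piMr.
split.
- by rewrite -(ler_nat R); exact: le_trans nz (ltW t2).
- by rewrite -zE ltr_pM2l.
- by rewrite -natr1 mulrDr mulr1 -zE lerD2r ler_pM2l.
Qed.

Lemma kick_rate (e : R) : 0 < e <= 1 / (5 * 1000 * 1000) ->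
  exists2 c, 0 < c & 1 - e ^+ 2 / 160 = expR (- (2 * c)).
Proof.
move=> /andP[e0 e1]; have e1' : e <= 1 by lra.
have r0 : 0 < 1 - e ^+ 2 / 160 by have := exprn_ile1 2 (ltW e0) e1'; lra.
have r1 : 1 - e ^+ 2 / 160 < 1 by have := exprn_gt0 2 e0; lra.
exists (- ln (1 - e ^+ 2 / 160) / 2).
  by rewrite divr_gt0// oppr_gt0 ln_lt0// r0.
by rewrite (_ : - (2 * (- ln (1 - e ^+ 2 / 160) / 2)) = ln (1 - e ^+ 2 / 160)) ?lnK ?posrE//; field.
Qed.

Lemma bad_average L N M p (z : nat * nat -> torus R) : (0 < p)%N ->
  \sum_(l <- grid p) bad L N M (z l) ^+ 2 <= p%:R ^+ 2 / 16 ->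
  \sum_(l <- grid p) bad L N M (z l) <= p%:R ^+ 2 / 4.
Proof.
move=> p0 h; rewrite sum_grid// in h; rewrite sum_grid//.
have p2 : 0 < p%:R ^+ 2 :> R by rewrite exprn_gt0// ltr0n.
rewrite ler_pM2l// in h; rewrite ler_pM2l//.
have g0 : (0 < size (grid p))%N by rewrite size_grid muln_gt0 p0.
have b0 l : 0 <= bad L N M (z l) by apply: Ex_ge0 => g; rewrite ler0n.
have := @avg_sqr R _ (grid p) (fun=> 1) (fun l => bad L N M (z l)) (fun l => bad L N M (z l) ^+ 2).
rewrite avg_cst// mul1r => cs.
rewrite -(ler_pXn2r (n := 2)) ?nnegrE ?avg_ge0 ?invr_ge0//.
apply: le_trans (cs _) _; last by apply: le_trans h _; rewrite expr2 -invfM -natrM.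
by move=> l _; rewrite mul1r sqr_ge0 ler01.
Qed.

(** With [u = c N], the factor [M^2 X] equals [4 exp (- 2 u)], while
    [exp (2 u) >= 1 + 2 u >= 4096 Q^2] and [4096 = 64 * 4 * 16]. *)
Lemma growth_bound c Q (k p X M N : R) : 0 <= p -> 0 <= k -> k <= Q * p ->
  0 < 1 + 2 * (c * N) -> 4096 * Q ^+ 2 <= 1 + 2 * (c * N) ->
  M = expR (c * N) -> X = expR (- (4 * (c * N))) * 4 ->
  64 * (k ^+ 2 * M ^+ 2) * X <= p ^+ 2 / 16.
Proof.
move=> p0 k0 kp N0 hN -> ->; set u := c * N in hN N0 *.
have ku : k ^+ 2 <= Q ^+ 2 * p ^+ 2.
  by rewrite -exprMn lerXn2r// nnegrE// (le_trans k0 kp).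
have E : expR u ^+ 2 * expR (- (4 * u)) = (expR (2 * u))^-1.
  by rewrite -expRN expr2 -!expRD; congr expR; ring.
have -> : 64 * (k ^+ 2 * expR u ^+ 2) * (expR (- (4 * u)) * 4) =
  256 * k ^+ 2 * (expR u ^+ 2 * expR (- (4 * u))) by ring.
rewrite E ler_pdivrMr ?expR_gt0//.
have e1 : 4096 * Q ^+ 2 <= expR (2 * u) by exact: le_trans hN (expR_ge1Dx _).
have := ler_wpM2r (sqr_ge0 p) e1.
by move: (k ^+ 2) (Q ^+ 2) (p ^+ 2) (expR _) ku => a b q s; lra.
Qed.

Lemma word_ln_lower G C N w : 1 <= C -> (forall f, f \in G -> forall x, tnorm f x <= C) ->
  1 <= 2 * enorm w -> forall g, word G N g -> forall x,
  - (N%:R * ln C + ln 2) <= ln (enorm (tdiff g x w)).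
Proof.
move=> C1 hC w1 g wg x; have [_ h] := word_bounded C1 hC wg x w.
have C0 : 0 < C by exact: lt_le_trans C1.
have CN : 0 < C ^+ N by rewrite exprn_gt0.
have u0 : 0 < enorm (tdiff g x w).
  by rewrite -(pmulr_rgt0 _ CN); apply: lt_le_trans h; lra.
have -> : N%:R * ln C + ln 2 = ln (C ^+ N * 2) by rewrite lnM ?posrE// lnXn// mulr_natl.
rewrite -lnV ?posrE ?mulr_gt0// ler_ln ?posrE ?invr_gt0 ?mulr_gt0//.
rewrite -div1r ler_pdivrMr ?mulr_gt0//.
rewrite [leRHS](_ : _ = 2 * (C ^+ N * enorm (tdiff g x w))); last by ring.
by move: h w1; move: (C ^+ N * _) (enorm w) => q s; clear; lra.
Qed.

End parameters.

Section expansion.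
Context (R : realType).
Implicit Types (L G J : seq (DiffVol R)) (f g : DiffVol R) (y v w a : plane R) (x z : torus R)
  (n k p h D N : nat) (c d B C M X rho e : R).

Definition translates (A : seq (plane R)) J : seq (DiffVol R) :=
  allpairs (fun a f => diffvol_comp (transl a) f) A J.

Lemma avg_steps (A : seq (plane R)) J e f0 (F : DiffVol R -> R) :
  avg (steps (translates A J) e f0) F = avg (kicks e) (fun t => avg A (fun a => avg J (fun f =>
    F (diffvol_comp (diffvol_comp (transl a) f) (diffvol_comp (kick t) f0))))).
Proof.
rewrite [LHS]avg_allpairs avg_exchange; apply: eq_avg => t.
by rewrite [LHS]avg_allpairs.
Qed.

Lemma tdiff_steps g a f f1 x v :
  tdiff (diffvol_comp g (diffvol_comp (diffvol_comp (transl a) f) f1)) x v =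
  tdiff g (transl a (f (f1 x))) (tdiff f (f1 x) (tdiff f1 x v)).
Proof.
move: (transl a) (@tdiff_transl R a) => h hE.
rewrite (tdiff_compE g) (tdiff_compE (diffvol_comp h f)) (tdiff_compE h) hE.
by rewrite !diffvol_compE.
Qed.

Lemma ln_tdiff_scale g f z z' (s : R) w : 0 < s -> w != 0 ->
  ln (enorm (tdiff g z (tdiff f z' (s *: w)))) = 1 * ln (enorm (tdiff g z (tdiff f z' w))) + ln s.
Proof.
move=> s0 w0; rewrite !tdiffZ enormZ (gtr0_norm s0) lnM ?posrE//.
  by rewrite mul1r addrC.
by rewrite enorm_tdiff_gt0// tdiff_eq0.
Qed.

Lemma step_expansion L G N n p h k rho M X e1 e2 e B C d f1 (C1 : R) :
  (forall f, f \in L -> exists a f', f' \in G /\ f = diffvol_comp (transl a) f') ->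
  (forall g, word G N g -> forall x t, `|t| < rho ->
    forall u, enorm (tdiff g (transl t x) u) <= 2 * enorm (tdiff g x u)) ->
  (0 < size L)%N -> (0 < k)%N -> (0 < n)%N -> (0 < p)%N -> k%:R^-1 < rho ->
  (p + h.*2 <= n)%N -> (p <= k)%N -> 1 <= M ->
  (energy (contracted L N) <= X%:E)%E -> 64 * (k%:R ^+ 2 * M ^+ 2) * X <= p%:R ^+ 2 / 16 ->
  0 < e1 <= 1 / 2000 -> 0 < e2 <= 1 / 2000 -> 0 < e1 <= e -> 0 < e2 <= e ->
  272 * e * k%:R <= h%:R ->
  (forall w, 1 <= 2 * enorm w -> forall g, word G N g -> forall x,
     - B <= ln (enorm (tdiff g x w))) ->
  (forall g z x w, enorm w = 1 -> ln (tnorm g z) / 2 - C <=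
     avg (twists e1 e2) (fun f => ln (enorm (tdiff g z (tdiff f x w))))) ->
  0 <= B -> 1 - d <= (p%:R / n%:R) ^+ 2 -> (p%:R / n%:R : R) ^+ 2 <= 1 -> d <= 1 / 3 ->
  1 <= C1 -> (forall x, tnorm f1 x <= C1) ->
  forall x v, enorm v = 1 ->
  ln M / 4 - d * B - (`|C| + ln 2) - ln C1 <=
  avg [seq gridpt R k l | l <- grid n] (fun a => avg (twists e1 e2) (fun f => Ex L N (fun g =>
    ln (enorm (tdiff (diffvol_comp g (diffvol_comp (diffvol_comp (transl a) f) f1)) x v))))).
Proof.
move=> hL tame L0 k0 n0 p0 kr pn pk M1 en hX he1 he2 h1 h2 hk hB hC B0 q0 q1 d1 C11 hC1 x v v1.
have J0 : (0 < size (twists e1 e2))%N by rewrite size_allpairs.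
have g0 : (0 < size (grid n))%N by rewrite size_grid muln_gt0 n0.
have v0 : v != 0 by apply: contraPneq v1 => ->; rewrite enorm0 => /esym/eqP; rewrite oner_eq0.
pose s := enorm (tdiff f1 x v); have s0 : 0 < s by exact: enorm_tdiff_gt0.
pose w := s^-1 *: tdiff f1 x v.
have vw : tdiff f1 x v = s *: w by rewrite scalerA mulfV ?gt_eqF// scale1r.
have w1 : enorm w = 1 by rewrite enormZ gtr0_norm ?invr_gt0// mulVf// gt_eqF.
have w0 : w != 0 by apply: contraPneq w1 => ->; rewrite enorm0 => /esym/eqP; rewrite oner_eq0.
have lns : - ln C1 <= ln s.
  have C10 : 0 < C1 by exact: lt_le_trans C11.
  rewrite -lnV ?posrE// ler_ln ?posrE ?invr_gt0// -div1r ler_pdivrMr// mulrC -v1.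
  by apply: le_trans (enorm_tdiff_ge f1 x v) _; rewrite ler_pM2r.
have [y fy] : exists y, f1 x = tpi y by exists (repr (f1 x)); rewrite tpi_repr.
pose T f l := Ex L N (fun g =>
  ln (enorm (tdiff g (transl (gridpt R k l) (f (tpi y))) (tdiff f (tpi y) w)))).
have -> : avg [seq gridpt R k l | l <- grid n] (fun a => avg (twists e1 e2) (fun f => Ex L N (fun g =>
    ln (enorm (tdiff (diffvol_comp g (diffvol_comp (diffvol_comp (transl a) f) f1)) x v))))) =
    avg (grid n) (fun l => avg (twists e1 e2) (fun f => T f l)) + ln s.
  rewrite avg_map -[ln s in RHS](avg_cst (ln s) g0) -avgD; apply: eq_avg => l.
  rewrite -[ln s in RHS](avg_cst (ln s) J0) -avgD; apply: eq_avg => f.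
  rewrite -[X in _ = X + _]mul1r -Ex_affine//; apply: eq_Ex => g.
  rewrite tdiff_steps vw fy; exact: (ln_tdiff_scale g f _ _ s0 w0).
suff : ln M / 4 - d * B - (`|C| + ln 2) <= avg (grid n) (fun l => avg (twists e1 e2) (fun f => T f l)).
  by move: (ln M) (avg _ _) (ln C1) (ln s) (ln 2) lns => a b l u r; clear; lra.
have hJ g z : ln (tnorm g z) / 2 - `|C| <=
    avg (twists e1 e2) (fun f => ln (enorm (tdiff g z (tdiff f (tpi y) w)))).
  by apply: le_trans (hC g z (tpi y) w w1); rewrite lerD2l lerN2 ler_norm.
have hBJ f : f \in twists e1 e2 -> forall g, word G N g -> forall x,
    - B <= ln (enorm (tdiff g x (tdiff f (tpi y) w))).
  move=> /allpairsP[[m m'] [mi ni ->]]; apply: hB.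
  move: (mi) (ni); rewrite !mem_iota !add0n => m16 n16.
  by have [_] := twist_bounds (tpi y) w he1 he2 m16 n16; rewrite w1.
have hd f : f \in twists e1 e2 -> exists2 t : plane R, `|t| * k%:R <= h%:R & f (tpi y) = tpi (y + t).
  move=> /allpairsP[[m m'] [mi ni ->]].
  move: (mi) (ni); rewrite !mem_iota !add0n => m16 n16.
  have [t ht ->] := twist_displacement y h1 h2 m16 n16.
  by exists t => //; apply: le_trans hk; rewrite ler_wpM2r.
have hbad : \sum_(m <- grid p) bad L N M (tpi (y + gridpt R k (h, h) + gridpt R k m)) <= p%:R ^+ 2 / 4.
  apply: bad_average => //; apply: le_trans hX.
  exact: (bad_grid_sum (y + gridpt R k (h, h)) hL tame (lt_le_trans ltr01 M1) k0 kr pk en).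
have key := grid_average_ge hL tame L0 J0 k0 n0 kr pn w0 M1 hBJ hd hJ hbad.
have ln20 : 0 <= ln 2 :> R by rewrite ln_ge0// ler1n.
apply: (ratio_bound (ln_ge0 M1) B0 _ q0 q1 d1); first by rewrite addr_ge0.
have n2 : 0 < n%:R ^+ 2 :> R by rewrite exprn_gt0// ltr0n.
rewrite expr_div_n mulrAC ler_pdivrMr// [leRHS]mulrC; apply: le_trans key.
by rewrite le_eqVlt; apply/orP; left; apply/eqP; ring.
Qed.

End expansion.

Section expanding_steps.
Context (R : realType).
Implicit Types (f g : DiffVol R) (v a : plane R) (x : torus R).

Lemma tnorm_comp_le g f x (K : R) : 0 <= K ->
  (forall v, enorm (tdiff g (f x) v) <= K * enorm v) -> tnorm (diffvol_comp g f) x <= K * tnorm f x.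
Proof.
move=> K0 h; rewrite -(ler_pXn2r (n := 2)) ?nnegrE ?tnorm_ge0 ?mulr_ge0 ?tnorm_ge0//.
have sq v : enorm (tdiff (diffvol_comp g f) x v) ^+ 2 <= K ^+ 2 * enorm (tdiff f x v) ^+ 2.
  have K1 : 0 <= K * enorm (tdiff f x v) by rewrite mulr_ge0 ?enorm_ge0.
  by rewrite tdiff_compE -exprMn lerXn2r ?nnegrE ?enorm_ge0.
by rewrite exprMn [leLHS]sqr_tnorm [in leRHS]sqr_tnorm mulrDr; apply: lerD; exact: sq.
Qed.

Lemma mem_translates_steps (A : seq (plane R)) (J : seq (DiffVol R)) e f0 f :
  f \in steps (translates A J) e f0 -> exists a t g,
  [/\ a \in A, t \in kicks e, g \in J &
   f = diffvol_comp (transl a) (diffvol_comp g (diffvol_comp (kick t) f0))].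
Proof.
move=> /allpairsP[[g' t] [/allpairsP[[a g] [aA gJ ->]] tk ->]].
exists a, t, g; split => //; exact: (esym (diffvol_compA _ _ _)).
Qed.

Lemma gridpt_small k n (l : nat * nat) (alpha : R) : (0 < k)%N -> n%:R < alpha * k%:R ->
  l \in grid n -> enorm (gridpt R k l) < 2 * alpha.
Proof.
move=> k0 nk; rewrite mem_grid => /andP[l1 l2]; have k0' : 0 < k%:R :> R by rewrite ltr0n.
have one (i : nat) : (i < n)%N -> `|i%:R / k%:R| < alpha.
  move=> ni; rewrite ger0_norm ?divr_ge0// ltr_pdivrMr//; apply: le_lt_trans nk.
  by rewrite ler_nat ltnW.
apply: le_lt_trans (enorm_le _) _; rewrite mulr_natl mulr2n.
by apply: ltrD; exact: one.
Qed.

Lemma mesh_ratio (alpha n p k : R) : 0 < alpha -> alpha * k <= n + alpha ->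
  n <= 2 * p -> 1 <= p -> k <= (2 / alpha + 1) * p.
Proof.
move=> a0 ak np p1; rewrite -(ler_pM2l a0); apply: le_trans ak _.
have -> : alpha * ((2 / alpha + 1) * p) = 2 * p + alpha * p by field; rewrite gt_eqF.
by apply: lerD => //; rewrite ler_peMr// ltW.
Qed.

Lemma grid_sizes D h : (10 <= D)%N -> (0 < h)%N -> [/\ (0 < D * h)%N,
  (D * h + h.*2 <= D.+2 * h)%N, (D.+2 * h <= 2 * (D * h))%N &
  ((D.+2 * h).+1 <= h * (4 * D.+2))%N].
Proof.
move=> D10 h0; have : (10 * h <= D * h)%N by rewrite leq_mul2r D10 orbT.
rewrite (mulnCA h 4) (mulnC h D.+2) !mulSn; move: (D * h)%N => u; split; lia.
Qed.

Lemma mul_div272 (u : R) : 272 * (u / 272) = u.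
Proof. by field. Qed.

Lemma choose_translations (E : R) : 0 < E ->
  exists alpha, 0 < alpha <= 1 /\ 2 * alpha <= E / 8.
Proof.
move=> E0; exists (Num.min 1 (E / 16)); split.
  by rewrite lt_min ltr01 divr_gt0//= ge_min lexx.
have : Num.min 1 (E / 16) <= E / 16 by rewrite ge_min lexx orbT.
by move: (Num.min _ _) => a; lra.
Qed.

Lemma ltr0_1div (n : nat) : (0 < n)%N -> 0 < 1 / n%:R :> R.
Proof. by move=> n0; rewrite divr_gt0// ltr0n. Qed.

Lemma choose_kicks f0 k (E : R) : 0 < E -> exists e, 0 < e <= 1 / (5 * 1000 * 1000) /\
    forall t, t \in kicks e -> Ck_ball k E f0 (diffvol_comp (kick t) f0).
Proof.
have k1 : 0 < 1 / (5 * 1000 * 1000) :> R by rewrite !divr_gt0 ?mulr_gt0 ?ltr0n.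
move=> E0; have [e [e0 e1 h]] := kicks_close f0 k E0 k1.
exists e; split; last exact: h.
by apply/andP; split; [exact: e0|exact: e1].
Qed.

Lemma choose_twists (S : seq (DiffVol R)) k (E eta : R) : 0 < E -> 0 < eta ->
  exists e1 e2, [/\ 0 < e1 <= 1 / 2000, 0 < e2 <= 1 / 2000 &
    [/\ 0 < e1 <= eta / 272, 0 < e2 <= eta / 272 & forall f, f \in S ->
    forall g, g \in twists e1 e2 -> Ck_ball k (E + E) f (diffvol_comp g f)]].
Proof.
have p1 := @ltr0_1div 2000 erefl; have p272 : 0 < 272 :> R by rewrite ltr0n.
move=> E0 eta0; have m0 : 0 < Num.min (1 / 2000) (eta / 272).
  by rewrite lt_min p1 (divr_gt0 eta0 p272).
have [e1 [e2 [/andP[e10 +] /andP[e20 +] h]]] := twists_close S k E0 m0.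
rewrite !le_min => /andP[a1 a2] /andP[b1 b2].
by exists e1, e2; rewrite e10 e20 a1 a2 b1 b2.
Qed.

Lemma expanding_steps f0 k0 (E : R) : 0 < E -> exists (L : seq (DiffVol R)) (N : nat),
  [/\ (0 < size L)%N, forall f, f \in L -> Ck_ball k0 E f0 f &
  forall x v, enorm v = 1 -> 2 < Ex L N.+1 (fun f => ln (enorm (tdiff f x v)))].
Proof.
move=> E0; have E8 : 0 < E / 8 by rewrite divr_gt0.
have [alpha [alpha01 alphaE]] := choose_translations E0.
have alpha0 : 0 < alpha by case/andP: alpha01.
have [e0 [he0 kball]] := choose_kicks f0 k0 E8.
have [c c0 cE] := kick_rate he0.
pose F1 := [seq diffvol_comp (kick t) f0 | t <- kicks e0].
have [C1 C11 hC1] := tnorm_bounded_seq F1.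
have C2 : 1 <= 2 * C1 by have := C11; clear; lra.
pose lc := ln (2 * C1); have lc0 : 0 <= lc by exact: ln_ge0.
have [D [D10 Dlc]] := choose_ratio lc c0.
pose d : R := 4 / D.+2%:R.
have D0 : 0 < 4 * D.+2%:R :> R by rewrite mulr_gt0// ltr0n.
pose eta := alpha / (4 * D.+2%:R); have eta0 : 0 < eta by rewrite divr_gt0.
have [e1 [e2 [he1 he2 [h1 h2 tball]]]] := choose_twists F1 k0 E8 eta0.
have [C3 hC3] := twists_stretch he1 he2.
pose J := twists e1 e2; pose G := allpairs (@diffvol_comp R) J F1.
pose Q := 2 / alpha + 1.
have ratio h := @ratio_sqr R D h.
have [_ _ hd] := ratio 1%N erefl D10.
have C0 : 0 <= `|C3| + ln 2 + ln C1 by rewrite !addr_ge0// ln_ge0// ler1n.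
have [N [hN hQ]] := choose_length Q c0 C0 Dlc hd.
have hG f : f \in G -> forall x, tnorm f x <= 2 * C1.
  move=> /allpairsP[[g f1] [/= /allpairsP[[m n] [mi ni ->]] f1F ->]] x.
  move: (mi) (ni); rewrite !mem_iota !add0n => m16 n16.
  apply: le_trans (tnorm_comp_le (K := 2) (ler0n _ _) _) _.
    by move=> v; have [] := twist_bounds (f1 x) v he1 he2 m16 n16.
  by rewrite ler_pM2l ?ltr0n//; exact: hC1.
have [rho rho0 tame] := tame_word G N (ltr1n R 2).
have [h [h0 hrho]] : exists h, (0 < h)%N /\ rho^-1 < h%:R.
  have [h hh] := ge_natr rho^-1; exists h.+1; split => //.
  by apply: le_lt_trans hh _; rewrite ltr_nat.
pose n := (D.+2 * h)%N; pose p := (D * h)%N.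
have n0 : (0 < n)%N by rewrite muln_gt0.
have [p0 pn np nD] := grid_sizes D10 h0; rewrite -/p -/n in p0 pn np nD.
have [k [nk ak1 ak2]] := choose_mesh alpha01 n0.
have k_gt0 : (0 < k)%N by exact: leq_trans n0 nk.
pose L := steps (translates [seq gridpt R k l | l <- grid n] J) e0 f0.
have k0' : 0 < k%:R :> R by rewrite ltr0n.
have A0 : (0 < size (translates [seq gridpt R k l | l <- grid n] J))%N.
  by rewrite size_allpairs size_map size_grid muln_gt0 [in X in X && _]muln_gt0 n0 size_allpairs.
have L0 : (0 < size L)%N by rewrite size_allpairs muln_gt0 A0.
have hL f : f \in L -> exists a f', f' \in G /\ f = diffvol_comp (transl a) f'.
  move=> /mem_translates_steps[a [t [g [_ tk gJ ->]]]].
  exists a, (diffvol_comp g (diffvol_comp (kick t) f0)); split => //.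
  apply: allpairs_f; first exact: gJ.
  exact: (map_f (fun t => diffvol_comp (kick t) f0) tk).
have kr : k%:R^-1 < rho.
  rewrite -[rho]invrK ltf_pV2 ?posrE ?invr_gt0//; apply: lt_le_trans hrho _.
  by rewrite ler_nat; apply: leq_trans nk; exact: leq_pmull.
have pk : (p <= k)%N by apply: leq_trans nk; apply: leq_trans pn; exact: leq_addr.
pose M := expR (c * N%:R).
have M1 : 1 <= M by rewrite -expR0 ler_expR mulr_ge0// ltW.
have en := energy_decay f0 N A0 he0.
have hX : 64 * (k%:R ^+ 2 * M ^+ 2) * (((1 - e0 ^+ 2 / 160) ^+ 2) ^+ N * 4) <= p%:R ^+ 2 / 16.
  apply: (@growth_bound R c Q k%:R p%:R _ M N%:R) => //.
  - have np' : n%:R <= 2 * p%:R :> R by rewrite -natrM ler_nat.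
    have p1 : 1 <= p%:R :> R by rewrite ler1n.
    exact: (mesh_ratio alpha0 ak2 np' p1).
  - by rewrite ltr_pwDl// !mulr_ge0// ltW.
  - congr (_ * _); rewrite cE -!expRM_natl; congr expR; ring.
have hk : 272 * (eta / 272) * k%:R <= h%:R.
  rewrite mul_div272 /eta mulrAC ler_pdivrMr//.
  apply: le_trans ak2 _; case/andP: alpha01 => _ /(lerD (lexx n%:R)) /le_trans; apply.
  by rewrite natr1 -!natrM ler_nat.
exists L, N; split=> //.
  move=> f /mem_translates_steps[a [t [g [/mapP[l lg ->] tk gJ ->]]]].
  have b1 := kball t tk; have b2 := tball _ (map_f (fun t => diffvol_comp (kick t) f0) tk) g gJ.
  have al : enorm (gridpt R k l) < E / 8 by apply: lt_le_trans (gridpt_small k_gt0 ak1 lg) _.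
  have b3 := @transl_Ck_ball R k0 (E / 8) (diffvol_comp g (diffvol_comp (kick t) f0)) _ al.
  apply: (@Ck_ball_le R k0 k0 _ (E / 8 + (E / 8 + E / 8) + E / 8)) => //.
    by move: E0; clear; lra.
  exact: (Ck_ball_trans (Ck_ball_trans b1 b2) b3).
move=> x v v1.
pose W := ln M / 4 - d * (N%:R * lc + ln 2) - (`|C3| + ln 2) - ln C1.
apply: (@lt_le_trans _ _ W).
  rewrite /W expRK; move: hN; rewrite -/d.
  by move: (ln 2) (ln C1) (d * _) (c * _) => l2 l1 u s; clear; lra.
rewrite [leRHS](_ : _ = avg L (fun f => Ex L N (fun g =>
  ln (enorm (tdiff (diffvol_comp g f) x v)))))// avg_steps.
rewrite -[leLHS](avg_cst W (erefl : (0 < size (kicks e0))%N)).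
apply: ler_avg => t tk; have [q0 q1 _] := ratio h h0 D10.
have B0 : 0 <= N%:R * lc + ln 2 by rewrite addr_ge0 ?mulr_ge0// ln_ge0// ler1n.
case/andP: hd => _ d3.
have hB w := @word_ln_lower R G (2 * C1) N w C2 hG.
have hf1 := hC1 _ (map_f (fun t => diffvol_comp (kick t) f0) tk).
exact: (step_expansion hL tame L0 k_gt0 n0 p0 kr pn pk M1 en hX he1 he2 h1 h2 hk hB hC3 B0
  q0 q1 d3 C11 hf1 x v1).
Qed.

End expanding_steps.

Theorem theorem0p1 (R : realType) (U : set (DiffVol R)) :
  open U -> U !=set0 ->
  exists mu : probability (DiffVolBorel R) R,
    [/\ finitely_supported mu, msupport mu `<=` U & uniformly_expanding mu].
Proof.
rewrite openE_diffvol => oU [f0 /oU[k [E [E0 ballU]]]].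
have [L [N [L0 LU hL]]] := expanding_steps f0 k E0.
by apply: (udist_expanding_probability L0 _ hL) => f /LU /ballU.
Qed.
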